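(* Fix $\beta>\beta_c$, $c_\lambda>0$ and let $\lambda=c_\lambda/N$. There exist $C_1,C_2>0$ (depending on $\beta,c_\lambda$) such that for every set $\Gamma$ of admissible interfaces, $$\mu^\pm_{\lambda,N}(\mathscr I\in\Gamma)\le e^{C_1N^{1/3}}\mu^\pm_{0,N}(\mathscr I\in\Gamma)+e^{-C_2N}.$$
   Context: Standing setup. $\beta_c=\log(1+\sqrt2)$. Ising measure on finite $\Lambda\subset\mathbb Z^2$ with boundary condition $\eta$: $\mu^\eta_{\beta,\lambda,\Lambda}(\sigma)\propto\exp\big(-2\beta\big(\sum_{v\sim w,\,v,w\in\Lambda}\mathbf 1\{\sigma_v\ne\sigma_w\}+\sum_{v\sim w,\,v\in\Lambda,w\notin\Lambda}\mathbf 1\{\sigma_v\ne\eta_w\}\big)+\lambda\sum_{v\in\Lambda}\sigma_v\big)$; $\beta$ fixed and suppressed. $\Lambda_N=\{0,\dots,N\}^2$; $\mu^\pm_{\lambda,N}$ uses the Dobrushin boundary condition ($+$ at outside sites with $y\ge0$, $-$ with $y<0$); $\mu^\pm_{0,N}$ is the same with zero field. The interface $\mathscr I$ is the unique path component, joining $(-\tfrac12,-\tfrac12)$ to $(N+\tfrac12,-\tfrac12)$, of the set of dual edges separating differing spins, decomposed into edge-disjoint paths and loops by the south-east splitting rule (at a dual vertex of degree 3 or 4 the pair of edges south and east of it is split from the others, likewise north and west). An admissible interface is any simple path of dual edges of $\Lambda_N^*$ from $(-\tfrac12,-\tfrac12)$ to $(N+\tfrac12,-\tfrac12)$ that arises as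 $\mathscr I$ for some configuration. *)

(* Defs.v *)
From HB Require Import structures.
From mathcomp Require Import all_boot all_order all_algebra.
From mathcomp Require Import all_classical all_reals all_analysis.
Set Implicit Arguments. Unset Strict Implicit. Unset Printing Implicit Defensive.
Import Order.TTheory GRing.Theory Num.Theory.
Local Open Scope ring_scope.

Definition site := (int * int)%type.

Definition in_box (N : nat) (v : site) : bool :=
  (0 <= v.1 <= N%:Z) && (0 <= v.2 <= N%:Z).

(* spin configurations on Lambda_N : true = +1, false = -1 *)
Definition config (N : nat) := {ffun 'I_N.+1 * 'I_N.+1 -> bool}.

Definition dobrushin (w : site) : bool := (0 <= w.2).

Definition spin (N : nat) (s : config N) (v : site) : bool :=
  if in_box N v then s (inord `|v.1|%N, inord `|v.2|%N) else dobrushin v.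

Definition site_of (N : nat) (i : 'I_N.+1 * 'I_N.+1) : site :=
  ((nat_of_ord i.1)%:Z, (nat_of_ord i.2)%:Z).

Definition nbrs (v : site) : seq site :=
  [:: (v.1 + 1, v.2); (v.1, v.2 + 1); (v.1 - 1, v.2); (v.1, v.2 - 1)].

(* Hamiltonian: number of disagreeing nearest-neighbour pairs {v,w} with
   v,w in Lambda (each unordered pair counted once, via its right / upper
   neighbour), plus number of pairs v in Lambda, w outside, w ~ v,
   with sigma_v <> eta_w. *)
Definition right_of (v : site) : site := (v.1 + 1, v.2).
Definition up_of (v : site) : site := (v.1, v.2 + 1).

Definition local_energy (N : nat) (s : config N) (v : site) : nat :=
  addn (addn (in_box N (right_of v) && (spin s v != spin s (right_of v)))
             (in_box N (up_of v) && (spin s v != spin s (up_of v))))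
       (count (fun w => ~~ in_box N w && (spin s v != dobrushin w)) (nbrs v)).

Definition energy (N : nat) (s : config N) : nat :=
  \sum_(i : 'I_N.+1 * 'I_N.+1) local_energy s (site_of i).

Definition magnetization (R : realType) (N : nat) (s : config N) : R :=
  \sum_(i : 'I_N.+1 * 'I_N.+1) (if s i then 1 else -1).

Definition gibbs_weight (R : realType) (beta lambda : R) (N : nat)
  (s : config N) : R :=
  expR (- (2 * beta * (energy s)%:R) + lambda * magnetization R s).

(* A dual vertex (a,b) : int * int represents the point (a - 1/2, b - 1/2). *)
Definition dvertex := (int * int)%type.

Inductive dir := DN | DE | DS | DW.

Definition dir_to_nat (d : dir) : nat :=
  match d with DN => 0 | DE => 1 | DS => 2 | DW => 3 end.
Definition nat_to_dir (n : nat) : dir :=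
  match n with 0 => DN | 1 => DE | 2 => DS | _ => DW end.
Lemma dir_natK : cancel dir_to_nat nat_to_dir. Proof. by case. Qed.
HB.instance Definition _ := Equality.copy dir (can_type dir_natK).

Definition dstep (u : dvertex) (d : dir) : dvertex :=
  match d with
  | DN => (u.1, u.2 + 1) | DE => (u.1 + 1, u.2)
  | DS => (u.1, u.2 - 1) | DW => (u.1 - 1, u.2)
  end.

Definition dopp (d : dir) : dir :=
  match d with DN => DS | DS => DN | DE => DW | DW => DE end.

(* the two primal sites separated by the dual edge from u in direction d *)
Definition dsep (u : dvertex) (d : dir) : site * site :=
  let: (a, b) := u in
  match d with
  | DE => ((a, b - 1), (a, b))
  | DN => ((a - 1, b), (a, b))
  | DW => ((a - 1, b - 1), (a - 1, b))
  | DS => ((a - 1, b - 1), (a, b - 1))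
  end.

Definition dedge_in (N : nat) (s : config N) (u : dvertex) (d : dir) : bool :=
  let: (p, q) := dsep u d in
  (in_box N p || in_box N q) && (spin s p != spin s q).

Definition alldirs := [:: DN; DE; DS; DW].

Definition ddegree (N : nat) (s : config N) (u : dvertex) : nat :=
  count (dedge_in s u) alldirs.

(* south-east splitting rule: at a vertex of degree >= 3, the S and E edges
   are paired with each other, and so are the N and W edges *)
Definition se_partner (d : dir) : dir :=
  match d with DS => DE | DE => DS | DN => DW | DW => DN end.

(* Having arrived at u along the edge in direction din (pointing from u back
   to the previous vertex), the edge along which the path component of the
   split graph continues, if any. *)
Definition next_dir (N : nat) (s : config N) (u : dvertex) (din : dir)
  : option dir :=
  if ddegree s u == 2%N then
    ohead [seq d <- alldirs | dedge_in s u d & d != din]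
  else if (3 <= ddegree s u)%N then
    (if dedge_in s u (se_partner din) then Some (se_partner din) else None)
  else None.

(* endpoints: (-1/2,-1/2) and (N+1/2,-1/2) *)
Definition dstart : dvertex := (0, 0).
Definition dtarget (N : nat) : dvertex := (N.+1%:Z, 0).

Fixpoint walk (N : nat) (s : config N) (fuel : nat) (u : dvertex) (din : dir)
  : seq dvertex :=
  if u == dtarget N then [::] else
  match fuel with
  | 0 => [::]
  | f.+1 =>
    match next_dir s u din with
    | Some d => dstep u d :: walk s f (dstep u d) (dopp d)
    | None => [::]
    end
  end.

(* number of dual edges of Lambda_N^* bounds the length of any edge-disjoint walk *)
Definition walk_fuel (N : nat) : nat := (2 * (N.+2) * (N.+2))%N.

(* The interface I(sigma): the path component of the split graph of
   disagreement dual edges starting at (-1/2,-1/2), given as its sequence of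
   dual vertices (it ends at (N+1/2,-1/2)). *)
Definition interface (N : nat) (s : config N) : seq dvertex :=
  match ohead [seq d <- alldirs | dedge_in s dstart d] with
  | Some d0 => dstart :: dstep dstart d0 :: walk s (walk_fuel N) (dstep dstart d0) (dopp d0)
  | None => [:: dstart]
  end.

Definition admissible (N : nat) (g : seq dvertex) : Prop :=
  exists s : config N, interface s = g.

Definition mu_interface (R : realType) (beta lambda : R) (N : nat)
  (Gamma : pred (seq dvertex)) : R :=
  (\sum_(s : config N | Gamma (interface s)) gibbs_weight beta lambda s)
  / (\sum_(s : config N) gibbs_weight beta lambda s).

Definition beta_c (R : realType) : R := ln (1 + Num.sqrt 2).

(* Main.v *)
(** Since [beta_c] is twice the critical inverse temperature of these weights,
    [x = exp (- 2 beta)] satisfies [4 x < 1] and Peierls estimates are available.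

    Revealing the spins around the interface splits every event about it into
    cells.  The four functions theorem and the Peierls bound on the size of minus
    clusters show that, inside a cell with an interface of length O(N), switching
    on the field multiplies the weight by at most the factor it gives to the
    partition function with plus boundary condition, up to a constant.  Longer
    interfaces are exponentially unlikely: close up an initial trail of the
    interface by a straight path and flip what it surrounds.

    It remains to bound from below what the field does to the ratio of the
    Dobrushin and the plus partition functions.  By FKG this ratio decreases when
    all rows above height [2 h] are set to plus, where [h] is about [N^(1/3)], and
    there the field costs only exp (O(h)).  What is left is a comparison at zero
    field of the surface tension of the strip of height [2 h] with that of the
    full box.  The disorder operators [fermD] (Jordan-Wigner fermions) intertwine
    the transfer operators with minus and with plus bottom row through a second
    order relation with a tridiagonal matrix, whose bottom eigenvalue is
    [cosh tau + O(h^-2)]: the strip only loses exp (O(h + N / h^2)) = exp (O(N^(1/3))). *)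

Require Import Defs.
From HB Require Import structures.
From mathcomp Require Import all_boot all_order all_algebra.
From mathcomp Require Import all_classical all_reals all_analysis.
From mathcomp Require Import ring lra zify.
Set Implicit Arguments. Unset Strict Implicit. Unset Printing Implicit Defensive.
Import Order.TTheory GRing.Theory Num.Theory.
Import numFieldNormedType.Exports.
Local Open Scope ring_scope.

(** * Correlation inequalities *)

(** The comparison of surface tensions must not lose exp (O(N)). Perron eigenvalues control the
    partition functions of a box of height m only up to factors x^(O(m)): affordable in the strip,
    fatal in the full box. For the full box an upper bound on the ratio is enough, and there
    supermultiplicativity in the width removes the constant.

    The transfer operators are never diagonalised. Formally the fermion relation is T D T^-1 + T^-1
    D T = M D with M tridiagonal. If lp and lm are the Perron eigenvalues for the plus and minus
    bottom row, pairing with both Perron vectors makes lp/lm + lm/lp an eigenvalue of M, hence at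
    least 2 cosh tau. A combination of fermions weighted by the bottom eigenvector of M, tested in
    the Rayleigh quotient of the minus operator, gives the reverse bound up to O(h^-2).

    The spins frozen in a cell have both signs, so a cell is not a monotone event. It is therefore
    paired with the plus measure pinned to plus on the same sites, to which the field is
    transferred; undoing the pinning costs lambda times the mean size of the minus clusters of O(N)
    sites, which is O(1). *)

Lemma big_tuple_cons (V : nmodType) (T : finType) n (F : n.+1.-tuple T -> V) :
  \sum_t F t = \sum_a \sum_(t : n.-tuple T) F [tuple of a :: t].
Proof.
rewrite pair_big /= (reindex (fun p : T * n.-tuple T => [tuple of p.1 :: p.2])) //=.
exists (fun t : n.+1.-tuple T => (thead t, [tuple of behead t])) => [[a t] _|t _] /=.
  by congr pair; apply/val_inj.
by rewrite [RHS]tuple_eta; apply/val_inj.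
Qed.

Section FourFunctions.
Variable R : realFieldType.

(** The cross products p = [a0 * b1] and q = [a1 * b0] are at most r = [c0 * d1], and p q <= r
    [c1 * d0]. Expanding (r - p)(r - q) >= 0 gives p + q <= r + [c1 * d0]. *)
Lemma four_numbers (a0 a1 b0 b1 c0 c1 d0 d1 : R) :
  0 <= a0 -> 0 <= a1 -> 0 <= b0 -> 0 <= b1 ->
  0 <= c0 -> 0 <= c1 -> 0 <= d0 -> 0 <= d1 ->
  a0 * b0 <= c0 * d0 -> a0 * b1 <= c0 * d1 -> a1 * b0 <= c0 * d1 ->
  a1 * b1 <= c1 * d1 -> (a0 + a1) * (b0 + b1) <= (c0 + c1) * (d0 + d1).
Proof.
move=> a0p a1p b0p b1p c0p c1p d0p d1p h00 h01 h10 h11.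
suff : a0 * b1 + a1 * b0 <= c0 * d1 + c1 * d0 by lra.
have [r0|rn0] := eqVneq (c0 * d1) 0.
  by have := mulr_ge0 c1p d0p; lra.
have rp : 0 < c0 * d1 by rewrite lt_def rn0 mulr_ge0.
have pq : (a0 * b1) * (a1 * b0) <= (c0 * d1) * (c1 * d0).
  have -> : (a0 * b1) * (a1 * b0) = (a0 * b0) * (a1 * b1) by ring.
  have -> : (c0 * d1) * (c1 * d0) = (c0 * d0) * (c1 * d1) by ring.
  by apply: ler_pM => //; apply: mulr_ge0.
rewrite -(ler_pM2l rp).
have : 0 <= (c0 * d1 - a0 * b1) * (c0 * d1 - a1 * b0).
  by apply: mulr_ge0; rewrite subr_ge0.
by lra.
Qed.

Definition tand n (s t : n.-tuple bool) : n.-tuple bool :=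
  [tuple tnth s i && tnth t i | i < n].
Definition tor n (s t : n.-tuple bool) : n.-tuple bool :=
  [tuple tnth s i || tnth t i | i < n].

Lemma four_functions_tuple n (f g h k : n.-tuple bool -> R) :
  (forall s, 0 <= f s) -> (forall s, 0 <= g s) ->
  (forall s, 0 <= h s) -> (forall s, 0 <= k s) ->
  (forall s t, f s * g t <= h (tand s t) * k (tor s t)) ->
  (\sum_s f s) * (\sum_s g s) <= (\sum_s h s) * (\sum_s k s).
Proof.
elim: n f g h k => [|n IH] f g h k f0 g0 h0 k0 H.
  have E (u : 0.-tuple bool -> R) : \sum_s u s = u [tuple].
    rewrite (bigD1 [tuple]) //= big1 ?addr0 // => s /eqP; case.
    exact: tuple0.
  rewrite !E; have := H [tuple] [tuple].
  by rewrite (tuple0 (tand _ _)) (tuple0 (tor _ _)).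
have cA a b (s t : n.-tuple bool) :
    tand [tuple of a :: s] [tuple of b :: t] = [tuple of (a && b) :: tand s t].
  apply: eq_from_tnth => i; rewrite tnth_mktuple.
  by case: (unliftP ord0 i) => [j ->|->]; rewrite ?tnthS ?tnth0 ?tnth_mktuple.
have cO a b (s t : n.-tuple bool) :
    tor [tuple of a :: s] [tuple of b :: t] = [tuple of (a || b) :: tor s t].
  apply: eq_from_tnth => i; rewrite tnth_mktuple.
  by case: (unliftP ord0 i) => [j ->|->]; rewrite ?tnthS ?tnth0 ?tnth_mktuple.
have B (u : n.+1.-tuple bool -> R) :
    \sum_t u t = \sum_(t : n.-tuple bool) \sum_a u [tuple of a :: t].
  by rewrite big_tuple_cons exchange_big.
(* Each function is summed over its first bit; [four_numbers] supplies the hypothesis for the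
   remaining bits. *)
rewrite !B.
apply: IH => [s|s|s|s|s t]; rewrite ?sumr_ge0 //.
rewrite !big_bool /=.
have := H [tuple of true :: s] [tuple of true :: t].
have := H [tuple of false :: s] [tuple of true :: t].
have := H [tuple of true :: s] [tuple of false :: t].
have := H [tuple of false :: s] [tuple of false :: t].
rewrite !cA !cO /= => h1 h2 h3 h4.
rewrite [X in X * _ <= _]addrC [X in _ * X <= _]addrC.
by rewrite [X in _ <= X * _]addrC [X in _ <= _ * X]addrC four_numbers.
Qed.

Definition conf_meet (T : finType) (s t : {ffun T -> bool}) : {ffun T -> bool} :=
  [ffun i => s i && t i].
Definition conf_join (T : finType) (s t : {ffun T -> bool}) : {ffun T -> bool} :=
  [ffun i => s i || t i].

(* Ahlswede--Daykin *)
Lemma four_functions (T : finType) (f g h k : {ffun T -> bool} -> R) :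
  (forall s, 0 <= f s) -> (forall s, 0 <= g s) ->
  (forall s, 0 <= h s) -> (forall s, 0 <= k s) ->
  (forall s t, f s * g t <= h (conf_meet s t) * k (conf_join s t)) ->
  (\sum_s f s) * (\sum_s g s) <= (\sum_s h s) * (\sum_s k s).
Proof.
move=> f0 g0 h0 k0 H.
pose e (t : #|T|.-tuple bool) : {ffun T -> bool} := [ffun i => tnth t (enum_rank i)].
have eE (u : {ffun T -> bool} -> R) : \sum_s u s = \sum_t u (e t).
  apply: reindex; exists (fun s : {ffun T -> bool} => [tuple s (enum_val i) | i < #|T|]) => [t _|s _].
    by apply: eq_from_tnth => i; rewrite tnth_mktuple ffunE enum_valK.
  by apply/ffunP => i; rewrite ffunE tnth_mktuple enum_rankK.
rewrite !eE; apply: four_functions_tuple => // s t.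
suff [<- <-] : conf_meet (e s) (e t) = e (tand s t) /\ conf_join (e s) (e t) = e (tor s t) by [].
by split; apply/ffunP => i; rewrite !ffunE tnth_mktuple.
Qed.

End FourFunctions.

(** * Top eigenvectors of symmetric kernels *)

Section TopEigenvector.
Variable R : realType.

Definition qform (T : finType) (K : T -> T -> R) (f g : T -> R) : R :=
  \sum_s f s * \sum_t K s t * g t.

Lemma qformC (T : finType) (K : T -> T -> R) (f g : T -> R) :
  (forall s t, K s t = K t s) -> qform K f g = qform K g f.
Proof.
move=> Ksym; rewrite /qform.
under eq_bigr do rewrite big_distrr /=.
rewrite exchange_big /=; apply: eq_bigr => t _.
rewrite big_distrr /=; apply: eq_bigr => s _.
by rewrite (Ksym s t); ring.
Qed.

Lemma qformD (T : finType) (K : T -> T -> R) (f g : T -> R) (e : R) :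
  (forall s t, K s t = K t s) ->
  qform K (fun t => f t + e * g t) (fun t => f t + e * g t) =
  qform K f f + 2 * e * qform K g f + e ^+ 2 * qform K g g.
Proof.
move=> Ksym.
have E u : \sum_t K u t * (f t + e * g t) =
    \sum_t K u t * f t + e * \sum_t K u t * g t.
  by rewrite [e * _]big_distrr /= -big_split /=; apply: eq_bigr => t _; ring.
have -> : qform K (fun t => f t + e * g t) (fun t => f t + e * g t) =
    qform K f f + e * qform K f g + e * qform K g f + e ^+ 2 * qform K g g.
  rewrite /qform !big_distrr /= -!big_split /=; apply: eq_bigr => t _.
  by rewrite E; ring.
by rewrite (qformC f g Ksym); ring.
Qed.

(** Compactness of the unit sphere: functions on [T] are read as row vectors, where the extreme
    value theorem applies. *)
Lemma max_qform (T : finType) (t0 : T) (K : T -> T -> R) :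
  exists2 f : T -> R, \sum_t f t ^+ 2 = 1 &
    forall g, \sum_t g t ^+ 2 = 1 -> qform K g g <= qform K f f.
Proof.
pose n := #|T|.
pose F (v : 'rV[R]_n) (t : T) : R := v ord0 (enum_rank t).
pose A : set 'rV[R]_n := [set v | \sum_t F v t ^+ 2 = 1]%classic.
have cF t : continuous (F^~ t) by move=> v; exact: coord_continuous.
have csum (h : T -> 'rV[R]_n -> R) : (forall t, continuous (h t)) ->
    continuous (fun v => \sum_t h t v).
  by move=> ch; apply: continuous_big => // z; exact: add_continuous.
have cn : continuous (fun v => \sum_t F v t ^+ 2).
  by apply: csum => t v; apply: continuousM; exact: cF.
have cq : continuous (fun v => qform K (F v) (F v)).
  apply: (csum) => t v; apply: continuousM; first exact: cF.
  apply: csum => s u; apply: continuousM; [exact: cst_continuous|exact: cF].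
have Acl : closed A.
  by apply: (@closed_comp _ _ _ [set x : R | x = 1]%classic) => // v _; exact: cn.
have Ab : bounded_set A.
  exists 1; split => // y y1 v Av; apply: le_trans (ltW y1).
  rewrite [leLHS]/Num.norm /= mx_normrE; apply/bigmax_leP; split=> // -[i j] _ /=.
  have := Av; rewrite /A /= (bigD1 (enum_val j)) //= /F enum_valK => E.
  have : v ord0 j ^+ 2 <= 1.
    by rewrite -[leRHS]E lerDl sumr_ge0 // => t _; exact: sqr_ge0.
  by rewrite (ord1 i) -real_normK ?num_real // expr_le1.
have toF (f : T -> R) : exists v, F v =1 f.
  exists (\row_j f (enum_val j)) => t.
  by rewrite /F mxE enum_rankK.
have A0 : (A !=set0)%classic.
  have [v vE] := toF (fun t => (t == t0)%:R); exists v; rewrite /A /=.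
  rewrite (bigD1 t0) //= vE eqxx expr1n big1 ?addr0 // => t /negPf tt.
  by rewrite vE tt expr0n.
have [c cA cmax] := EVT_max_rV A0 (bounded_closed_compact Ab Acl) (continuous_subspaceT cq).
exists (F c); first by move: cA; rewrite inE.
move=> g g1; have [v vE] := toF g.
have -> : qform K g g = qform K (F v) (F v).
  by apply: eq_bigr => t _; rewrite vE; congr (_ * _); apply: eq_bigr => s _; rewrite vE.
apply: cmax; rewrite inE /A /= -g1; by apply: eq_bigr => t _; rewrite vE.
Qed.

Lemma max_qform_eigen (T : finType) (K : T -> T -> R) (f : T -> R) :
  (forall s t, K s t = K t s) -> \sum_t f t ^+ 2 = 1 ->
  (forall g, \sum_t g t ^+ 2 = 1 -> qform K g g <= qform K f f) ->
  (forall g, qform K g g <= qform K f f * \sum_t g t ^+ 2) /\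
  (forall s, \sum_t K s t * f t = qform K f f * f s).
Proof.
move=> Ksym f1 fmax; set l := qform K f f.
have hom g : qform K g g <= l * \sum_t g t ^+ 2.
  have [n0|n0] := eqVneq (\sum_t g t ^+ 2) 0.
    have g0 t : g t = 0.
      apply/eqP; rewrite -sqrf_eq0; apply/eqP.
      by apply: (psumr_eq0P _ n0) => // s _; exact: sqr_ge0.
    by rewrite n0 mulr0 /qform big1 // => t _; rewrite g0 mul0r.
  have np : 0 < \sum_t g t ^+ 2.
    by rewrite lt_def n0 sumr_ge0 // => t _; exact: sqr_ge0.
  set m := \sum_t g t ^+ 2 in np n0 *.
  have sm : Num.sqrt m ^+ 2 = m by rewrite sqr_sqrtr // ltW.
  have sm0 : Num.sqrt m != 0 by rewrite sqrtr_eq0 -ltNge.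
  have := fmax (fun t => g t / Num.sqrt m).
  have -> : \sum_t (g t / Num.sqrt m) ^+ 2 = 1.
    under eq_bigr do rewrite exprMn exprVn sm.
    by rewrite -big_distrl /= divff.
  have -> : qform K (fun t => g t / Num.sqrt m) (fun t => g t / Num.sqrt m) = qform K g g / m.
    rewrite /qform big_distrl /=; apply: eq_bigr => s _.
    rewrite -[in RHS]sm !big_distrr /= big_distrl /=; apply: eq_bigr => t _.
    by field.
  by move=> /(_ erefl); rewrite ler_pdivrMr.
split => // s.
pose g t := l * f t - \sum_u K t u * f u.
have gz : \sum_t g t ^+ 2 = 0.
  apply/eqP; rewrite eq_le sumr_ge0 ?andbT; last by move=> t _; exact: sqr_ge0.
  rewrite leNgt; apply/negP => gp.
  set G := \sum_t g t ^+ 2 in gp.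
  pose L := \sum_t g t * f t.
  have LK : G = l * L - qform K g f.
    rewrite /G /L /qform big_distrr /= -sumrB; apply: eq_bigr => t _.
    by rewrite /g; ring.
  (* derivative of the Rayleigh defect at f in direction - g *)
  have key e : 0 <= 2 * e * G + e ^+ 2 * (l * G - qform K g g).
    have := hom (fun t => f t + e * g t).
    rewrite qformD // -/l.
    have -> : \sum_t (f t + e * g t) ^+ 2 = 1 + 2 * e * L + e ^+ 2 * G.
      transitivity (\sum_t f t ^+ 2 + 2 * e * L + e ^+ 2 * G); last by rewrite f1.
      by rewrite /L /G !big_distrr /= -!big_split /=; apply: eq_bigr => t _; ring.
    rewrite LK; lra.
  set D := l * G - qform K g g in key.
  have Dp : 0 <= D by rewrite /D subr_ge0; apply: hom.
  (* A small step against [g] contradicts [key]: with this denominator q D <= G, so the quadratic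
     term q^2 D stays below the linear one 2 q G. *)
  have := key (- (G / (D + G + 1))).
  have E : 0 < D + G + 1 by lra.
  set q := G / (D + G + 1).
  have qp : 0 < q by apply: divr_gt0.
  have qE : q * (D + G + 1) = G by rewrite /q divfK // gt_eqF.
  have : 0 < q * G by apply: mulr_gt0.
  have : q * q * D <= q * G.
    rewrite -mulrA ler_pM2l // -qE ler_pM2l //; lra.
  by move=> h1 h2 h3; have := h3; rewrite sqrrN expr2; lra.
have : g s = 0.
  apply/eqP; rewrite -sqrf_eq0; apply/eqP.
  by apply: (psumr_eq0P _ gz) => // t _; exact: sqr_ge0.
by rewrite /g => /eqP; rewrite subr_eq0 => /eqP ->.
Qed.

(** Replacing a maximiser by its absolute value does not decrease the form: off-diagonal entries are
    nonnegative and diagonal terms only see squares. The diagonal may thus have any sign, as in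
    [tridiag]. *)
Lemma top_eigenvector (T : finType) (t0 : T) (K : T -> T -> R) :
  (forall s t, K s t = K t s) -> (forall s t, s != t -> 0 <= K s t) ->
  exists (f : T -> R) (l : R),
    [/\ \sum_t f t ^+ 2 = 1, forall t, 0 <= f t,
        forall s, \sum_t K s t * f t = l * f s &
        forall g, qform K g g <= l * \sum_t g t ^+ 2].
Proof.
move=> Ksym K0; have [f f1 fmax] := max_qform t0 K.
pose h t := `|f t|.
have h1 : \sum_t h t ^+ 2 = 1.
  by rewrite -f1; apply: eq_bigr => t _; rewrite real_normK // num_real.
have fh : qform K f f <= qform K h h.
  apply: ler_sum => s _; rewrite !big_distrr /=; apply: ler_sum => t _.
  have [<-|st] := eqVneq s t.
    have E : f s * f s = h s * h s by rewrite -!expr2 real_normK // num_real.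
    by rewrite mulrCA E mulrCA.
  rewrite mulrCA [leRHS]mulrCA ler_wpM2l ?K0 // /h -normrM; exact: ler_norm.
have hmax g : \sum_t g t ^+ 2 = 1 -> qform K g g <= qform K h h.
  by move=> g1; apply: le_trans fh; exact: fmax.
have [H1 H2] := max_qform_eigen Ksym h1 hmax.
by exists h, (qform K h h); split => // t; exact: normr_ge0.
Qed.

End TopEigenvector.

(** * The column transfer operator and its fermions *)

Section Transfer.
Variables (R : realType) (H : nat) (x : R).
Hypotheses (x0 : 0 < x) (x1 : x < 1).

Definition column := {ffun 'I_H -> bool}.

(* heights start at the boundary spin b: row j.-1 of the column has height j *)
Definition cval (b : bool) (c : column) (j : nat) : bool :=
  if j is k.+1 then (if insub k is Some i then c i else true) else b.

Arguments cval : simpl never.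

Definition hweight (c d : column) : R := \prod_i (if c i == d i then 1 else x).
Definition vweight (b : bool) (c : column) : R :=
  \prod_(j < H.+1) (if cval b c j == cval b c j.+1 then 1 else x).
Definition sgb (b : bool) : R := if b then 1 else -1.
(** With the bottom spin turned from plus to minus as well, all heights up to [j] are reversed: this
    inserts a domain wall just above height [j]. *)
Definition flip (j : nat) (c : column) : column := [ffun i => c i (+) (i < j)%N].
Definition flip1 (k : 'I_H) (c : column) : column := [ffun i => c i (+) (i == k)].

Definition hop (f : column -> R) (c : column) : R := \sum_d hweight c d * f d.
Definition transfer (b : bool) (f : column -> R) : column -> R :=
  hop (fun d => vweight b d * f d).

(* the two Jordan-Wigner fermions of height j, as maps from functions of columns
   above a + to functions of columns above a - *)
Definition fermA (j : nat) (f : column -> R) (c : column) : R :=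
  - sgb (cval false c j) * f (flip j c).
Definition fermB (j : nat) (f : column -> R) (c : column) : R :=
  sgb (cval false c j.+1) * f (flip j c).

(** For x = exp (-2 beta) and the dual coupling beta' given by tanh beta' = x, these are cosh and
    sinh of 2 beta', then of 2 beta. *)
Definition cosh_dual : R := (1 + x ^+ 2) / (1 - x ^+ 2).
Definition sinh_dual : R := 2 * x / (1 - x ^+ 2).
Definition cosh_bond : R := (1 + x ^+ 2) / (2 * x).
Definition sinh_bond : R := (1 - x ^+ 2) / (2 * x).

Let xn0 : x != 0. Proof. by rewrite gt_eqF. Qed.
Let x2n0 : 1 - x ^+ 2 != 0.
Proof. by rewrite subr_eq0 eq_sym lt_eqF // expr_lt1 // ltW. Qed.

Lemma sgb2 b : sgb b * sgb b = 1. Proof. by case: b; rewrite /sgb; ring. Qed.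

Lemma flipK j : involutive (flip j).
Proof. by move=> c; apply/ffunP => i; rewrite !ffunE addbK. Qed.

Lemma flip_flip1 (k : 'I_H) c : flip k (flip1 k c) = flip k.+1 c.
Proof.
apply/ffunP => i; rewrite !ffunE -addbA; congr addb.
by rewrite -val_eqE /= ltnS; case: ltngtP.
Qed.

Lemma flipS_flip1 (k : 'I_H) c : flip k.+1 (flip1 k c) = flip k c.
Proof.
apply/ffunP => i; rewrite !ffunE -addbA; congr addb.
by rewrite -val_eqE /= ltnS; case: ltngtP.
Qed.

Lemma cvalS b c (k : 'I_H) : cval b c k.+1 = c k.
Proof. by rewrite /cval insubT /= => [|?]; first exact: ltn_ord; congr (c _); apply/val_inj. Qed.

Lemma cval_top b c : cval b c H.+1 = true.
Proof. by rewrite /cval insubF // ltnn. Qed.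

Lemma hweightC c d : hweight c d = hweight d c.
Proof. by apply: eq_bigr => i _; rewrite eq_sym. Qed.

Lemma hweight_flip j c d : hweight (flip j c) (flip j d) = hweight c d.
Proof. by apply: eq_bigr => i _; rewrite !ffunE (inj_eq (@addIb _)). Qed.

Lemma hop_flip j f c : hop (fun d => f (flip j d)) c = hop f (flip j c).
Proof.
rewrite /hop [RHS](reindex_inj (inv_inj (@flipK j))) /=.
by apply: eq_bigr => d _; rewrite hweight_flip.
Qed.

Lemma eq_hop f g c : f =1 g -> hop f c = hop g c.
Proof. by move=> fg; apply: eq_bigr => d _; rewrite fg. Qed.

Lemma hopD a b f g c : hop (fun d => a * f d + b * g d) c = a * hop f c + b * hop g c.
Proof. by rewrite /hop !big_distrr -big_split /=; apply: eq_bigr => d _; ring. Qed.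

(** The kernel is a product over rows, so moving the spin of row [k] across it is a 2 by 2
    computation: a hyperbolic rotation by the dual coupling. *)
Lemma hweight_sg (k : 'I_H) c d :
  hweight c d * sgb (d k) =
  sgb (c k) * (cosh_dual * hweight c d - sinh_dual * hweight (flip1 k c) d).
Proof.
have E : \prod_(i | i != k) (if flip1 k c i == d i then 1 else x) =
         \prod_(i | i != k) (if c i == d i then 1 else x).
  by apply: eq_bigr => i /negPf ik; rewrite ffunE ik addbF.
rewrite /hweight (bigD1 k) //= [X in sinh_dual * X](bigD1 k) //= E ffunE eqxx addbT.
set P := \prod_(i | _) _.
by case: (c k); case: (d k) => /=; rewrite /cosh_dual /sinh_dual /sgb; field.
Qed.

Lemma hop_sg (k : 'I_H) j f c :
  hop (fun d => sgb (d k) * f (flip j d)) c =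
  sgb (c k) * (cosh_dual * hop f (flip j c) - sinh_dual * hop f (flip j (flip1 k c))).
Proof.
rewrite -!hop_flip /hop !big_distrr /= -sumrB big_distrr /=.
by apply: eq_bigr => d _; rewrite mulrA hweight_sg; ring.
Qed.

(** [hop] mixes only [fermB k] with [fermA k.+1], the fermions on either side of row [k], while
    [vweight] mixes only [fermA j] with [fermB j]. Both factors of the transfer operator thus act
    linearly on the span of the fermions. *)
Lemma hop_fermB (k : 'I_H) f c :
  hop (fermB k f) c = cosh_dual * fermB k (hop f) c + sinh_dual * fermA k.+1 (hop f) c.
Proof.
rewrite /fermB /fermA (cvalS _ c).
under eq_hop do rewrite cvalS.
by rewrite hop_sg flip_flip1; ring.
Qed.

Lemma hop_fermA (k : 'I_H) f c :
  hop (fermA k.+1 f) c = cosh_dual * fermA k.+1 (hop f) c + sinh_dual * fermB k (hop f) c.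
Proof.
rewrite /fermB /fermA (cvalS _ c).
rewrite (@eq_hop _ (fun d => (-1) * (sgb (d k) * f (flip k.+1 d)) + 0 * f d)); last first.
  by move=> d; rewrite cvalS; ring.
by rewrite hopD hop_sg flipS_flip1; ring.
Qed.

(** The end fermions [fermA 0] and [fermB H] carry frozen boundary spins, which [hop] does not
    rotate; hence the exceptional end entries of [mdiag]. *)
Lemma hop_fermA0 f c : hop (fermA 0 f) c = fermA 0 (hop f) c.
Proof.
rewrite /fermA /= -hop_flip.
rewrite (@eq_hop _ (fun d => 1 * f (flip 0 d) + 0 * f d)) ?hopD; first by rewrite /sgb; ring.
by move=> d; rewrite /sgb; ring.
Qed.

Lemma hop_fermBH f c : hop (fermB H f) c = fermB H (hop f) c.
Proof.
rewrite /fermB !cval_top -hop_flip.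
rewrite (@eq_hop _ (fun d => 1 * f (flip H d) + 0 * f d)) ?hopD; first by rewrite /sgb; ring.
by move=> d; rewrite cval_top /sgb; ring.
Qed.

Lemma cval_flip c j k : (k <= H.+1)%N -> (j <= H)%N ->
  cval true (flip j c) k = cval false c k (+) (k <= j)%N.
Proof.
move=> kH jH; case: k kH => [//|k] kH.
rewrite ltnS leq_eqVlt in kH; case/orP: kH => [/eqP ->|kH].
  by rewrite !cval_top ltnNge jH.
by rewrite !(cvalS _ _ (Ordinal kH)) ffunE.
Qed.

(** The flip changes the status of a single bond, between heights [j] and [j.+1]; the prefactor is
    1/x if the spins of [c] agree there and x otherwise. *)
Lemma vweight_flip j c : (j <= H)%N ->
  vweight false c =
  (cosh_bond + sinh_bond * (sgb (cval false c j) * sgb (cval false c j.+1))) * vweight true (flip j c).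
Proof.
move=> jH; have jH' : (j < H.+1)%N by [].
rewrite /vweight [LHS](bigD1 (Ordinal jH')) //= [X in _ = _ * X](bigD1 (Ordinal jH')) //=.
have -> : cval true (flip j c) j = ~~ cval false c j.
  by rewrite cval_flip ?leqnn ?addbT // ltnW.
have -> : cval true (flip j c) j.+1 = cval false c j.+1.
  by rewrite cval_flip ?ltnn ?addbF.
rewrite [X in _ = _ * (_ * X)](eq_bigr (fun i : 'I_H.+1 => if cval false c i == cval false c i.+1 then 1 else x)); last first.
  move=> i; rewrite -val_eqE /= => ij.
  have iH : (i <= H)%N by rewrite -ltnS.
  rewrite (cval_flip c (leqW iH) jH) cval_flip //.
  by rewrite [(i <= j)%N]leq_eqVlt (negPf ij) /= (inj_eq (@addIb _)).
set P := \prod_(i | _) _.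
have h0 : 2 * x != 0 by rewrite mulf_neq0 // pnatr_eq0.
by case: (cval false c j); case: (cval false c j.+1); rewrite /= /sgb /cosh_bond /sinh_bond; field; rewrite ?xn0.
Qed.

Lemma vweight_fermA j f c : (j <= H)%N ->
  vweight false c * fermA j f c =
  cosh_bond * fermA j (fun d => vweight true d * f d) c
  - sinh_bond * fermB j (fun d => vweight true d * f d) c.
Proof.
move=> jH; rewrite (vweight_flip c jH) /fermA /fermB.
have := sgb2 (cval false c j); set u := sgb _; set v := sgb _ => u2.
set V := vweight true _; transitivity (- (cosh_bond * u * V * f (flip j c)) - sinh_bond * (u * u) * v * V * f (flip j c)).
  by ring.
by rewrite u2; ring.
Qed.

Lemma vweight_fermB j f c : (j <= H)%N ->
  vweight false c * fermB j f c =
  cosh_bond * fermB j (fun d => vweight true d * f d) c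
  - sinh_bond * fermA j (fun d => vweight true d * f d) c.
Proof.
move=> jH; rewrite (vweight_flip c jH) /fermA /fermB.
have := sgb2 (cval false c j.+1); set u := sgb _; set v := sgb _ => u2.
set V := vweight true _; transitivity ((cosh_bond * u * V * f (flip j c)) + sinh_bond * (u * u) * v * V * f (flip j c)).
  by ring.
by rewrite u2; ring.
Qed.

End Transfer.
Arguments cval : simpl never.

(** * The second order relation between fermions and transfer operators *)

Section FermionRelation.
Variables (R : realType) (H : nat) (x : R).
Hypotheses (x0 : 0 < x) (x1 : x < 1) (H0 : (0 < H)%N).

Let xn0 : x != 0. Proof. by rewrite gt_eqF. Qed.
Let x2n0 : 1 - x ^+ 2 != 0.
Proof. by rewrite subr_eq0 eq_sym lt_eqF // expr_lt1 // ltW. Qed.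

Notation column := (column H).
Notation fA := (@fermA R H).
Notation fB := (@fermB R H).
Notation hop := (@hop R H x).
Notation Tr := (@transfer R H x).
Notation Cs := (cosh_dual x). Notation Ss := (sinh_dual x).
Notation Cv := (cosh_bond x). Notation Sv := (sinh_bond x).
Notation V := (vweight x true).
Implicit Types (f g : column -> R) (c d : column).

(** The coefficients are proportional to cosh beta and sinh beta: half of the rotation performed by
    [vweight]. Moving [vweight] across then only changes the sign of the [fermB] part, as [VD]
    states. *)
Definition fermD (j : nat) f c : R := (1 + x) * fA j f c + (1 - x) * fB j f c.

(** The prefactors are cosh^2 beta and sinh^2 beta, the shares of [fermA] and [fermB] in [fermD].
    The bulk value is [Cv * Cs]; an end fermion commutes with [hop] and has 1 in place of [Cs]. *)
Definition mdiag (j : nat) : R :=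
  (Cv + 1) / 2 * (if j == 0%N then 1 else Cs) + (Cv - 1) / 2 * (if j == H then 1 else Cs).

(** [e = 1] is the rotation produced by [hop], [e = -1] its inverse. *)
Let pA (e : R) (j : nat) g c := if j is k.+1 then Cs * fA j g c + e * Ss * fB k g c else fA 0 g c.
Let pB (e : R) (j : nat) g c := if (j == H)%N then fB H g c else Cs * fB j g c + e * Ss * fA j.+1 g c.

Let CS1 : Cs ^+ 2 - Ss ^+ 2 = 1.
Proof. by rewrite /cosh_dual /sinh_dual; field. Qed.
Let CV1 : Cv ^+ 2 - Sv ^+ 2 = 1.
Proof. by rewrite /cosh_bond /sinh_bond; field. Qed.

Let hop_pA j g c : (j <= H)%N -> hop (fA j g) c = pA 1 j (hop g) c.
Proof.
case: j => [|k] kH; first by rewrite hop_fermA0.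
by rewrite (hop_fermA x0 x1 (Ordinal kH)) /= mul1r.
Qed.

Let hop_pB j g c : (j <= H)%N -> hop (fB j g) c = pB 1 j (hop g) c.
Proof.
move=> jH; rewrite /pB; case: eqVneq => [->|jnH]; first by rewrite hop_fermBH.
have jH' : (j < H)%N by rewrite ltn_neqAle jnH.
by rewrite (hop_fermB x0 x1 (Ordinal jH')) /= mul1r.
Qed.

Let hop_qA j g c : (j <= H)%N -> hop (pA (-1) j g) c = fA j (hop g) c.
Proof.
case: j => [|k] kH; first by rewrite /= hop_fermA0.
rewrite /pA hopD (hop_fermA x0 x1 (Ordinal kH)) (hop_fermB x0 x1 (Ordinal kH)) /=.
set a := fermA _ _ _; set b := fermB _ _ _.
transitivity ((Cs ^+ 2 - Ss ^+ 2) * a); first by ring.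
by rewrite CS1 mul1r.
Qed.

Let hop_qB j g c : (j <= H)%N -> hop (pB (-1) j g) c = fB j (hop g) c.
Proof.
move=> jH; rewrite /pB; case: eqVneq => [->|jnH]; first by rewrite hop_fermBH.
have jH' : (j < H)%N by rewrite ltn_neqAle jnH.
rewrite hopD (hop_fermA x0 x1 (Ordinal jH')) (hop_fermB x0 x1 (Ordinal jH')) /=.
set a := fermA _ _ _; set b := fermB _ _ _.
transitivity ((Cs ^+ 2 - Ss ^+ 2) * b); first by ring.
by rewrite CS1 mul1r.
Qed.

Let VA j g c : (j <= H)%N -> fA j (fun d => V d * g d) c =
  vweight x false c * (Cv * fA j g c + Sv * fB j g c).
Proof.
move=> jH; have hA := vweight_fermA x0 g c jH; have hB := vweight_fermB x0 g c jH.
set v := vweight _ _ _ in hA hB *.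
transitivity (Cv * (v * fA j g c) + Sv * (v * fB j g c)); last by ring.
rewrite hA hB; set a := fermA _ _ _; set b := fermB _ _ _.
transitivity ((Cv ^+ 2 - Sv ^+ 2) * a); last by ring.
by rewrite CV1 mul1r.
Qed.

Let VB j g c : (j <= H)%N -> fB j (fun d => V d * g d) c =
  vweight x false c * (Cv * fB j g c + Sv * fA j g c).
Proof.
move=> jH; have hA := vweight_fermA x0 g c jH; have hB := vweight_fermB x0 g c jH.
set v := vweight _ _ _ in hA hB *.
transitivity (Cv * (v * fB j g c) + Sv * (v * fA j g c)); last by ring.
rewrite hA hB; set a := fermA _ _ _; set b := fermB _ _ _.
transitivity ((Cv ^+ 2 - Sv ^+ 2) * b); last by ring.
by rewrite CV1 mul1r.
Qed.

Let VD j g c : (j <= H)%N -> vweight x false c * fermD j g c =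
  (1 + x) * fA j (fun d => V d * g d) c + (- (1 - x)) * fB j (fun d => V d * g d) c.
Proof.
move=> jH; rewrite VA // VB // /fermD; set v := vweight _ _ _.
by rewrite /cosh_bond /sinh_bond; field.
Qed.

Let TD j f c : (j <= H)%N ->
  Tr false (fermD j f) c = (1 + x) * pA 1 j (Tr true f) c - (1 - x) * pB 1 j (Tr true f) c.
Proof.
move=> jH; rewrite /transfer.
by rewrite (eq_hop _ _ (fun d => VD f d jH)) hopD hop_pA // hop_pB // mulNr.
Qed.

Let DT j g c : (j <= H)%N -> fermD j (Tr true g) c =
  Tr false (fun d =>
    (1 + x) * (if j is k.+1 then Cs * (Cv * fA j g d + Sv * fB j g d)
                                - Ss * (Cv * fB k g d + Sv * fA k g d)
               else Cv * fA 0 g d + Sv * fB 0 g d) +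
    (1 - x) * (if j == H then Cv * fB H g d + Sv * fA H g d
               else Cs * (Cv * fB j g d + Sv * fA j g d)
                    - Ss * (Cv * fA j.+1 g d + Sv * fB j.+1 g d))) c.
Proof.
move=> jH; rewrite /fermD /transfer -hop_qA // -hop_qB // -hopD.
apply: eq_hop => d; set v := vweight x false d.
have -> : pA (-1) j (fun d0 => V d0 * g d0) d = v *
   (if j is k.+1 then Cs * (Cv * fA j g d + Sv * fB j g d)
                                - Ss * (Cv * fB k g d + Sv * fA k g d)
               else Cv * fA 0 g d + Sv * fB 0 g d).
  case: j jH => [|k] kH /=; first by rewrite VA.
  by rewrite VA // VB 1?ltnW // -/v; ring.
have -> : pB (-1) j (fun d0 => V d0 * g d0) d = v *
   (if j == H then Cv * fB H g d + Sv * fA H g d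
               else Cs * (Cv * fB j g d + Sv * fA j g d)
                    - Ss * (Cv * fA j.+1 g d + Sv * fB j.+1 g d)).
  rewrite /pB; case: eqVneq => [_|jnH]; first by rewrite VB.
  have jH' : (j < H)%N by rewrite ltn_neqAle jnH.
  by rewrite VB // VA // -/v; ring.
ring.
Qed.

Lemma transferD b (u v : R) f g c :
  Tr b (fun d => u * f d + v * g d) c = u * Tr b f c + v * Tr b g c.
Proof. by rewrite /transfer -hopD; apply: eq_hop => d; ring. Qed.

(** A single conjugation by the transfer operator leaves the span of the [fermD]; the sum of the
    conjugation and its inverse stays inside, coupling [j] only to its neighbours. Multiplying by
    one more transfer on each side avoids inverting the operators. *)
Lemma transfer_fermD j f c : (j <= H)%N ->
  Tr false (Tr false (fermD j f)) c + fermD j (Tr true (Tr true f)) c =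
  Tr false (fun d => 2 * mdiag j * fermD j (Tr true f) d
    - (if j is k.+1 then fermD k (Tr true f) d else 0)
    - (if (j < H)%N then fermD j.+1 (Tr true f) d else 0)) c.
Proof.
move=> jH; set g := Tr true f.
have -> : Tr false (Tr false (fermD j f)) c =
   Tr false (fun d => (1 + x) * pA 1 j g d - (1 - x) * pB 1 j g d) c.
  by apply: eq_hop => d; rewrite TD.
(* The factors 1 give the sum the shape needed for [transferD]; what remains is an identity between
   fermions applied to [g]. *)
rewrite (DT g) // -[LHS]mulr1 mulrDl -{1}(mulr1 (Tr _ _ _)).
set F1 := (X in Tr false X c * 1 * 1 + _); set F2 := (X in _ + Tr false X c * 1).
rewrite mulr1 ![_ * 1]mulrC -transferD; apply: eq_hop => d; congr (_ * _).
rewrite {}/F1 {}/F2 /mdiag /fermD /pA /pB !mul1r.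
case: j jH => [|k] jH.
  rewrite H0 eqxx ltn_eqF //.
  set a := fermA _ _ _; set b := fermB _ _ _; set a' := fermA _ _ _; set b' := fermB _ _ _.
  by rewrite /cosh_bond /sinh_bond /cosh_dual /sinh_dual; field; rewrite ?xn0 ?x2n0 ?pnatr_eq0.
have -> : (k.+1 == 0)%N = false by [].
have [E|kn] := eqVneq k.+1 H.
  have -> : fB H g d = fB k.+1 g d by rewrite E.
  have -> : fA H g d = fA k.+1 g d by rewrite E.
  have -> : (k.+1 < H)%N = false by rewrite E ltnn.
  set a := fermA _ _ _; set b := fermB _ _ _; set b' := fermB _ _ _; set a' := fermA _ _ _.
  by rewrite /cosh_bond /sinh_bond /cosh_dual /sinh_dual; field; rewrite ?xn0 ?x2n0 ?pnatr_eq0.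
have -> : (k.+1 < H)%N by rewrite ltn_neqAle kn.
set a := fA k.+1 _ _; set b := fB k.+1 _ _; set b' := fB k _ _; set a' := fA k _ _.
set b'' := fB k.+2 _ _; set a'' := fA k.+2 _ _.
by rewrite /cosh_bond /sinh_bond /cosh_dual /sinh_dual; field; rewrite ?xn0 ?x2n0 ?pnatr_eq0.
Qed.

End FermionRelation.

(** * Perron eigenvectors and the tridiagonal form of the fermion relation *)

Section Perron.
Variables (R : realType) (H : nat) (x : R).
Hypotheses (x0 : 0 < x) (x1 : x < 1).
Notation column := (column H).
Notation hop := (@hop R H x).
Notation Tr := (@transfer R H x).
Implicit Types (f g : column -> R) (c d : column) (b : bool).

Lemma vweight_gt0 b c : 0 < vweight x b c.
Proof. by apply: prodr_gt0 => j _; case: ifP. Qed.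

Lemma hweight_gt0 c d : 0 < hweight x c d.
Proof. by apply: prodr_gt0 => j _; case: ifP. Qed.

Lemma hweight_le1 c d : hweight x c d <= 1.
Proof. by apply: prodr_ile1 => j _; case: ifP => _; rewrite ?lexx ?ler01 // (ltW x0) (ltW x1). Qed.

Lemma hweight_ge c d : x ^+ H <= hweight x c d.
Proof.
rewrite -[X in x ^+ X]card_ord -prodr_const; apply: ler_prod => j _.
by rewrite (ltW x0) /=; case: ifP => _ //; exact: ltW.
Qed.

(** The inner product for which [Tr b] is self-adjoint. *)
Definition vdot b f g : R := \sum_c vweight x b c * f c * g c.

Lemma vdot_transferC b f g : vdot b f (Tr b g) = vdot b (Tr b f) g.
Proof.
rewrite /vdot /transfer /hop.
under eq_bigr do rewrite big_distrr /=.
rewrite exchange_big /=; apply: eq_bigr => d _.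
rewrite big_distrr big_distrl /=; apply: eq_bigr => c _.
by rewrite (hweightC x c d); ring.
Qed.

Lemma vdot_ge0 b f : 0 <= vdot b f f.
Proof.
by apply: sumr_ge0 => c _; rewrite -mulrA mulr_ge0 ?(ltW (vweight_gt0 _ _)) // -expr2 sqr_ge0.
Qed.

(** The square root [r] of [vweight] conjugates [Tr b] to the symmetric kernel [K], and an
    eigenvector of [K] divided by [r] is one of [Tr b]. Since all entries of [K] are positive, a
    nonnegative eigenvector is strictly positive. *)
Lemma perron b : exists (l : R) (w : column -> R),
  [/\ 0 < l, forall c, 0 < w c, forall c, Tr b w c = l * w c &
      forall f, vdot b f (Tr b f) <= l * vdot b f f].
Proof.
pose r c := Num.sqrt (vweight x b c).
have r2 c : r c * r c = vweight x b c.
  by rewrite -expr2 sqr_sqrtr // ltW // vweight_gt0.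
have r0 c : 0 < r c by rewrite sqrtr_gt0 vweight_gt0.
pose K c d := r c * hweight x c d * r d.
have K0 c d : 0 < K c d by rewrite !mulr_gt0 // hweight_gt0.
have Ksym c d : K c d = K d c by rewrite /K (hweightC x c d); ring.
have [h [l [h1 h0 hE hmax]]] := top_eigenvector [ffun=> true] Ksym (fun s t _ => ltW (K0 s t)).
have [t tp] : exists t, 0 < h t.
  apply/existsP; rewrite -[X in is_true X]negbK negb_exists; apply/negP => /forallP hn.
  have : \sum_t h t ^+ 2 = 0.
    apply: big1 => t _; have := hn t; rewrite -leNgt => tn.
    by have -> : h t = 0; [apply/le_anti; rewrite tn h0|rewrite expr0n].
  by rewrite h1 => /eqP; rewrite oner_eq0.
have lh s : 0 < l * h s.
  rewrite -hE (bigD1 t) //=; apply: ltr_wpDr; last by rewrite mulr_gt0.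
  by apply: sumr_ge0 => u _; rewrite mulr_ge0 // ltW.
have hp s : 0 < h s.
  rewrite lt_def h0 andbT; apply/eqP => hs; have := lh s.
  by rewrite hs mulr0 ltxx.
have lp : 0 < l by have := lh t; rewrite pmulr_lgt0.
exists l, (fun c => h c / r c); split => //.
- by move=> c; rewrite divr_gt0.
- move=> c; rewrite /transfer /hop mulrA -hE big_distrl /=.
  apply: eq_bigr => d _; rewrite /K -r2.
  by field; rewrite !gt_eqF.
move=> f; have := hmax (fun c => r c * f c).
have -> : qform K (fun c => r c * f c) (fun c => r c * f c) = vdot b f (Tr b f).
  rewrite /qform /vdot /transfer /hop; apply: eq_bigr => c _.
  rewrite !big_distrr /=; apply: eq_bigr => d _.
  by rewrite /K -!r2; ring.
have -> : \sum_c (r c * f c) ^+ 2 = vdot b f f.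
  by rewrite /vdot; apply: eq_bigr => c _; rewrite -!r2; ring.
by [].
Qed.

Definition topcol : column := [ffun=> true].
Definition Zcol b n : R := iter n (Tr b) (fun c => hweight x c topcol) topcol.

Lemma transfer_le b f g : (forall c, f c <= g c) -> forall c, Tr b f c <= Tr b g c.
Proof.
move=> fg c; apply: ler_sum => d _; rewrite ler_pM2l ?hweight_gt0 //.
by rewrite ler_pM2l ?vweight_gt0.
Qed.

Lemma transferZ b (u : R) f c : Tr b (fun d => u * f d) c = u * Tr b f c.
Proof. by rewrite /transfer /hop big_distrr /=; apply: eq_bigr => d _; ring. Qed.

(** The entries of [hweight] lie between [x ^+ H] and 1, so [w] varies at most by the factor
    [x ^+ H] and the boundary vector is comparable to it. The loss depends on the height and not on
    [n]. *)
Lemma Zcol_bounds b (l : R) (w : column -> R) :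
  0 < l -> (forall c, 0 < w c) -> (forall c, Tr b w c = l * w c) ->
  forall n, x ^+ (2 * H) * l ^+ n <= Zcol b n /\ x ^+ H * Zcol b n <= l ^+ n.
Proof.
move=> l0 w0 wE n; have x0' := ltW x0.
have wr c d : x ^+ H * w c <= w d.
  rewrite -(ler_pM2l l0) mulrCA -!wE /transfer /hop big_distrr /=.
  apply: ler_sum => e _; rewrite (mulrA (x ^+ H)); apply: ler_wpM2r.
    by rewrite mulr_ge0 // ltW // vweight_gt0.
  by apply: le_trans (hweight_ge d e); rewrite ler_piMr ?exprn_ge0 // hweight_le1.
have W k c : iter k (Tr b) w c = l ^+ k * w c.
  elim: k c => [|k IH] c /=; first by rewrite mul1r.
  have -> : Tr b (iter k (Tr b) w) c = Tr b (fun d => l ^+ k * w d) c.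
    by apply: eq_hop => d; rewrite IH.
  by rewrite transferZ wE exprSr; ring.
have I k (u : R) f c : iter k (Tr b) (fun d => u * f d) c = u * iter k (Tr b) f c.
  elim: k c => [|k IH] c //=; rewrite -transferZ.
  by apply: eq_hop => d; rewrite IH.
have mono k f g : (forall c, f c <= g c) -> forall c, iter k (Tr b) f c <= iter k (Tr b) g c.
  by move=> fg; elim: k => [|k IH] c //=; apply: transfer_le.
pose t := topcol.
split.
  have : forall c, x ^+ H * x ^+ H / w t * w c <= hweight x c t.
    move=> c; apply: le_trans (hweight_ge c t).
    rewrite (_ : _ * w c = x ^+ H * (x ^+ H * w c / w t)); last by ring.
    by rewrite ler_piMr ?exprn_ge0 // ler_pdivrMr // mul1r wr.
  move=> /(mono n) /(_ t); rewrite I W; apply: le_trans.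
  rewrite mul2n -addnn exprD.
  by have wt := w0 t; rewrite le_eqVlt; apply/orP; left; apply/eqP; field; rewrite gt_eqF.
have : forall c, x ^+ H * hweight x c t <= (w t)^-1 * w c.
  move=> c; apply: (@le_trans _ _ (x ^+ H)).
    by rewrite ler_piMr ?exprn_ge0 // hweight_le1.
  by rewrite mulrC ler_pdivlMr // wr.
move=> /(mono n) /(_ t); rewrite !I W => /le_trans; apply.
by have wt := w0 t; rewrite le_eqVlt; apply/orP; left; apply/eqP; field; rewrite gt_eqF.
Qed.

End Perron.

Section Tridiagonal.
Variables (R : realType) (H : nat) (x : R).
Hypotheses (x0 : 0 < x) (x1 : x < 1) (H0 : (0 < H)%N).
Notation mdiag := (@mdiag R H x).

(* t = exp (- tau) for the surface tension tau = 2 beta - 2 beta_dual *)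
Definition tau_exp : R := x * (1 + x) / (1 - x).
Notation t := tau_exp.
Definition tau_cosh : R := (t + t^-1) / 2.

Lemma tau_exp_gt0 : 0 < t.
Proof. by rewrite /t divr_gt0 ?mulr_gt0 ?subr_gt0 // addr_gt0. Qed.

Definition nearest (G : nat -> R) (j : nat) : R :=
  (if j is k.+1 then G k else 0) + (if (j < H)%N then G j.+1 else 0).

(** In the bulk [mdiag] is cosh (2 beta) cosh (2 beta') = cosh tau + 1, because sinh (2 beta) sinh
    (2 beta') = 1. The rest is summation by parts, and both end coefficients are nonnegative once t
    <= 1. *)
Lemma tridiag_form (G : nat -> R) :
  \sum_(j < H.+1) G j * (mdiag j * G j - nearest G j / 2) =
  tau_cosh * (\sum_(j < H.+1) G j ^+ 2) + (\sum_(j < H) (G j - G j.+1) ^+ 2) / 2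
  + (1 - t) / 2 * G 0%N ^+ 2 + (1 - x * (1 - x) / (1 + x)) / 2 * G H ^+ 2.
Proof.
pose a0 := t / 2; pose aH := x * (1 - x) / (1 + x) / 2.
have x1n : 1 - x != 0 by rewrite subr_eq0 eq_sym lt_eqF.
have x2n : 1 + x != 0 by rewrite gt_eqF // addr_gt0.
have xn : x != 0 by rewrite gt_eqF.
have x3n : 1 - x ^+ 2 != 0 by rewrite subr_eq0 eq_sym lt_eqF // expr_lt1 // ltW.
have mE j : mdiag j = tau_cosh + 1 - (if j == 0%N then a0 else 0) - (if j == H then aH else 0).
  rewrite /mdiag /tau_cosh /a0 /aH /t /cosh_dual /cosh_bond.
  case: eqP => [j0|_]; case: eqP => [jH|_].
  - by move: H0; rewrite -jH j0.
  - by field; rewrite ?x1n ?x2n ?xn ?x3n.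
  - by field; rewrite ?x1n ?x2n ?xn ?x3n.
  - by field; rewrite ?x1n ?x2n ?xn ?x3n.
have S1 : \sum_(j < H.+1) (if j == 0%N :> nat then a0 else 0) * G j ^+ 2 = a0 * G 0%N ^+ 2.
  by rewrite big_ord_recl /= big1 ?addr0 // => j _; rewrite /= mul0r.
have S2 : \sum_(j < H.+1) (if j == H :> nat then aH else 0) * G j ^+ 2 = aH * G H ^+ 2.
  rewrite big_ord_recr /= eqxx big1 ?add0r // => j _.
  by rewrite ltn_eqF ?mul0r.
have S3 : \sum_(j < H.+1) G j * nearest G j = 2 * \sum_(j < H) G j * G j.+1.
  under eq_bigr do rewrite mulrDr.
  rewrite big_split /= big_ord_recl /= mulr0 add0r [X in _ + X]big_ord_recr /= ltnn mulr0 addr0.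
  rewrite mulr_natl mulr2n; congr (_ + _); apply: eq_bigr => j _.
    by rewrite /= mulrC.
  by rewrite ltn_ord.
have S4 : \sum_(j < H) (G j - G j.+1) ^+ 2 =
    2 * (\sum_(j < H.+1) G j ^+ 2) - G 0%N ^+ 2 - G H ^+ 2 - 2 * \sum_(j < H) G j * G j.+1.
  have E1 : \sum_(j < H.+1) G j ^+ 2 = G 0%N ^+ 2 + \sum_(j < H) G j.+1 ^+ 2.
    by rewrite big_ord_recl.
  have E2 : \sum_(j < H.+1) G j ^+ 2 = \sum_(j < H) G j ^+ 2 + G H ^+ 2.
    by rewrite big_ord_recr.
  have -> : \sum_(j < H) (G j - G j.+1) ^+ 2 =
      \sum_(j < H) G j ^+ 2 + \sum_(j < H) G j.+1 ^+ 2 - 2 * \sum_(j < H) G j * G j.+1.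
    by rewrite big_distrr -big_split -sumrB /=; apply: eq_bigr => j _; ring.
  by lra.
transitivity ((tau_cosh + 1) * \sum_(j < H.+1) G j ^+ 2 - a0 * G 0%N ^+ 2 - aH * G H ^+ 2 - \sum_(j < H) G j * G j.+1).
  have -> : \sum_(j < H) G j * G j.+1 = (\sum_(j < H.+1) G j * nearest G j) / 2 by rewrite S3; field.
  rewrite -S1 -S2 big_distrr big_distrl /= -!sumrB; apply: eq_bigr => j _.
  rewrite mE; case: (j == 0%N :> nat); case: (j == H :> nat) => /=; ring.
rewrite S4 /a0 /aH; field; by rewrite x2n.
Qed.

(** The sign is reversed with respect to [tridiag_form]: off-diagonal entries become nonnegative,
    and [top_eigenvector] yields a nonnegative bottom eigenvector of the form. *)
Definition tridiag (i j : 'I_H.+1) : R :=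
  (if i == j then - mdiag i else 0)
  + (if i == j.+1 :> nat then 2^-1 else 0) + (if j == i.+1 :> nat then 2^-1 else 0).

Lemma tridiagC i j : tridiag i j = tridiag j i.
Proof.
rewrite /tridiag eq_sym addrAC; congr (_ + _ + _).
by case: eqVneq => // ->.
Qed.

Lemma tridiag_sum (G : nat -> R) (i : 'I_H.+1) :
  \sum_j tridiag i j * G j = nearest G i / 2 - mdiag i * G i.
Proof.
under eq_bigr do rewrite /tridiag !mulrDl.
rewrite !big_split /= (bigD1 i) //= eqxx big1 ?addr0; last first.
  by move=> j /negPf ji; rewrite eq_sym ji mul0r.
rewrite /nearest mulrDl.
have -> : \sum_(j < H.+1) (if i == j.+1 :> nat then 2^-1 else 0) * G j =
    (if nat_of_ord i is k.+1 then G k else 0) / 2.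
  case: i => -[|k] /= kH.
    by rewrite mul0r big1 // => j _; rewrite mul0r.
  rewrite (bigD1 (Ordinal (ltnW kH))) //= eqxx big1 ?addr0 1?mulrC // => j.
  by rewrite -val_eqE /= eqSS eq_sym => /negPf ->; rewrite mul0r.
have -> : \sum_(j < H.+1) (if j == i.+1 :> nat then 2^-1 else 0) * G j =
    (if (i < H)%N then G i.+1 else 0) / 2.
  case: ifP => iH; last first.
    rewrite mul0r big1 // => j _; case: eqP => [ji|_]; last by rewrite mul0r.
    by have := ltn_ord j; rewrite ji ltnS iH.
  have iH' : (i.+1 < H.+1)%N by [].
  rewrite (bigD1 (Ordinal iH')) //= eqxx big1 ?addr0 1?mulrC // => j.
  by rewrite -val_eqE /= => /negPf ->; rewrite mul0r.
by rewrite mulNr -addrA addrC.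
Qed.

End Tridiagonal.

(** * Comparing the Perron eigenvalues for the two bottom rows *)

Section SpectralGap.
Variables (R : realType) (H : nat) (x : R).
Hypotheses (x0 : 0 < x) (x1 : x < 1) (H0 : (0 < H)%N).
Notation column := (column H).
Notation Tr := (@transfer R H x).
Notation t := (tau_exp x).
Notation ch := (tau_cosh x).
Notation mdiag := (@mdiag R H x).
Notation D := (@fermD R H x).
Variables (lp lm : R) (wp wm : column -> R).
Hypotheses (lp0 : 0 < lp) (lm0 : 0 < lm) (wp0 : forall c, 0 < wp c) (wm0 : forall c, 0 < wm c).
Hypotheses (wpE : forall c, Tr true wp c = lp * wp c) (wmE : forall c, Tr false wm c = lm * wm c).
Hypothesis lm_max : forall f, vdot x false f (Tr false f) <= lm * vdot x false f f.
Hypotheses (t1 : t < 1) (lmlp : lm <= lp).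

Let t0 : 0 < t. Proof. exact: tau_exp_gt0. Qed.

Implicit Types (f g h : column -> R) (c d : column) (b : bool).

Lemma fermDZ j u f g c : (forall c, f c = u * g c) -> D j f c = u * D j g c.
Proof. by move=> fg; rewrite /fermD /fermA /fermB !fg; ring. Qed.

Lemma fermion_relation j c : (j <= H)%N ->
  Tr false (Tr false (D j wp)) c + lp ^+ 2 * D j wp c =
  lp * Tr false (fun d => 2 * mdiag j * D j wp d - nearest H (fun k => D k wp d) j) c.
Proof.
move=> jH.
have -> : lp ^+ 2 * D j wp c = D j (Tr true (Tr true wp)) c.
  rewrite -(@fermDZ j (lp ^+ 2) (Tr true (Tr true wp)) wp c) // => d.
  transitivity (Tr true (fun e => lp * wp e) d).
    by apply: eq_hop => e; rewrite wpE.
  by rewrite transferZ wpE; ring.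
rewrite transfer_fermD // -transferZ; apply: eq_hop => d; congr (_ * _).
rewrite /nearest !(fermDZ _ _ wpE).
by case: j jH => [|j] jH; case: ifP => _; rewrite ?(fermDZ _ _ wpE); ring.
Qed.

Lemma vdotZr b u f g : vdot x b f (fun c => u * g c) = u * vdot x b f g.
Proof. by rewrite /vdot big_distrr /=; apply: eq_bigr => c _; ring. Qed.

Lemma vdotDr b f g h : vdot x b f (fun c => g c + h c) = vdot x b f g + vdot x b f h.
Proof. by rewrite /vdot -big_split /=; apply: eq_bigr => c _; ring. Qed.

Lemma eq_vdot b f g h : g =1 h -> vdot x b f g = vdot x b f h.
Proof. by move=> gh; apply: eq_bigr => c _; rewrite gh. Qed.

Lemma vdot_wm f : vdot x false wm (Tr false f) = lm * vdot x false wm f.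
Proof.
rewrite vdot_transferC /vdot big_distrr /=; apply: eq_bigr => c _.
by rewrite wmE; ring.
Qed.

(** Pairing [fermion_relation] with [wm] shows that the numbers [l j] form an eigenvector of the
    tridiagonal form, with eigenvalue [th]. The form is at least cosh tau, so lm/lp + lp/lm >= t +
    1/t, and [lm <= lp] selects the branch lm/lp <= t. *)
Lemma transfer_upper : lm <= t * lp.
Proof.
pose l j := vdot x false wm (D j wp).
have rel j : (j <= H)%N -> (lm ^+ 2 + lp ^+ 2) * l j = lp * lm * (2 * mdiag j * l j - nearest H l j).
  move=> jH; have E := fun c => fermion_relation c jH.
  have : vdot x false wm (fun c => Tr false (Tr false (D j wp)) c + lp ^+ 2 * D j wp c) =
         vdot x false wm (fun c => lp * Tr false (fun d => 2 * mdiag j * D j wp d - nearest H (fun k => D k wp d) j) c).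
    by apply: eq_vdot => c; rewrite E.
  rewrite vdotDr !vdotZr !vdot_wm -/(l j) => E'.
  have -> : 2 * mdiag j * l j - nearest H l j =
     vdot x false wm (fun d => 2 * mdiag j * D j wp d - nearest H (fun k => D k wp d) j).
    have N : vdot x false wm (fun d => nearest H (fun k => D k wp d) j) = nearest H l j.
      have Z : vdot x false wm (fun _ => 0) = 0.
        by rewrite /vdot big1 // => c _; rewrite mulr0.
      by rewrite /nearest vdotDr; congr (_ + _); [case: (j)|case: ifP].
    transitivity (vdot x false wm (fun d => 2 * mdiag j * D j wp d + (-1) * nearest H (fun k => D k wp d) j)).
      by rewrite vdotDr !vdotZr N mulN1r.
    by apply: eq_vdot => d; rewrite mulN1r.
  by rewrite -mulrA -E'; ring.
pose th := (lm ^+ 2 + lp ^+ 2) / (2 * lm * lp).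
have thE j : (j <= H)%N -> mdiag j * l j - nearest H l j / 2 = th * l j.
  move=> /rel; rewrite /th => E.
  have n1 : lm != 0 by rewrite gt_eqF.
  have n2 : lp != 0 by rewrite gt_eqF.
  apply: (@mulfI _ (2 * (lp * lm))); first by rewrite !mulf_neq0 // pnatr_eq0.
  transitivity (lp * lm * (2 * mdiag j * l j - nearest H l j)); first by field.
  rewrite -E; field; by rewrite n1 n2.
(* The eigenvector is not zero: at height 0 nothing is flipped and [fermA] is the identity, so
   [D 0 wp] is at least 2 x [wp]. *)
have l00 : 0 < l 0%N.
  rewrite /l /vdot (bigD1 [ffun=> true]) //=.
  have P c : 0 < vweight x false c * wm c * D 0 wp c.
    rewrite !mulr_gt0 ?vweight_gt0 // /fermD /fermA /fermB.
    have -> : flip 0 c = c by apply/ffunP => i; rewrite ffunE addbF.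
    have -> : cval false c 0 = false by [].
    have wc := wp0 c; have xw := mulr_gt0 x0 wc.
    by rewrite /sgb; case: (cval false c 1); lra.
  by apply: ltr_wpDr => //; apply: sumr_ge0 => c _; exact: ltW.
have := tridiag_form x0 x1 H0 l.
have -> : \sum_(j < H.+1) l j * (mdiag j * l j - nearest H l j / 2) = th * \sum_(j < H.+1) l j ^+ 2.
  by rewrite big_distrr /=; apply: eq_bigr => j _; rewrite thE -1?ltnS //; ring.
have Sp : 0 < \sum_(j < H.+1) l j ^+ 2.
  rewrite big_ord_recl /=; apply: ltr_wpDr; last by rewrite exprn_gt0.
  by apply: sumr_ge0 => j _; exact: sqr_ge0.
set S := \sum_(j < H.+1) _ in Sp * => E.
have : ch * S <= th * S.
  have x1' : 0 < 1 + x by rewrite addr_gt0.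
  rewrite {}E -!addrA lerDl; apply: addr_ge0.
    by apply: divr_ge0 => //; apply: sumr_ge0 => j _; exact: sqr_ge0.
  apply: addr_ge0; rewrite mulr_ge0 ?sqr_ge0 // divr_ge0 //; first by rewrite subr_ge0 ltW.
  by rewrite subr_ge0 ler_pdivrMr //; have := sqr_ge0 x; rewrite expr2; lra.
rewrite ler_pM2r // /th /tau_cosh ler_pdivlMr ?mulr_gt0 // => chth.
rewrite leNgt; apply/negP => lt.
have : t * ((t + t^-1) / 2 * (2 * lm * lp)) <= t * (lm ^+ 2 + lp ^+ 2) by rewrite ler_pM2l.
have -> : t * ((t + t^-1) / 2 * (2 * lm * lp)) = (t ^+ 2 + 1) * lm * lp.
  by field; rewrite gt_eqF.
have : 0 < (lm - t * lp) * (lp - t * lm).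
  apply: mulr_gt0; rewrite subr_gt0 //; apply: lt_le_trans lmlp.
  by rewrite gtr_pMl.
nra.
Qed.

(** The combination [f] of fermions weighted by the bottom eigenvector [a] satisfies T^2 f + lp^2 f
    = 2 th lp T f. The maximality of [lm] on [f] turns this into lm/lp + lp/lm <= 2 th, and a test
    function bounds [th] from above. *)
Lemma transfer_lower (m : nat) : (0 < m)%N -> H = (2 * m)%N ->
  lm ^+ 2 + lp ^+ 2 <= (t + t^-1 + 6 / m%:R ^+ 2) * (lm * lp).
Proof.
move=> m0 Hm.
have Koff (i j : 'I_H.+1) : i != j -> 0 <= tridiag x i j.
  move=> /negPf ij; rewrite /tridiag ij add0r.
  by apply: addr_ge0; case: ifP => _ //; rewrite invr_ge0.
have [a [l [a1 a0 aE amax]]] := top_eigenvector ord0 (@tridiagC R H x) Koff.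
pose th := - l.
pose G k := a (inord k).
have aG j : a j = G j by rewrite /G inord_val.
have x1' : 0 < 1 + x by rewrite addr_gt0.
have ch_th : ch <= th.
  have := tridiag_form x0 x1 H0 G.
  have -> : \sum_(j < H.+1) G j * (mdiag j * G j - nearest H G j / 2) = th * \sum_(j < H.+1) G j ^+ 2.
    rewrite big_distrr /=; apply: eq_bigr => j _.
    rewrite /th mulNr -[mdiag j * _]opprK -opprD mulrN; congr (- _).
    rewrite [- _ + _]addrC -tridiag_sum.
    have := aE j; under eq_bigr do rewrite aG; move=> ->; rewrite aG; ring.
  have -> : \sum_(j < H.+1) G j ^+ 2 = 1 by rewrite -a1; apply: eq_bigr => j _; rewrite aG.
  rewrite !mulr1 => ->; rewrite -!addrA lerDl; apply: addr_ge0.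
    by apply: divr_ge0 => //; apply: sumr_ge0 => j _; exact: sqr_ge0.
  apply: addr_ge0; rewrite mulr_ge0 ?sqr_ge0 // divr_ge0 //; first by rewrite subr_ge0 ltW.
  by rewrite subr_ge0 ler_pdivrMr //; have := sqr_ge0 x; rewrite expr2; lra.
have th_ch : 2 * th <= t + t^-1 + 6 / m%:R ^+ 2.
  (* The tent has 2 m increments of size 1 and square norm at least m^3 / 3, hence the term 6 / m^2.
     Vanishing at both ends, it does not see the end terms. *)
  pose T (j : nat) : R := (minn j (2 * m - j))%:R.
  have := tridiag_form x0 x1 H0 T.
  have T0 : T 0%N = 0 by rewrite /T min0n.
  have TH : T H = 0 by rewrite /T Hm subnn minn0.
  rewrite T0 TH expr0n /= !mulr0 !addr0.
  have -> : \sum_(j < H) (T j - T j.+1) ^+ 2 = 2 * m%:R.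
    have -> : 2 * m%:R = \sum_(j < H) 1 :> R by rewrite sumr_const card_ord Hm natrM.
    apply: eq_bigr => j _.
    have jH : (j < 2 * m)%N by rewrite -Hm.
    rewrite /T.
    have [jm|mj] := ltnP j m.
      have -> : minn j (2 * m - j) = j by lia.
      have -> : minn j.+1 (2 * m - j.+1) = j.+1 by lia.
      by rewrite -natr1; ring.
    have -> : minn j (2 * m - j) = (2 * m - j.+1).+1 by lia.
    have -> : minn j.+1 (2 * m - j.+1) = (2 * m - j.+1)%N by lia.
    by rewrite -natr1; ring.
  have := amax (fun j : 'I_H.+1 => T j).
  have -> : qform (tridiag x (H:=H)) (fun j => T j) (fun j => T j) =
     - \sum_(j < H.+1) T j * (mdiag j * T j - nearest H T j / 2).
    by rewrite /qform -sumrN; apply: eq_bigr => j _; rewrite tridiag_sum //; ring.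
  have -> : l = - th by rewrite /th opprK.
  have Sm : m%:R ^+ 3 <= 3 * \sum_(j < H.+1) T j ^+ 2.
    have : m%:R ^+ 3 <= 3 * \sum_(j < m.+1) (j%:R : R) ^+ 2.
      elim: (m) => [|k IH]; first by rewrite expr0n /= mulr_ge0 // sumr_ge0 // => j _; exact: sqr_ge0.
      rewrite big_ord_recr /= mulrDr -natr1.
      have : 0 <= k%:R :> R by rewrite ler0n.
      by nra.
    move=> /le_trans; apply; rewrite ler_pM2l //.
    have mH : (m.+1 <= H.+1)%N by rewrite ltnS Hm; lia.
    rewrite (big_ord_widen _ (fun j => (j%:R : R) ^+ 2) mH) big_mkcond /=.
    apply: ler_sum => j _; case: ifP => jm; last exact: sqr_ge0.
    by rewrite /T; have -> : minn j (2 * m - j) = j by lia.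
  set S := \sum_(j < H.+1) T j ^+ 2 in Sm *; set Q := \sum_(j < H.+1) _ * _.
  move=> h1 h2.
  have mp : 0 < m%:R :> R by rewrite ltr0n.
  have Sp : 0 < S by have := exprn_gt0 3 mp; lra.
  have : 2 * (th * S) <= 2 * (ch * S) + 2 * m%:R by lra.
  have chE : 2 * ch = t + t^-1 by rewrite /tau_cosh; field; rewrite gt_eqF.
  rewrite mulrA [2 * (ch * S)]mulrA chE => h3.
  rewrite -(ler_pM2r Sp); apply: le_trans h3 _; rewrite [leRHS]mulrDl lerD2l.
  rewrite mulrAC ler_pdivlMr ?exprn_gt0 //.
  have -> : 2 * m%:R * m%:R ^+ 2 = 2 * m%:R ^+ 3 :> R by ring.
  by lra.
pose bot : column := [ffun=> false].
pose f c := \sum_j a j * D j wp c.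
(* On the all minus column every [fermA j wp] is positive and outweighs [fermB j wp], so [f] is not
   zero. *)
have fpos : 0 < f bot.
  have P (j : 'I_H.+1) : 0 < D j wp bot.
    rewrite /fermD /fermA /fermB.
    have -> : cval false bot j = false.
      case: j => -[|k] kH //=.
      by rewrite (cvalS false bot (Ordinal (kH : (k < H)%N))) ffunE.
    have wc := wp0 (flip j bot); have xw := mulr_gt0 x0 wc.
    by rewrite /sgb; case: cval; lra.
  have [j aj] : exists j, 0 < a j.
    apply/existsP; rewrite -[X in is_true X]negbK negb_exists; apply/negP => /forallP hn.
    have : \sum_t a t ^+ 2 = 0.
      apply: big1 => s _; have := hn s; rewrite -leNgt => tn.
      by have -> : a s = 0; [apply/le_anti; rewrite tn a0|rewrite expr0n].
    by rewrite a1 => /eqP; rewrite oner_eq0.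
  rewrite /f (bigD1 j) //=; apply: ltr_wpDr; last by rewrite mulr_gt0.
  by apply: sumr_ge0 => i _; rewrite mulr_ge0 // ltW.
have trsum (u : 'I_H.+1 -> column -> R) c :
    Tr false (fun d => \sum_j a j * u j d) c = \sum_j a j * Tr false (u j) c.
  rewrite /transfer /hop; under eq_bigr do rewrite !big_distrr /=.
  rewrite exchange_big /=; apply: eq_bigr => j _; rewrite big_distrr /=.
  by apply: eq_bigr => d _; ring.
have frel c : Tr false (Tr false f) c + lp ^+ 2 * f c = lp * (2 * th) * Tr false f c.
  have -> : Tr false (Tr false f) c = \sum_j a j * Tr false (Tr false (D j wp)) c.
    by rewrite -trsum; apply: eq_hop => d; rewrite -trsum.
  have -> : \sum_j a j * Tr false (Tr false (D j wp)) c + lp ^+ 2 * f c =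
     \sum_j a j * (lp * Tr false (fun d => - 2 * \sum_k tridiag x j k * D k wp d) c).
    rewrite /f big_distrr -big_split /=; apply: eq_bigr => j _.
    have jH : (j <= H)%N by rewrite -ltnS.
    rewrite [lp ^+ 2 * _]mulrCA -mulrDr fermion_relation //; congr (_ * (_ * _)).
    apply: eq_hop => d; congr (_ * _).
    by rewrite (tridiag_sum x (fun k => D k wp d)); field.
  rewrite -mulrA; under eq_bigr do rewrite mulrCA.
  rewrite -big_distrr /=; congr (lp * _); rewrite -trsum -transferZ; apply: eq_hop => d; congr (_ * _).
  under eq_bigr do rewrite mulrCA.
  rewrite -big_distrr /=; under eq_bigr do rewrite big_distrr /=.
  rewrite exchange_big /= ; rewrite mulNr -mulrN mulrC mulrC -mulrA; congr (_ * _).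
  rewrite /th mulNr; congr (- _); rewrite /f big_distrr /=; apply: eq_bigr => k _.
  transitivity ((\sum_j tridiag x k j * a j) * D k wp d).
    by rewrite big_distrl /=; apply: eq_bigr => j _; rewrite (tridiagC x j k); ring.
  by rewrite aE; ring.
pose N := vdot x false f f.
pose P1 := vdot x false f (Tr false f).
pose P2 := vdot x false f (Tr false (Tr false f)).
have Np : 0 < N.
  rewrite /N /vdot (bigD1 bot) //=; apply: ltr_wpDr; last by rewrite !mulr_gt0 ?vweight_gt0.
  by apply: sumr_ge0 => c _; rewrite -mulrA mulr_ge0 ?(ltW (vweight_gt0 _ _ _)) // -expr2 sqr_ge0.
have P1N : P1 <= lm * N by exact: lm_max.
have E2 : P2 + lp ^+ 2 * N = lp * (2 * th) * P1.
  by rewrite /P2 /N /P1 -!vdotZr -vdotDr; apply: eq_vdot => c; rewrite frel.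
(* The square norm of T f - lm f is nonnegative, and P2 is the square norm of T f. *)
have P2N : 2 * lm * P1 - lm ^+ 2 * N <= P2.
  have := vdot_ge0 x0 false (fun c => Tr false f c - lm * f c).
  have -> : vdot x false (fun c => Tr false f c - lm * f c) (fun c => Tr false f c - lm * f c) =
     vdot x false (Tr false f) (Tr false f) - 2 * lm * P1 + lm ^+ 2 * N.
    by rewrite /P1 /N /vdot !big_distrr /= -sumrB -big_split /=; apply: eq_bigr => c _; ring.
  by rewrite -vdot_transferC -/P2; lra.
have ch1 : 1 <= ch.
  rewrite /tau_cosh -(ler_pM2l t0).
  have -> : t * ((t + t^-1) / 2) = (t ^+ 2 + 1) / 2 by field; rewrite gt_eqF.
  by have := sqr_ge0 (t - 1); lra.
(* After [P2N] is inserted in [E2], the coefficient of [P1] is 2 (th lp - lm); its sign allows the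
   use of [P1N]. *)
have thlp : lm <= th * lp.
  by apply: le_trans lmlp _; rewrite ler_peMl ?(ltW lp0) //; lra.
suff : lm ^+ 2 + lp ^+ 2 <= 2 * th * (lm * lp).
  by move=> /le_trans; apply; rewrite ler_pM2r // mulr_gt0.
rewrite -(ler_pM2r Np).
have : 0 <= (2 * (th * lp) - 2 * lm) * (lm * N - P1).
  by apply: mulr_ge0; lra.
by nra.
Qed.

End SpectralGap.

(** * Ising weights on rectangles *)

Notation rect n m := ({ffun 'I_n * 'I_m -> bool}).

Definition pos n m (i : 'I_n * 'I_m) : site := ((nat_of_ord i.1)%:Z, (nat_of_ord i.2)%:Z).

Lemma pos_inj n m : injective (@pos n m).
Proof.
by move=> [a b] [c d] [] /= ac bd; congr pair; apply: val_inj.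
Qed.

Definition ext n m (eta : site -> bool) (s : rect n m) (v : site) : bool :=
  if [pick i | pos i == v] is Some i then s i else eta v.

Lemma ext_in n m eta (s : rect n m) i : ext eta s (pos i) = s i.
Proof.
rewrite /ext; case: pickP => [j /eqP /pos_inj -> //|/(_ i)]; by rewrite eqxx.
Qed.

Definition inrect n m (v : site) : bool := (0 <= v.1 < n%:Z) && (0 <= v.2 < m%:Z).

Lemma inrectP n m v : reflect (exists i : 'I_n * 'I_m, pos i = v) (inrect n m v).
Proof.
apply: (iffP idP) => [|[[i j] <-]]; last by rewrite /inrect /= !ltz_nat !ltn_ord.
case: v => -[a|a] [b|b] /andP[] //= an bm.
by exists (Ordinal (an : (a < n)%N), Ordinal (bm : (b < m)%N)).
Qed.

Lemma ext_out n m eta (s : rect n m) v : ~~ inrect n m v -> ext eta s v = eta v.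
Proof.
rewrite /ext; case: pickP => [i /eqP <-|//] /negP[]; apply/inrectP; by exists i.
Qed.

(** Every bond with an end in the rectangle, listed once as (left, right) or (lower, upper), the
    order in which [dsep] returns its sites. *)
Definition bonds (n m : nat) : seq (site * site) :=
  [seq ((k%:Z - 1, j%:Z), (k%:Z, j%:Z)) | k <- iota 0 n.+1, j <- iota 0 m] ++
  [seq ((k%:Z, j%:Z - 1), (k%:Z, j%:Z)) | k <- iota 0 n, j <- iota 0 m.+1].

Definition disagree (S : site -> bool) (e : site * site) : bool := S e.1 != S e.2.

Definition bond_energy (n m : nat) (S : site -> bool) : nat := count (disagree S) (bonds n m).

Lemma bond_energyE n m S : bond_energy n m S =
  (\sum_(0 <= k < n.+1) \sum_(0 <= j < m) (S (k%:Z - 1, j%:Z)%R != S (k%:Z, j%:Z)) +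
   \sum_(0 <= k < n) \sum_(0 <= j < m.+1) (S (k%:Z, j%:Z - 1)%R != S (k%:Z, j%:Z)))%N.
Proof.
rewrite /bond_energy count_cat -!sum1_count; congr (_ + _)%N.
  rewrite big_mkcond big_allpairs_dep /= /index_iota subn0.
  by apply: eq_bigr => k _; rewrite subn0; apply: eq_bigr => j _; rewrite /disagree /=; case: (_ != _).
rewrite big_mkcond big_allpairs_dep /= /index_iota subn0.
by apply: eq_bigr => k _; rewrite subn0; apply: eq_bigr => j _; rewrite /disagree /=; case: (_ != _).
Qed.

Lemma bond_energy_submodular n m S S' :
  (bond_energy n m (fun v => S v && S' v) + bond_energy n m (fun v => S v || S' v)
   <= bond_energy n m S + bond_energy n m S')%N.
Proof.
rewrite /bond_energy -!sum1_count !(big_mkcond (disagree _)) -!big_split /=.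
by apply: leq_sum => -[u v] _; rewrite /disagree /=; case: (S u); case: (S v); case: (S' u); case: (S' v).
Qed.

Lemma eq_bond_energy n m S S' : S =1 S' -> bond_energy n m S = bond_energy n m S'.
Proof. by move=> SS; apply: eq_count => e; rewrite /disagree !SS. Qed.

Section Weights.
Variables (R : realType) (x : R) (n m : nat).
Hypotheses (x0 : 0 < x) (x1 : x < 1).
Notation rect := (rect n m).

Definition mag (s : rect) : R := \sum_i (if s i then 1 else -1).

Definition wgt (eta : site -> bool) (lam : R) (s : rect) : R :=
  x ^+ bond_energy n m (ext eta s) * expR (lam * mag s).

Definition Zf (eta : site -> bool) (lam : R) (P : pred rect) : R :=
  \sum_(s | P s) wgt eta lam s.

Lemma wgt_gt0 eta lam s : 0 < wgt eta lam s.
Proof. by rewrite /wgt mulr_gt0 ?exprn_gt0 ?expR_gt0. Qed.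

Lemma Zf_ge0 eta lam P : 0 <= Zf eta lam P.
Proof. by apply: sumr_ge0 => s _; exact: ltW (wgt_gt0 _ _ _). Qed.

Lemma Zf_gt0 eta lam (P : pred rect) s : P s -> 0 < Zf eta lam P.
Proof.
move=> Ps; rewrite /Zf (bigD1 s) //= ltr_wpDr ?wgt_gt0 //.
by apply: sumr_ge0 => t _; exact: ltW (wgt_gt0 _ _ _).
Qed.

Lemma eq_Zf eta eta' lam (P P' : pred rect) : eta =1 eta' -> P =1 P' -> Zf eta lam P = Zf eta' lam P'.
Proof.
move=> /funext -> PP; exact: eq_bigl.
Qed.

Lemma ext_meet eta eta' (s t : rect) v :
  ext (fun w => eta w && eta' w) (conf_meet s t) v = ext eta s v && ext eta' t v.
Proof. by rewrite /ext; case: pickP => // i _; rewrite ffunE. Qed.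

Lemma ext_join eta eta' (s t : rect) v :
  ext (fun w => eta w || eta' w) (conf_join s t) v = ext eta s v || ext eta' t v.
Proof. by rewrite /ext; case: pickP => // i _; rewrite ffunE. Qed.

(* FKG lattice inequality in field, boundary condition and constraint at once *)
Lemma Zf_four eta eta' (a b c d : R) (P P' Q Q' : pred rect) :
  a + b = c + d -> c <= a -> c <= b ->
  (forall s t, P s -> P' t -> Q (conf_meet s t) && Q' (conf_join s t)) ->
  Zf eta a P * Zf eta' b P' <=
  Zf (fun w => eta w && eta' w) c Q * Zf (fun w => eta w || eta' w) d Q'.
Proof.
move=> abcd ca cb PQ; rewrite /Zf.
rewrite (big_mkcond P) (big_mkcond P') (big_mkcond Q) (big_mkcond Q') /=.
have pos P0 eta0 l (s : rect) : 0 <= (if P0 s then wgt eta0 l s else 0).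
  by case: ifP => // _; exact: ltW (wgt_gt0 _ _ _).
apply: four_functions => // s t.
case Ps : (P s); last by rewrite mul0r mulr_ge0.
case Pt : (P' t); last by rewrite mulr0 mulr_ge0.
have /andP[-> ->] := PQ s t Ps Pt.
rewrite /wgt mulrACA [leRHS]mulrACA -!exprD -!expRD.
apply: ler_pM; rewrite ?exprn_ge0 ?expR_ge0 ?(ltW x0) //.
  apply: ler_wiXn2l; rewrite ?(ltW x0) ?(ltW x1) //.
  apply: leq_trans (bond_energy_submodular n m _ _).
  by apply: eq_leq; congr (_ + _)%N; apply: eq_bond_energy => v; rewrite ?ext_meet ?ext_join.
rewrite ler_expR /mag !big_distrr -!big_split /=; apply: ler_sum => i _.
by rewrite !ffunE; case: (s i); case: (t i) => /=; lra.
Qed.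

End Weights.

(** * Partition functions and the transfer operator *)

Definition bc (b : bool) (v : site) : bool := b || dobrushin v.

Section TransferIdentity.
Variables (R : realType) (x : R) (m : nat) (b : bool).
Notation column := (column m).
Notation top := (topcol m).

Fixpoint path_weight (c0 : column) (cs : seq column) : R :=
  if cs is c :: cs' then hweight x c0 c * (vweight x b c * path_weight c cs')
  else hweight x c0 top.

Lemma Zcol_path n : Zcol m x b n = \sum_(cs : n.-tuple column) path_weight top cs.
Proof.
rewrite /Zcol; suff gen : forall c0, iter n (transfer x b) (fun c => hweight x c top) c0 =
    \sum_(cs : n.-tuple column) path_weight c0 cs by exact: gen.
elim: n => [|n IH] c0.
  rewrite (bigD1 [tuple]) //= big1 ?addr0 // => s /eqP; case.
  exact: tuple0.
rewrite iterS big_tuple_cons /transfer /hop; apply: eq_bigr => c _ /=.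
by rewrite -!big_distrr /= -IH.
Qed.

Lemma path_weight_prod c0 cs : path_weight c0 cs =
  (\prod_(0 <= k < (size cs).+1) hweight x (nth top (c0 :: cs) k) (nth top cs k)) *
  \prod_(0 <= k < size cs) vweight x b (nth top cs k).
Proof.
elim: cs c0 => [|c cs IH] c0 /=; first by rewrite big_nat1 big_geq // mulr1.
by rewrite big_nat_recl // [X in _ = _ * X]big_nat_recl //= IH /=; ring.
Qed.

Definition slice (S : site -> bool) (k : int) : column := [ffun j : 'I_m => S (k, (nat_of_ord j)%:Z)].

Lemma hweight_slice S k l :
  hweight x (slice S k) (slice S l) = x ^+ (\sum_(0 <= j < m) (S (k, j%:Z) != S (l, j%:Z)))%N.
Proof.
rewrite big_mkord expr_sum; apply: eq_bigr => j _.
by rewrite !ffunE; case: (S _ == S _).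
Qed.

Lemma vweight_slice S k : S (k, -1) = b -> S (k, m%:Z) = true ->
  vweight x b (slice S k) = x ^+ (\sum_(0 <= j < m.+1) (S (k, j%:Z - 1)%R != S (k, j%:Z)))%N.
Proof.
move=> Sb St.
have cv j : (j <= m.+1)%N -> cval b (slice S k) j = S (k, j%:Z - 1).
  case: j => [_|j jm]; first by rewrite -[LHS]Sb.
  have -> : j.+1%:Z - 1 = j%:Z by rewrite -addn1 PoszD addrK.
  move: jm; rewrite ltnS leq_eqVlt => /orP[/eqP ->|jm]; first by rewrite cval_top.
  by rewrite (cvalS _ _ (Ordinal jm)) ffunE.
rewrite big_mkord expr_sum; apply: eq_bigr => j _.
have jm := ltn_ord j.
rewrite cv ?(ltnW jm) // cv //.
have -> : (nat_of_ord j).+1%:Z - 1 = j%:Z by rewrite -addn1 PoszD addrK.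
by case: (S _ == S _).
Qed.

(** The all plus column plays both lateral boundaries: it is prepended to the columns, and it is the
    default value of [nth] past the last one. *)
Lemma Zf_transfer n : Zf (n := n) (m := m) x (bc b) 0 predT = Zcol m x b n.
Proof.
rewrite Zcol_path /Zf.
pose e (cs : n.-tuple column) : rect n m := [ffun i => tnth cs i.1 i.2].
rewrite (reindex e) /=; last first.
  exists (fun s : rect n m => [tuple [ffun j => s (i, j)] | i < n]) => [cs _|s _].
    apply: eq_from_tnth => i; rewrite tnth_mktuple; apply/ffunP => j.
    by rewrite !ffunE.
  by apply/ffunP => -[i j]; rewrite ffunE tnth_mktuple ffunE.
apply: eq_bigr => cs _; rewrite /wgt mul0r expR0 mulr1 path_weight_prod size_tuple.
set S := ext (bc b) (e cs).
have Sin k (kn : (k < n)%N) j (jm : (j < m)%N) : S (k%:Z, j%:Z) = nth top cs k (Ordinal jm).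
  have -> : (k%:Z, j%:Z) = pos (Ordinal kn, Ordinal jm) by [].
  by rewrite /S ext_in ffunE /= (tnth_nth top).
have Sout (k j : int) : ~~ inrect n m (k, j) -> S (k, j) = bc b (k, j).
  by move=> ?; rewrite /S ext_out.
have sl k : (k <= n)%N -> slice S k%:Z = nth top cs k.
  rewrite leq_eqVlt => /orP[/eqP ->|kn]; apply/ffunP => j; rewrite ffunE.
    rewrite nth_default ?size_tuple // ffunE Sout ?/bc ?/dobrushin /= ?orbT //.
    by rewrite /inrect /= ltz_nat ltnn.
  rewrite (Sin _ kn _ (ltn_ord j)); congr (nth top cs k _); exact: val_inj.
have sl' k : (k <= n)%N -> slice S (k%:Z - 1) = nth top (top :: cs) k.
  case: k => [_|k kn] /=; last first.
    by rewrite -sl ?(ltnW kn) // -addn1 PoszD addrK.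
  by apply/ffunP => j; rewrite !ffunE Sout // /bc /dobrushin /= orbT.
rewrite bond_energyE exprD; congr (_ * _).
  rewrite expr_sum big_nat [RHS]big_nat; apply: eq_bigr => k /andP[_ kn].
  by rewrite -sl' // -sl // hweight_slice.
rewrite expr_sum big_nat [RHS]big_nat; apply: eq_bigr => k /andP[_ kn].
rewrite -sl ?(ltnW kn) // vweight_slice //.
  by rewrite Sout /bc /dobrushin /= ?orbF // /inrect /= andbF.
rewrite Sout ?/bc ?/dobrushin /= ?orbT //.
by rewrite /inrect /= ltxx !andbF.
Qed.

End TransferIdentity.

(** * Sub-rectangles *)

Lemma sum_nat_window (F : nat -> nat) (N a l : nat) : (a + l <= N)%N ->
  (forall k, (k < N)%N -> ~~ (a <= k < a + l)%N -> F k = 0%N) ->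
  (\sum_(0 <= k < N) F k = \sum_(0 <= k < l) F (k + a))%N.
Proof.
move=> alN F0; rewrite (@big_cat_nat _ _ _ a) //=; last by lia.
have -> : (\sum_(0 <= k < a) F k = 0)%N.
  by rewrite big_nat; apply: big1 => k ka; apply: F0; lia.
rewrite add0n (@big_cat_nat _ _ _ (a + l)) //=; last by lia.
have -> : (\sum_(a + l <= k < N) F k = 0)%N.
  by rewrite big_nat; apply: big1 => k ka; apply: F0; lia.
rewrite addn0.
by rewrite -{1}(add0n a) big_addn addKn.
Qed.

Section Embedding.
Variables (R : realType) (x : R) (n m a n' m' : nat) (b : bool).
Hypotheses (an : (a + n' <= n)%N) (mm : (m' <= m)%N).

Definition bcw (v : site) : bool :=
  bc b v || ~~ (a%:Z <= v.1 < (a + n')%:Z).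

Definition shift (v : site) : site := (v.1 - a%:Z, v.2).
Definition emb (s : rect n' m') : rect n m := [ffun i => ext xpredT s (shift (pos i))].
Definition res (t : rect n m) : rect n' m' :=
  [ffun j => ext xpredT t ((pos j).1 + a%:Z, (pos j).2)].
Definition plus_off (t : rect n m) : bool :=
  [forall i, inrect n' m' (shift (pos i)) || t i].

Lemma inrect_shift v : inrect n' m' (shift v) -> inrect n m v.
Proof. by rewrite /inrect /=; lia. Qed.

Lemma ext_emb s v : ext bcw (emb s) v =
  if inrect n' m' (shift v) then ext xpredT s (shift v)
  else inrect n m v || bcw v.
Proof.
case: ifP => sv.
  by have /inrectP[i E] := inrect_shift sv; rewrite -E ext_in ffunE E.
have [/inrectP[i E]|nv] := boolP (inrect n m v); last by rewrite ext_out.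
by rewrite -E ext_in ffunE E ext_out // sv.
Qed.

Lemma ext_emb_shift s (k j : int) : (0 <= j) || (0 <= k < n'%:Z) ->
  ext bcw (emb s) (k + a%:Z, j) = ext (bc b) s (k, j).
Proof.
move=> kj; rewrite ext_emb.
have -> : shift (k + a%:Z, j) = (k, j) by rewrite /shift /= addrK.
case: ifP => sv; first by case/inrectP: sv => i <-; rewrite !ext_in.
rewrite [RHS]ext_out ?sv // /bcw /bc /dobrushin /=.
case: b => /=; rewrite ?orbT //; move: kj sv; rewrite /inrect /=.
by case: (0 <= j) => /= [|kj]; [rewrite orbT|lia].
Qed.

Lemma ext_emb_plus s (k j : int) :
  ~~ (a%:Z <= k < (a + n')%:Z) || (m'%:Z <= j) -> ext bcw (emb s) (k, j).
Proof.
move=> kj; rewrite ext_emb; case: ifP => sv; first by move: kj sv; rewrite /inrect /shift /=; lia.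
rewrite /bcw /bc /dobrushin /=; case: b => /=; rewrite ?orbT //; move: kj; lia.
Qed.

Lemma bond_energy_emb s :
  bond_energy n m (ext bcw (emb s)) = bond_energy n' m' (ext (bc b) s).
Proof.
rewrite !bond_energyE; set S := ext bcw _; set S' := ext (bc b) s.
have P k j : ~~ (a%:Z <= k < (a + n')%:Z) || (m'%:Z <= j) -> S (k, j) = true.
  by move=> /(ext_emb_plus s).
have sh (k j : nat) : S ((k + a)%:Z, j%:Z) = S' (k%:Z, j%:Z).
  by rewrite PoszD; exact: ext_emb_shift.
congr (_ + _)%N.
  rewrite (@sum_nat_window _ _ a n'.+1) ?addnS //; last first.
    by move=> k kn ka; rewrite big1 // => j _; rewrite !P // PoszD; lia.
  apply: eq_big_nat => k /andP[_ kn].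
  rewrite (@sum_nat_window _ _ 0 m') //; last first.
    by move=> j jm jm'; rewrite !P //; lia.
  apply: eq_big_nat => j _; rewrite addn0 sh.
  have -> : (k + a)%:Z - 1 = (k%:Z - 1) + a%:Z by rewrite PoszD addrAC.
  by rewrite /S ext_emb_shift.
rewrite (@sum_nat_window _ _ a n') //; last first.
  by move=> k kn ka; rewrite big1 // => j _; rewrite !P //; lia.
apply: eq_big_nat => k /andP[_ kn].
rewrite (@sum_nat_window _ _ 0 m'.+1) //; last first.
  by move=> j jm jm'; rewrite !P //; lia.
apply: eq_big_nat => j _; rewrite addn0 sh.
by rewrite /S PoszD ext_emb_shift //; lia.
Qed.

(** Frozen plus spins act as a boundary condition, and bonds between two plus spins cost nothing, so
    only the bonds touching the window contribute. *)
Lemma Zf_emb : Zf (n := n) (m := m) x bcw 0 plus_off = Zf (n := n') (m := m') x (bc b) 0 predT.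
Proof.
rewrite /Zf (reindex_onto emb res) /=; last first.
  move=> t /forallP tp; apply/ffunP => i; rewrite ffunE.
  have := tp i; have [/inrectP[j E] _|sv /= ->] := boolP (inrect n' m' (shift (pos i))).
    rewrite -E ext_in ffunE E /shift /= subrK.
    have -> : ((pos i).1, (pos i).2) = pos i by [].
    by rewrite ext_in.
  by rewrite ext_out.
apply: eq_big => [s|s _].
  have -> : res (emb s) == s.
    apply/eqP/ffunP => j; rewrite ffunE.
    have sv : shift ((pos j).1 + a%:Z, (pos j).2) = pos j by rewrite /shift /= addrK.
    have vin : inrect n' m' (shift ((pos j).1 + a%:Z, (pos j).2)) by rewrite sv; apply/inrectP; exists j.
    by have /inrectP[i E] := inrect_shift vin; rewrite -E ext_in ffunE E sv ext_in.
  rewrite andbT; apply/forallP => i.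
  by case: (boolP (inrect n' m' (shift (pos i)))) => //= sv; rewrite ffunE ext_out.
by rewrite /wgt bond_energy_emb !mul0r expR0.
Qed.

End Embedding.

(** * Surface tension *)

(** Used to discard multiplicative constants that do not grow with the power [k]. *)
Lemma bounded_powers_le1 (R : realType) (q C : R) :
  0 <= q -> (forall k, q ^+ k <= C) -> q <= 1.
Proof.
move=> q0 qC; rewrite leNgt; apply/negP => q1.
have bern k : 1 + k%:R * (q - 1) <= q ^+ k.
  elim: k => [|k IH]; first by rewrite mul0r addr0 expr0.
  rewrite exprS -natr1; have kp : 0 <= k%:R :> R by rewrite ler0n.
  have : q * (1 + k%:R * (q - 1)) <= q * q ^+ k by rewrite ler_wpM2l.
  have : 0 <= k%:R * (q - 1) ^+ 2 by rewrite mulr_ge0 // sqr_ge0.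
  by rewrite expr2; lra.
have qp : 0 < q - 1 by rewrite subr_gt0.
have := archi_boundP (normr_ge0 (C / (q - 1))); set k := Num.bound _ => Ck.
have := le_trans (bern k) (qC k); have := le_lt_trans (ler_norm _) Ck.
by rewrite ltr_pdivrMr //; lra.
Qed.

Section SurfaceTension.
Variables (R : realType) (x : R).
Hypotheses (x0 : 0 < x) (x1 : x < 1).

Notation Z n m := (@Zf R x n m).

(** No bond reads a boundary spin that is both below row 0 and outside the columns of the
    rectangle. *)
Lemma eq_Zf_in n m eta eta' lam (P : pred (rect n m)) :
  (forall v, (0 <= v.2) || (0 <= v.1 < n%:Z) -> eta v = eta' v) ->
  Zf x eta lam P = Zf x eta' lam P.
Proof.
move=> E; apply: eq_bigr => s _; congr (_ ^+ _ * _).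
apply: eq_in_count => -[u v] uv; rewrite /disagree /=.
have D w : (0 <= w.2) || (0 <= w.1 < n%:Z) -> ext eta s w = ext eta' s w.
  by move=> wD; rewrite /ext; case: pickP => // _; exact: E.
suff [-> ->] : ext eta s u = ext eta' s u /\ ext eta s v = ext eta' s v by [].
move: uv; rewrite mem_cat => /orP[] /allpairsP[[k j] /= []];
  rewrite !mem_iota => kn jm [-> ->]; split; apply: D => /=; lia.
Qed.

Lemma Zf_flip n m eta :
  Z n m (fun v => ~~ eta v) 0 predT = Z n m eta 0 predT.
Proof.
pose f (s : rect n m) : rect n m := [ffun i => ~~ s i].
have fK : involutive f by move=> s; apply/ffunP => i; rewrite !ffunE negbK.
rewrite /Zf (reindex_inj (inv_inj fK)) /=; apply: eq_bigr => s _.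
rewrite /wgt !mul0r; congr (_ ^+ _ * _); apply: eq_count => e; rewrite /disagree.
have E v : ext (fun v => ~~ eta v) (f s) v = ~~ ext eta s v.
  by rewrite /ext; case: pickP => // i _; rewrite ffunE.
by rewrite !E; case: ext; case: ext.
Qed.

(* the two boundary conditions being global flips of each other on the part
   where they differ from all plus, FKG compares their geometric mean *)
Lemma Zf_minus_le n m :
  Z n m (bc false) 0 predT <= Z n m (bc true) 0 predT.
Proof.
have := @Zf_four R x n m x0 x1 (bc false) (fun v => ~~ bc false v) 0 0 0 0 predT predT predT predT.
move=> /(_ erefl (lexx _) (lexx _) (fun _ _ _ _ => isT)).
rewrite Zf_flip.
have -> : Z n m (fun w => bc false w && ~~ bc false w) 0 predT = Z n m (bc true) 0 predT.
  by rewrite -Zf_flip; apply: eq_Zf => // v; rewrite andbN.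
have -> : Z n m (fun w => bc false w || ~~ bc false w) 0 predT = Z n m (bc true) 0 predT.
  by apply: eq_Zf => // v; rewrite orbN.
by rewrite -!expr2 ler_pXn2r // nnegrE Zf_ge0.
Qed.

Definition wall_ratio n m : R :=
  Z n m (bc false) 0 predT / Z n m (bc true) 0 predT.

Lemma Zbc_gt0 n m b lam : 0 < Z n m (bc b) lam predT.
Proof. exact: (@Zf_gt0 R x n m x0 _ _ predT [ffun=> true]). Qed.

(** FKG: [plus_off] is an increasing event, hence more likely under the plus boundary condition. *)
Lemma window_le n m a n' m' lam : (a + n' <= n)%N -> (m' <= m)%N ->
  Z n m (bcw a n' false) lam (plus_off a n' m') * Z n m (bc true) lam predT <=
  Z n m (bcw a n' false) lam predT * Z n m (bc true) lam (plus_off a n' m').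
Proof.
move=> an mm.
have := @Zf_four R x n m x0 x1 (bcw a n' false) (bc true) lam lam lam lam
  (plus_off a n' m') predT predT (plus_off a n' m') erefl (lexx _) (lexx _).
set A := _ * _; set B := _ * _ => H.
rewrite (@eq_Zf _ x n m (bcw a n' false) (fun w => bcw a n' false w && bc true w) _ predT predT) //; last by move=> v; rewrite andbT.
rewrite (@eq_Zf _ x n m (bc true) (fun w => bcw a n' false w || bc true w) _ (plus_off a n' m') (plus_off a n' m')) //; last by move=> v; rewrite orbT.
apply: H => s t /forallP sp _ /=; apply/forallP => i; rewrite ffunE.
by have := sp i; case: inrect => //= ->.
Qed.

(** Two windows are put side by side. Minus below both is the meet of minus below each, the join is
    plus, and freezing everything outside one window to plus can only lower its ratio. *)
Lemma wall_ratio_supermul n m k :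
  wall_ratio k m * wall_ratio n m <= wall_ratio (k + n) m.
Proof.
set w := (k + n)%N.
have W a n' : (a + n' <= w)%N -> wall_ratio n' m * Z w m (bc true) 0 predT <=
    Z w m (bcw a n' false) 0 predT.
  move=> an; have := @window_le w m a n' m 0 an (leqnn _).
  rewrite (Zf_emb _ false an (leqnn _)).
  rewrite (@eq_Zf _ x w m (bc true) (bcw a n' true) 0 (plus_off a n' m) (plus_off a n' m)) //.
  rewrite (Zf_emb _ true an (leqnn _)) => H.
  by rewrite /wall_ratio mulrAC ler_pdivrMr // Zbc_gt0.
have H1 := W 0%N k (leq_addr _ _); have H2 := W k n (leqnn _).
have := @Zf_four R x w m x0 x1 (bcw 0 k false) (bcw k n false) 0 0 0 0 predT predT predT predT erefl (lexx _) (lexx _) (fun _ _ _ _ => isT).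
rewrite (@eq_Zf_in w m (fun v => bcw 0 k false v && bcw k n false v) (bc false)); last first.
  by move=> v; rewrite /bcw /bc /dobrushin /w /=; case: (0 <= v.2) => //=; lia.
rewrite (@eq_Zf_in w m (fun v => bcw 0 k false v || bcw k n false v) (bc true)); last first.
  by move=> v; rewrite /bcw /bc /dobrushin /w /=; case: (0 <= v.2) => //=; lia.
move=> H3; rewrite {3}/wall_ratio ler_pdivlMr ?Zbc_gt0 //.
have Zp := Zbc_gt0 w m true 0.
rewrite -(ler_pM2r Zp); apply: le_trans H3; apply: le_trans (ler_pM _ _ H1 H2).
- by rewrite le_eqVlt; apply/orP; left; apply/eqP; rewrite /w; ring.
- by rewrite mulr_ge0 ?(ltW Zp) // divr_ge0 // Zf_ge0.
- by rewrite mulr_ge0 ?(ltW Zp) // divr_ge0 // Zf_ge0.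
Qed.

Hypothesis t1 : tau_exp x < 1.
Notation t := (tau_exp x).

Lemma wall_ratio_spectral m : (0 < m)%N -> exists rho : R,
  [/\ 0 < rho, rho <= t,
      forall h, (0 < h)%N -> m = (2 * h)%N -> rho ^+ 2 + 1 <= (t + t^-1 + 6 / h%:R ^+ 2) * rho,
      forall n, x ^+ (3 * m) * rho ^+ n <= wall_ratio n m &
      forall n, x ^+ (3 * m) * wall_ratio n m <= rho ^+ n].
Proof.
move=> m0.
have [lp [wp [lp0 wp0 wpE _]]] := perron m x0 true.
have [lm [wm [lm0 wm0 wmE lm_max]]] := perron m x0 false.
have Bp := Zcol_bounds x0 x1 lp0 wp0 wpE.
have Bm := Zcol_bounds x0 x1 lm0 wm0 wmE.
have rp : 0 < lm / lp by rewrite divr_gt0.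
have xp k : 0 < x ^+ k by rewrite exprn_gt0.
have E3 : x ^+ (3 * m) = x ^+ (2 * m) * x ^+ m by rewrite -exprD; congr (_ ^+ _); lia.
have Zc n b : 0 < Zcol m x b n by rewrite -Zf_transfer Zbc_gt0.
have L n : x ^+ (3 * m) * (lm / lp) ^+ n <= wall_ratio n m.
  rewrite /wall_ratio !Zf_transfer ler_pdivlMr //.
  have [l1 _] := Bm n; have [_ u2] := Bp n.
  rewrite E3 expr_div_n; apply: le_trans l1.
  have -> : x ^+ (2 * m) * x ^+ m * (lm ^+ n / lp ^+ n) * Zcol m x true n =
     x ^+ (2 * m) * lm ^+ n * ((x ^+ m * Zcol m x true n) / lp ^+ n) by ring.
  rewrite ler_piMr // ?mulr_ge0 ?(ltW (xp _)) ?exprn_ge0 ?(ltW lm0) //.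
  by rewrite ler_pdivrMr ?exprn_gt0 // mul1r.
have U n : x ^+ (3 * m) * wall_ratio n m <= (lm / lp) ^+ n.
  rewrite /wall_ratio !Zf_transfer mulrA ler_pdivrMr //.
  have [_ u1] := Bm n; have [l2 _] := Bp n.
  rewrite E3 expr_div_n.
  have -> : lm ^+ n / lp ^+ n * Zcol m x true n = lm ^+ n * (Zcol m x true n / lp ^+ n) by ring.
  have -> : x ^+ (2 * m) * x ^+ m * Zcol m x false n = (x ^+ m * Zcol m x false n) * x ^+ (2 * m) by ring.
  apply: ler_pM => //; rewrite ?mulr_ge0 ?(ltW (xp _)) ?(ltW (Zc _ _)) //.
  by rewrite ler_pdivlMr ?exprn_gt0.
(* The wall ratio is at most 1 by [Zf_minus_le], and the constant in [L] does not depend on the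
   power. *)
have lmlp : lm <= lp.
  rewrite -[lp]mul1r -ler_pdivrMr //.
  apply: (@bounded_powers_le1 _ _ (x ^+ (3 * m))^-1); first exact: ltW.
  move=> k; rewrite -(ler_pM2l (xp (3 * m)%N)) mulfV ?gt_eqF //.
  apply: le_trans (L k) _; rewrite /wall_ratio ler_pdivrMr ?Zbc_gt0 // mul1r.
  exact: Zf_minus_le.
exists (lm / lp); split => //.
  rewrite ler_pdivrMr //.
  exact: (transfer_upper x0 x1 m0 lp0 lm0 wp0 wm0 wpE wmE t1 lmlp).
move=> h h0 mh.
have le := transfer_lower x0 x1 m0 lp0 lm0 wp0 wpE lm_max t1 lmlp h0 mh.
have lp2 : 0 < lp ^+ 2 by rewrite exprn_gt0.
rewrite -(ler_pM2r lp2); set c := t + _ + _ in le *.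
have -> : ((lm / lp) ^+ 2 + 1) * lp ^+ 2 = lm ^+ 2 + lp ^+ 2 by field; rewrite gt_eqF.
have -> : c * (lm / lp) * lp ^+ 2 = c * (lm * lp) by field; rewrite gt_eqF.
by [].
Qed.

Lemma wall_ratio_ge0 n m : 0 <= wall_ratio n m.
Proof. by rewrite divr_ge0 // Zf_ge0. Qed.

(** The spectral bound alone would lose [x ^+ (3 * m)], too much when [m] is comparable to [n]. It
    is applied at width [k * n], where supermultiplicativity bounds the k-th power of the ratio, and
    the constant disappears as [k] grows. *)
Lemma wall_ratio_upper n m : (0 < m)%N -> wall_ratio n m <= t ^+ n.
Proof.
move=> m0; have [r [r0 rt _ _ U]] := wall_ratio_spectral m0.
have t0 : 0 < t by exact: tau_exp_gt0.
suff H : wall_ratio n m <= r ^+ n.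
  by apply: le_trans H _; rewrite lerXn2r ?nnegrE ?(ltW r0) ?(ltW t0).
rewrite -[leRHS]mul1r -ler_pdivrMr ?exprn_gt0 //.
apply: (@bounded_powers_le1 _ _ (x ^+ (3 * m))^-1).
  by rewrite divr_ge0 ?wall_ratio_ge0 ?exprn_ge0 // ltW.
move=> k; rewrite expr_div_n ler_pdivrMr ?exprn_gt0 ?exprn_gt0 //.
have S : wall_ratio n m ^+ k <= wall_ratio (k * n) m.
  elim: k => [|k IH].
    rewrite expr0 mul0n /wall_ratio !Zf_transfer.
    by rewrite /Zcol /= divff // gt_eqF // hweight_gt0.
  rewrite exprSr mulSnr; apply: le_trans (wall_ratio_supermul _ _ _).
  by rewrite ler_wpM2r // wall_ratio_ge0.
apply: le_trans S _; rewrite -exprM mulnC mulrC ler_pdivlMr ?exprn_gt0 // mulrC.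
exact: U.
Qed.

Lemma wall_ratio_lower : exists2 C : R, 0 < C & forall n h, (0 < h)%N ->
  t ^+ n * expR (- (C * (h%:R + n%:R / h%:R ^+ 2))) <= wall_ratio n (2 * h).
Proof.
have t0 : 0 < t by exact: tau_exp_gt0.
have t2 : 0 < 1 - t ^+ 2 by rewrite subr_gt0 expr_lt1 // ltW.
(* The quadratic inequality for r = lm/lp factors as (t - r)(1 - r t) <= (6 / h^2) r t, hence t/r <=
   1 + c1 / h^2. The constant [c2] pays for the factor x^(6 h). *)
pose c1 := 6 * t / (1 - t ^+ 2).
have c10 : 0 < c1 by rewrite divr_gt0 // mulr_gt0.
pose c2 := - (6 * ln x).
have c20 : 0 < c2.
  by rewrite oppr_gt0 pmulr_rlt0 //; apply: ln_lt0; rewrite x0 x1.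
exists (c1 + c2); first by rewrite addr_gt0.
move=> n h h0; have hp : 0 < h%:R :> R by rewrite ltr0n.
have m0 : (0 < 2 * h)%N by lia.
have [r [r0 rt rq L _]] := wall_ratio_spectral m0.
apply: le_trans (L n).
have hE : x ^+ (3 * (2 * h)) = expR (- (c2 * h%:R)).
  rewrite -[x in LHS](lnK x0) -expRM_natl; congr expR; rewrite /c2 natrM natrM; ring.
have tr : t <= r * expR (c1 / h%:R ^+ 2).
  apply: (@le_trans _ _ (r * (1 + c1 / h%:R ^+ 2))); last by rewrite ler_pM2l // expR_ge1Dx.
  have := rq h h0 erefl.
  pose d : R := 6 / h%:R ^+ 2; rewrite -/d => q.
  have dp : 0 < d by rewrite divr_gt0 // exprn_gt0.
  have -> : c1 / h%:R ^+ 2 = t * d / (1 - t ^+ 2) by rewrite /c1 /d; field; rewrite ?gt_eqF //.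
  have K : (t - r) * (1 - r * t) <= d * (r * t).
    have := ler_wpM2l (ltW t0) q.
    have -> : t * ((t + t^-1 + d) * r) = t ^+ 2 * r + r + d * (r * t) by field; rewrite gt_eqF.
    by rewrite mulrDr !expr2; lra.
  have K2 : (t - r) * (1 - t ^+ 2) <= d * (r * t).
    apply: le_trans K; rewrite ler_wpM2l ?subr_ge0 // lerD2l lerN2 expr2.
    by rewrite ler_wpM2r // ltW.
  rewrite mulrDr mulr1 -lerBlDl mulrA ler_pdivlMr //; apply: le_trans K2 _.
  by rewrite le_eqVlt; apply/orP; left; apply/eqP; ring.
rewrite hE; set e1 := c1 / h%:R ^+ 2 in tr.
have -> : - ((c1 + c2) * (h%:R + n%:R / h%:R ^+ 2)) =
    - (c2 * h%:R) + (- (n%:R * e1) + - (c1 * h%:R + c2 * (n%:R / h%:R ^+ 2))).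
  by rewrite /e1; field; rewrite gt_eqF.
rewrite 2!expRD mulrCA ler_pM2l ?expR_gt0 // mulrA.
apply: (@le_trans _ _ (t ^+ n * expR (- (n%:R * e1)))).
  rewrite ler_piMr ?mulr_ge0 ?exprn_ge0 ?expR_ge0 ?(ltW t0) //.
  rewrite -[leRHS]expR0 ler_expR oppr_le0.
  apply: addr_ge0; first exact: mulr_ge0 (ltW c10) (ltW hp).
  by apply: mulr_ge0 (ltW c20) _; rewrite divr_ge0 ?exprn_ge0 ?ler0n.
rewrite expRN expRM_natl ler_pdivrMr ?exprn_gt0 ?expR_gt0 // -exprMn.
by apply: lerXn2r => //; rewrite nnegrE ?(ltW t0) // mulr_ge0 ?expR_ge0 // ltW.
Qed.

End SurfaceTension.

(** * The effect of the field on the wall ratio *)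

Section FieldRatio.
Variables (R : realType) (x : R).
Hypotheses (x0 : 0 < x) (x1 : x < 1).
Notation Z n m := (@Zf R x n m).

Lemma mag_le n m (s : rect n m) : mag R s <= (n * m)%:R.
Proof.
rewrite -[n in (n * m)%N]card_ord -[m in (_ * m)%N]card_ord -card_prod -sumr_const.
by apply: ler_sum => i _; case: (s i); lra.
Qed.

Lemma mag_ge n m (s : rect n m) : - (n * m)%:R <= mag R s.
Proof.
rewrite -[n in (n * m)%N]card_ord -[m in (_ * m)%N]card_ord -card_prod -sumr_const -sumrN.
by apply: ler_sum => i _; case: (s i); lra.
Qed.

Lemma mag_plus_off n m m' (s : rect n m) : (m' <= m)%N -> plus_off 0 n m' s ->
  (n * m)%:R - 2 * (n * m')%:R <= mag R s.
Proof.
move=> mm /forallP sp.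
have E : (n * m')%:R = \sum_(i : 'I_n * 'I_m) (if (i.2 < m')%N then 1 else 0) :> R.
  rewrite -big_mkcond /= sumr_const; congr (_%:R).
  rewrite -[n in LHS]card_ord -[m' in LHS]card_ord -card_prod.
  pose f (j : 'I_n * 'I_m') : 'I_n * 'I_m := (j.1, widen_ord mm j.2).
  rewrite -(card_imset predT (f := f)); last first.
    by move=> [a b] [c d] [] -> bd; congr pair; apply: val_inj.
  apply: eq_card => -[a b]; rewrite [RHS]unfold_in /=; apply/imsetP/idP => [[[c d] _ [_ ->]] /=|bm].
    exact: ltn_ord.
  by exists (a, Ordinal (bm : (b < m')%N)) => //; congr pair; apply: val_inj.
rewrite E -[n in (n * m)%N]card_ord -[m in (_ * m)%N]card_ord -card_prod -sumr_const.
rewrite big_distrr -sumrB; apply: ler_sum => i _ /=.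
have := sp i; case: ltnP => im; first by case: (s i) => _; lra.
suff -> : inrect n m' (shift 0 (pos i)) = false by move=> /= ->; lra.
by rewrite /inrect /shift /pos /=; lia.
Qed.

Lemma Zf_field_le n m eta lam P : 0 <= lam ->
  Z n m eta lam P <= expR (lam * (n * m)%:R) * Z n m eta 0 P.
Proof.
move=> l0; rewrite /Zf big_distrr /=; apply: ler_sum => s _.
rewrite /wgt mul0r expR0 mulr1 mulrC ler_wpM2r ?exprn_ge0 ?(ltW x0) //.
by rewrite ler_expR ler_wpM2l // mag_le.
Qed.

Lemma Zf_field_ge n m eta lam (P : pred (rect n m)) (K : R) : 0 <= lam ->
  (forall s, P s -> K <= mag R s) ->
  expR (lam * K) * Z n m eta 0 P <= Z n m eta lam P.
Proof.
move=> l0 PK; rewrite /Zf big_distrr /=; apply: ler_sum => s Ps.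
rewrite /wgt mul0r expR0 mulr1 mulrC ler_wpM2l ?exprn_ge0 ?(ltW x0) //.
by rewrite ler_expR ler_wpM2l // PK.
Qed.

Hypothesis t1 : tau_exp x < 1.

(** The window consists of the 2 h lowest rows. On [plus_off] the magnetization is within 4 n h of
    its maximum, so the field contributes nearly the same factor for both boundary conditions. At
    zero field, the powers t^n in [wall_ratio_upper] for the box and [wall_ratio_lower] for the
    strip cancel. *)
Lemma field_ratio : exists2 C : R, 0 < C & forall n h lam, 0 <= lam -> (0 < h)%N -> (2 * h <= n)%N ->
  Z n n (bc false) 0 predT * Z n n (bc true) lam predT <=
  expR (4 * lam * (n%:R * h%:R) + C * (h%:R + n%:R / h%:R ^+ 2)) *
  (Z n n (bc true) 0 predT * Z n n (bc false) lam predT).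
Proof.
have [C C0 HC] := wall_ratio_lower x0 x1 t1.
exists C => // n h lam l0 h0 hn.
set E := expR _.
have Ep : 0 < E by exact: expR_gt0.
have n0 : (0 < n)%N by lia.
pose P := @plus_off n n 0 n (2 * h).
have Pt : P [ffun=> true] by apply/forallP => i; rewrite ffunE orbT.
have win := @window_le R x x0 x1 n n 0 n (2 * h) lam (leqnn _) hn.
rewrite -/P in win.
have B1 : expR (lam * ((n * n)%:R - 2 * (n * (2 * h))%:R)) * Z n n (bcw 0 n false) 0 P <=
          Z n n (bcw 0 n false) lam P.
  by apply: Zf_field_ge => // s; apply: mag_plus_off.
have B2 : Z n n (bc true) lam P <= expR (lam * (n * n)%:R) * Z n n (bc true) 0 P.
  exact: Zf_field_le.
have S1 : Z n n (bcw 0 n false) 0 P = Z n (2 * h) (bc false) 0 predT.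
  by rewrite /P Zf_emb.
have S2 : Z n n (bc true) 0 P = Z n (2 * h) (bc true) 0 predT.
  rewrite -(Zf_emb x true (leqnn (0 + n)) hn).
  exact: eq_Zf.
have S3 : Z n n (bcw 0 n false) lam predT = Z n n (bc false) lam predT.
  apply: (eq_Zf_in x0 x1) => v; rewrite /bcw /bc /dobrushin /=.
  by case: (0 <= v.2) => //=; lia.
rewrite S1 in B1; rewrite S2 in B2; rewrite S3 in win.
have U := wall_ratio_upper x0 x1 t1 n n0.
have L := HC n h h0.
have Zp0 := @Zbc_gt0 R x x0 n n true 0.
have Zpl := @Zbc_gt0 R x x0 n n true lam.
have Zh := @Zbc_gt0 R x x0 n (2 * h) true 0.
have ZhP : 0 < Z n n (bc true) lam P by apply: (Zf_gt0 x0 _ _ Pt).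
set G := expR (- (C * _)) in L.
set a := Z n n (bc false) 0 predT in U *; set b := Z n n (bc true) 0 predT in U Zp0 *.
set al := Z n n (bc false) lam predT in win *; set bl := Z n n (bc true) lam predT in win Zpl *.
set p := Z n (2 * h) (bc false) 0 predT in L B1; set q := Z n (2 * h) (bc true) 0 predT in L B2 Zh.
set ql := Z n n (bc true) lam P in win B2 ZhP; set pl := Z n n _ lam P in win B1.
have Gp : 0 < G by exact: expR_gt0.
have aU : a <= tau_exp x ^+ n * b by rewrite -ler_pdivrMr.
have pL : tau_exp x ^+ n * G * q <= p by rewrite -ler_pdivlMr.
have key : a * G * q <= b * p.
  apply: le_trans (_ : tau_exp x ^+ n * b * G * q <= _).
    by rewrite !ler_pM2r.
  have -> : tau_exp x ^+ n * b * G * q = b * (tau_exp x ^+ n * G * q) by ring.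
  by rewrite ler_pM2l.
pose e1 := expR (lam * ((n * n)%:R - 2 * (n * (2 * h))%:R)).
pose e2 := expR (lam * (n * n)%:R).
have e1p : 0 < e1 by exact: expR_gt0.
have e2p : 0 < e2 by exact: expR_gt0.
rewrite -/e1 in B1; rewrite -/e2 in B2.
have EE : E * e1 * G = e2.
  rewrite /E /e1 /G /e2 -!expRD; congr expR.
  rewrite !natrM; ring.
(* multiply up: a bl ql G <= a bl e2 q G <= e2 bl b p <= (e2/e1) b bl pl <= (e2/e1) b al ql *)
rewrite -(ler_pM2r ZhP) -(ler_pM2r Gp) -(ler_pM2r e1p).
apply: le_trans (_ : a * bl * (e2 * q) * G * e1 <= _).
  rewrite !ler_pM2r // ler_wpM2l // mulr_ge0 ?(ltW Zpl) // Zf_ge0 //.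
have -> : a * bl * (e2 * q) * G * e1 = e2 * bl * e1 * (a * G * q) by ring.
apply: le_trans (_ : e2 * bl * e1 * (b * p) <= _).
  by rewrite ler_pM2l // !mulr_gt0.
have -> : e2 * bl * e1 * (b * p) = e2 * b * ((e1 * p) * bl) by ring.
apply: le_trans (_ : e2 * b * (pl * bl) <= _).
  by rewrite ler_pM2l ?mulr_gt0 // ler_pM2r.
apply: le_trans (_ : e2 * b * (al * ql) <= _).
  by rewrite ler_pM2l ?mulr_gt0.
by rewrite -EE le_eqVlt; apply/orP; left; apply/eqP; ring.
Qed.

End FieldRatio.

(** * Dual paths, parity flips and the Peierls estimate *)

Fixpoint wend (u : dvertex) (w : seq dir) : dvertex :=
  if w is d :: w' then wend (dstep u d) w' else u.
Fixpoint wbonds (u : dvertex) (w : seq dir) : seq (site * site) :=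
  if w is d :: w' then dsep u d :: wbonds (dstep u d) w' else [::].
Fixpoint wverts (u : dvertex) (w : seq dir) : seq dvertex :=
  u :: if w is d :: w' then wverts (dstep u d) w' else [::].

Lemma wend_cat u w w' : wend u (w ++ w') = wend (wend u w) w'.
Proof. by elim: w u => //= d w IH u. Qed.
Lemma wbonds_cat u w w' : wbonds u (w ++ w') = wbonds u w ++ wbonds (wend u w) w'.
Proof. by elim: w u => //= d w IH u; rewrite IH. Qed.
Lemma size_wbonds u w : size (wbonds u w) = size w.
Proof. by elim: w u => //= d w IH u; rewrite IH. Qed.
Lemma wverts_cat (P : pred dvertex) u w w' : all P (wverts u (w ++ w')) =
  all P (wverts u w) && all P (wverts (wend u w) w').
Proof.
elim: w u => [|d w IH] u /=; last by rewrite IH andbA.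
by case: w' => [|d w'] /=; case: (P u).
Qed.

(* the bond e is crossed by the ray going down from v *)
Definition below (v : site) (e : site * site) : bool :=
  [&& e.1.1 == e.2.1, e.2.1 == v.1 & e.2.2 <= v.2].
(** For a closed path, the winding number of the path around [v] modulo 2. *)
Definition parity (L : seq (site * site)) (v : site) : bool := odd (count (below v) L).

(** The right side tests whether the ends of the path lie on the dual half-line between the two
    downward rays. Each step accounts for the change of this test, so the contributions telescope
    and cancel for a closed path. *)
Lemma parity_right u w v :
  parity (wbonds u w) v (+) parity (wbonds u w) (right_of v)
  (+) odd (count_mem (v, right_of v) (wbonds u w)) =
  ((u.1 == v.1 + 1) && (u.2 <= v.2)) (+) (((wend u w).1 == v.1 + 1) && ((wend u w).2 <= v.2)).
Proof.
elim: w u => [|d w IH] u /=; first by rewrite addbb.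
rewrite /parity /= !oddD !oddb.
have bl (A B C E b1 b2 c X W : bool) : b1 (+) b2 (+) c = X (+) E ->
    A (+) B (+) C = E (+) W -> (b1 (+) A) (+) (b2 (+) B) (+) (c (+) C) = X (+) W.
  by case: A; case: B; case: C; case: E; case: b1; case: b2; case: c; case: X; case: W.
apply: bl (IH (dstep u d)).
rewrite /below /right_of; case: u v {IH} => a b [k j].
by case: d; rewrite /= !xpair_eqE /=; lia.
Qed.

Lemma parity_up u w v :
  parity (wbonds u w) v (+) parity (wbonds u w) (up_of v)
  = odd (count_mem (v, up_of v) (wbonds u w)).
Proof.
elim: w u => [|d w IH] u //=; rewrite /parity /= !oddD !oddb.
have bl (A B C b1 b2 c : bool) : b1 (+) b2 = c ->
    A (+) B = C -> (b1 (+) A) (+) (b2 (+) B) = c (+) C.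
  by case: A; case: B; case: C; case: b1; case: b2; case: c.
apply: bl (IH (dstep u d)).
rewrite /below /up_of; case: u v {IH} => a b [k j].
by case: d; rewrite /= !xpair_eqE /=; lia.
Qed.

Definition is_bond (e : site * site) : bool :=
  (e.2 == right_of e.1) || (e.2 == up_of e.1).

Lemma is_bond_dsep u d : is_bond (dsep u d).
Proof. by case: u => a b; case: d; rewrite /is_bond /right_of /up_of /= !xpair_eqE; lia. Qed.

Lemma parity_bond u w e : wend u w = u -> is_bond e ->
  parity (wbonds u w) e.1 (+) parity (wbonds u w) e.2 = odd (count_mem e (wbonds u w)).
Proof.
case: e => p q cl /orP[] /= /eqP ->; last exact: parity_up.
have := parity_right u w p; rewrite cl addbb.
by case: parity; case: parity; case: odd.
Qed.

Definition in_window (x0 x1 y0 y1 : int) (z : dvertex) : bool :=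
  (x0 <= z.1 <= x1) && (y0 <= z.2 <= y1).

Lemma wbonds_window x0 x1 y0 y1 u w e : all (in_window x0 x1 y0 y1) (wverts u w) ->
  e \in wbonds u w ->
  (e.2.1 == e.1.1 + 1) && (e.2.2 == e.1.2) && (y0 <= e.1.2 < y1) && (x0 <= e.2.1 <= x1) ||
  (e.2.1 == e.1.1) && (e.2.2 == e.1.2 + 1) && (x0 <= e.1.1 < x1) && (y0 <= e.2.2 <= y1).
Proof.
elim: w u => [|d w IH] u //=; rewrite inE => /andP[u_in w_in] /orP[/eqP ->|]; last exact: IH.
have : in_window x0 x1 y0 y1 (dstep u d) by case: w w_in {IH} => [|? ?] /= /andP[].
case: u u_in {IH w_in} => a b; rewrite /in_window.
by case: d => /=; lia.
Qed.

Lemma parity_window x0 x1 y0 y1 u w v : wend u w = u ->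
  all (in_window x0 x1 y0 y1) (wverts u w) ->
  parity (wbonds u w) v -> (x0 <= v.1 < x1) && (y0 <= v.2 < y1).
Proof.
move=> cl win; set L := wbonds u w.
have col z : parity L z -> (x0 <= z.1 < x1) && (y0 <= z.2).
  apply: contraTT => zo; rewrite /parity (eq_in_count (a2 := pred0)) ?count_pred0 // => e eL.
  move: (wbonds_window win eL); case: e z {eL} zo => [[a b] [c d]] [k j]; rewrite /below /= => zo h.
  apply/negbTE; lia.
move=> pv; have := col v pv => /andP[-> y0v] /=; rewrite y0v /= ltNge; apply/negP => y1v.
(* Above the window no bond of the path separates sites of this row, so the parity keeps the value 0
   it has left of the window. *)
have row (k : nat) : parity L (x0 - 1 + k%:Z, v.2) = false.
  elim: k => [|k IH].
    by apply/negP => /col /=; lia.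
  have bd : is_bond ((x0 - 1 + k%:Z, v.2), (x0 - 1 + k.+1%:Z, v.2)).
    by rewrite /is_bond /right_of !xpair_eqE /=; lia.
  have := parity_bond cl bd.
  rewrite /= IH /= => ->; apply/negP => o.
  have : ((x0 - 1 + k%:Z, v.2), (x0 - 1 + k.+1%:Z, v.2)) \in L.
    by rewrite -has_pred1 has_count; case: count o.
  by move=> /(wbonds_window win) /=; lia.
have /andP[v1 _] := col v pv.
have := row (absz (v.1 - x0 + 1)).
have -> : (x0 - 1 + (absz (v.1 - x0 + 1))%:Z, v.2) = v.
  by case: (v) v1 => a b /= v1; congr pair; lia.
by rewrite pv.
Qed.

Lemma wverts_ball u w : all (in_window (u.1 - (size w)%:Z) (u.1 + (size w)%:Z)
   (u.2 - (size w)%:Z) (u.2 + (size w)%:Z)) (wverts u w).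
Proof.
elim: w u => [|d w IH] u /=; rewrite /in_window; first by rewrite andbT /=; lia.
apply/andP; split; first by lia.
apply: sub_all (IH (dstep u d)) => z; rewrite /in_window.
by case: d => /=; lia.
Qed.

Section Flip.
Variables (n m : nat) (eta : site -> bool) (u : dvertex) (w : seq dir).
Hypothesis closed_w : wend u w = u.
Hypothesis box_w : all (in_window 0 n%:Z 0 m%:Z) (wverts u w).

Definition flip_config (s : rect n m) : rect n m :=
  [ffun i => s i (+) parity (wbonds u w) (pos i)].

Lemma flip_configK : involutive flip_config.
Proof. by move=> s; apply/ffunP => i; rewrite !ffunE addbK. Qed.

Lemma ext_flip s v : ext eta (flip_config s) v = ext eta s v (+) parity (wbonds u w) v.
Proof.
have [/inrectP[i <-]|nv] := boolP (inrect n m v); first by rewrite !ext_in ffunE.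
rewrite !ext_out //; case E: (parity _ v); last by rewrite addbF.
by have := parity_window closed_w box_w E; move: nv; rewrite /inrect => /negP.
Qed.

Lemma disagree_flip s e : is_bond e ->
  disagree (ext eta (flip_config s)) e = disagree (ext eta s) e (+) odd (count_mem e (wbonds u w)).
Proof.
move=> be; rewrite -(parity_bond closed_w be) /disagree !ext_flip.
by case: ext; case: ext; case: parity; case: parity.
Qed.

End Flip.

Lemma bonds_uniq n m : uniq (bonds n m).
Proof.
rewrite cat_uniq; apply/and3P; split.
- apply: allpairs_uniq; rewrite ?iota_uniq // => -[a b] [c d] _ _ /= [].
  by move=> _ _ -> ->.
- apply/hasPn => e /allpairsP[[a b] /= [_ _ ->]].
  by apply/negP => /= h; have /allpairsP[[c d] /= [_ _ []]] : (a%:Z, b%:Z - 1, (a%:Z, b%:Z)) \in [seq ((k%:Z - 1, j%:Z), (k%:Z, j%:Z)) | k <- iota 0 n.+1, j <- iota 0 m] by []; lia.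
- apply: allpairs_uniq; rewrite ?iota_uniq // => -[a b] [c d] _ _ /= [].
  by move=> _ _ -> ->.
Qed.

Lemma bonds_is_bond n m e : e \in bonds n m -> is_bond e.
Proof.
rewrite mem_cat => /orP[] /allpairsP[[a b] /= [_ _ ->]];
  rewrite /is_bond /right_of /up_of !xpair_eqE /=; lia.
Qed.

Lemma count_mem_sub (T : eqType) (s l : seq T) :
  uniq s -> uniq l -> {subset l <= s} -> count (mem l) s = size l.
Proof.
move=> us ul ls; rewrite -size_filter; apply/perm_size/uniq_perm => //.
  exact: filter_uniq.
move=> e; rewrite mem_filter; case el : (e \in l); first by rewrite /= el ls.
by rewrite /= el.
Qed.

Lemma sum_count_mem_le (T : eqType) (s l : seq T) :
  uniq s -> (\sum_(e <- s) count_mem e l <= size l)%N.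
Proof.
move=> us; elim: l => [|a l IH] /=; first by rewrite big1.
rewrite big_split /= -add1n leq_add //.
have -> : (\sum_(e <- s) (a == e) = count_mem a s)%N.
  rewrite -sum1_count [RHS]big_mkcond /=; apply: eq_bigr => e _.
  by rewrite eq_sym; case: (_ == _).
by rewrite count_uniq_mem //; case: (_ \in _).
Qed.

Section Peierls.
Variables (R : realType) (x : R) (n m : nat) (eta : site -> bool).
Hypotheses (x0 : 0 < x) (x1 : x < 1).
Variables (u : dvertex) (t r : seq dir).
Hypothesis closed_tr : wend u (t ++ r) = u.
Hypothesis box_tr : all (in_window 0 n%:Z 0 m%:Z) (wverts u (t ++ r)).
Hypothesis uniq_t : uniq (wbonds u t).

Definition trail_in (L : seq (site * site)) (s : rect n m) : bool :=
  all (fun e => (e \in bonds n m) && disagree (ext eta s) e) L.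

(** Flipping toggles the bonds crossed an odd number of times. Those of [t] were all disagreements,
    and each step of the closing path [r] spoils at most one bond. *)
Lemma bond_energy_flip s : trail_in (wbonds u t) s ->
  (bond_energy n m (ext eta (flip_config u (t ++ r) s)) + size t
   <= bond_energy n m (ext eta s) + size r)%N.
Proof.
move=> /allP ts; set r' := wbonds (wend u t) r.
have St : size t = (\sum_(e <- bonds n m) (e \in wbonds u t))%N.
  have sub : {subset wbonds u t <= bonds n m} by move=> e /ts /andP[].
  rewrite -(size_wbonds u t) -(count_mem_sub (bonds_uniq n m) uniq_t sub) -sum1_count [LHS]big_mkcond /=.
  by apply: eq_bigr => e _; case: (_ \in _).
apply: leq_trans (leq_add (leqnn _) (_ : \sum_(e <- bonds n m) count_mem e r' <= _)%N); last first.
  by rewrite -(size_wbonds (wend u t) r); apply: sum_count_mem_le; exact: bonds_uniq.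
rewrite St /bond_energy -!sum1_count !(big_mkcond (disagree _)) -!big_split /=.
rewrite big_seq [leqRHS]big_seq; apply: leq_sum => e eb.
rewrite (disagree_flip eta closed_tr box_tr) ?(bonds_is_bond eb) // wbonds_cat count_cat -/r'.
rewrite (count_uniq_mem _ uniq_t) oddD oddb.
case et : (e \in wbonds u t).
  have /andP[_ ->] := ts e et.
  by rewrite /=; case: (count_mem e r') => [|k] //=; case: odd.
rewrite /= addn0; case: disagree => /=; case: (count_mem e r') => [|k] //=; case: odd => //.
Qed.

Lemma peierls : x ^+ size r * (\sum_(s | trail_in (wbonds u t) s) wgt x eta 0 s)
  <= x ^+ size t * Zf (n := n) (m := m) x eta 0 predT.
Proof.
rewrite !big_distrr /= [leRHS](reindex_inj (inv_inj (@flip_configK n m u (t ++ r)))) /=.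
rewrite [leLHS]big_mkcond; apply: ler_sum => s _; case: ifP => ts; last first.
  by rewrite mulr_ge0 ?exprn_ge0 ?(ltW x0) // ltW // wgt_gt0.
rewrite /wgt !mul0r expR0 !mulr1 -!exprD; apply: ler_wiXn2l; rewrite ?(ltW x0) ?(ltW x1) //.
by rewrite addnC (addnC (size r)) bond_energy_flip.
Qed.

End Peierls.

(** * Closed trails around minus clusters *)

Lemma mem_bonds n m e : is_bond e -> inrect n m e.1 || inrect n m e.2 -> e \in bonds n m.
Proof.
case: e => [[a b] [c d]] be ine; rewrite mem_cat.
rewrite /is_bond /right_of /up_of /inrect !xpair_eqE /= in be ine.
apply/orP; case/orP: be => /andP[/eqP E1 /eqP E2]; [left|right]; apply/allpairsP;
  exists (absz c, absz d); rewrite !mem_iota; split; rewrite /=; try lia; congr pair; congr pair; lia.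
Qed.

Lemma bonds_window n m z d : dsep z d \in bonds n m ->
  in_window 0 n%:Z 0 m%:Z z && in_window 0 n%:Z 0 m%:Z (dstep z d).
Proof.
case: z => a b; rewrite mem_cat /in_window => /orP[] /allpairsP[[k j] []];
  rewrite !mem_iota; case: d => /= kn jm [] *; lia.
Qed.

Lemma wverts_window n m u w : (0 < size w)%N -> {subset wbonds u w <= bonds n m} ->
  all (in_window 0 n%:Z 0 m%:Z) (wverts u w).
Proof.
elim: w u => [//|d w IH] u _ sub /=.
have /andP[-> d_in] : in_window 0 n%:Z 0 m%:Z u && in_window 0 n%:Z 0 m%:Z (dstep u d).
  by apply: bonds_window; apply: sub; rewrite inE eqxx.
case: w IH sub => [|d' w] IH sub; first by rewrite /= d_in.
by apply: IH => // e ew; apply: sub; rewrite inE ew orbT.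
Qed.

Lemma dsep_degree z u d :
  (\sum_(d' <- alldirs) (dsep u d == dsep z d'))%N = ((z == u) + (z == dstep u d))%N.
Proof.
rewrite /alldirs !big_cons big_nil; case: z u => [a b] [k j].
by case: d; rewrite /= !xpair_eqE; lia.
Qed.

Lemma trail_degree z u w :
  odd (\sum_(d <- alldirs) count_mem (dsep z d) (wbonds u w)) = (z == u) (+) (z == wend u w).
Proof.
elim: w u => [|d w IH] u /=; first by rewrite big1 // addbb.
rewrite big_split /= oddD dsep_degree IH oddD !oddb.
by case: (z == dstep u d); case: (z == u); case: (z == wend _ _).
Qed.

Lemma disagree_degree S z : ~~ odd (\sum_(d <- alldirs) disagree S (dsep z d)).
Proof.
rewrite /alldirs !big_cons big_nil /disagree; case: z => a b /=.
by case: (S (a - 1, b)); case: (S (a, b)); case: (S (a, b - 1)); case: (S (a - 1, b - 1)).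
Qed.

Lemma trail_extend S u w : uniq (wbonds u w) -> all (disagree S) (wbonds u w) ->
  wend u w != u ->
  exists2 d, disagree S (dsep (wend u w) d) & dsep (wend u w) d \notin wbonds u w.
Proof.
move=> uw /allP dw wu; set z := wend u w.
have [/hasP[d _ /andP[]]|/hasPn no] :=
  boolP (has (fun d => disagree S (dsep z d) && (dsep z d \notin wbonds u w)) alldirs).
  by exists d.
have := trail_degree z u w; rewrite (negPf wu) eqxx /= => o.
have := disagree_degree S z.
suff -> : (\sum_(d <- alldirs) disagree S (dsep z d) =
          \sum_(d <- alldirs) count_mem (dsep z d) (wbonds u w))%N by rewrite o.
apply: eq_big_seq => d /no; rewrite (count_uniq_mem _ uw) negb_and negbK.
case: (boolP (_ \in _)) => [/dw -> //|_]; by rewrite orbF => /negPf ->.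
Qed.

Section ClosedTrail.
Variables (n m : nat).
Notation plus := (bc true).
Notation trail_in := (@trail_in n m plus).

Lemma disagree_bonds (s : rect n m) e : is_bond e -> disagree (ext plus s) e -> e \in bonds n m.
Proof.
move=> be; apply: contraLR => nb; rewrite /disagree negbK.
have := contra (mem_bonds be) nb; rewrite negb_or => /andP[n1 n2].
by rewrite !ext_out.
Qed.

Lemma closed_trail_exists (s : rect n m) u w : (0 < size w)%N ->
  uniq (wbonds u w) -> all (disagree (ext plus s)) (wbonds u w) ->
  exists w', [/\ (0 < size w')%N, wend u w' = u, uniq (wbonds u w') &
                 all (disagree (ext plus s)) (wbonds u w')].
Proof.
move: {2}(_ - _)%N (leqnn (size (bonds n m) - size w)) => k.
elim: k w => [|k IH] w kw w0 uw dw.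
all: have [wu|wu] := eqVneq (wend u w) u; first by exists w.
all: have [d dd dn] := trail_extend uw dw wu.
all: have E : wbonds u (rcons w d) = rcons (wbonds u w) (dsep (wend u w) d)
       by rewrite -!cats1 wbonds_cat.
all: have u' : uniq (wbonds u (rcons w d)) by rewrite E rcons_uniq dn.
all: have d' : all (disagree (ext plus s)) (wbonds u (rcons w d)) by rewrite E all_rcons dd.
all: have le : (size (rcons w d) <= size (bonds n m))%N.
1,3: rewrite -(size_wbonds u); apply: uniq_leq_size => // e eb.
1,2: apply: (disagree_bonds (s := s)); last exact: (allP d').
1,2: by elim: (rcons w d) (u) eb => //= c v IHv y; rewrite inE => /orP[/eqP ->|/IHv //]; exact: is_bond_dsep.
- by move: kw le; rewrite size_rcons; lia.
- by apply: (IH (rcons w d)) => //; move: kw; rewrite size_rcons; lia.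
Qed.

Lemma minus_disagree (s : rect n m) i : s i = false ->
  exists u d, disagree (ext plus s) (dsep u d).
Proof.
move=> si; apply: contrapT => no.
have all_minus (k : nat) : ext plus s ((pos i).1 - k%:Z, (pos i).2) = false.
  elim: k => [|k IH].
    have -> : ((pos i).1 - 0%:Z, (pos i).2) = pos i by rewrite subr0; case: pos.
    by rewrite ext_in.
  apply/negP => Sk; apply: no.
  exists ((pos i).1 - k%:Z, (pos i).2), DN; rewrite /disagree /= IH.
  have -> : (pos i).1 - k%:Z - 1 = (pos i).1 - k.+1%:Z by lia.
  by rewrite Sk.
have := all_minus i.1.+1; rewrite ext_out //.
by rewrite /inrect /pos /=; lia.
Qed.

(** Induction on the energy. A closed trail that does not enclose [i] is erased by flipping its
    inside: [i] stays minus and the energy drops. A trail found afterwards is valid for [s], since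
    the only bonds that changed are disagreements of [s]. *)
Lemma closed_trail_around (s : rect n m) i : s i = false ->
  exists u w, [/\ wend u w = u, uniq (wbonds u w), trail_in (wbonds u w) s &
                  parity (wbonds u w) (pos i)].
Proof.
move: {2}(bond_energy _ _ _).+1 (ltnSn (bond_energy n m (ext plus s))) => k.
elim: k s => [//|k IH] s sk si.
have [u [d ud]] := minus_disagree si.
have [w [w0 cl uw dw]] := @closed_trail_exists s u [:: d] isT isT (introT andP (conj ud isT)).
have tw : trail_in (wbonds u w) s.
  apply/allP => e ew; have de := allP dw e ew; rewrite de andbT.
  apply: (disagree_bonds (s := s)) de.
  by elim: (w) (u) ew => //= c v IHv y; rewrite inE => /orP[/eqP ->|/IHv //]; exact: is_bond_dsep.
have [pi|npi] := boolP (parity (wbonds u w) (pos i)); first by exists u, w.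
have box : all (in_window 0 n%:Z 0 m%:Z) (wverts u (w ++ [::])).
  by rewrite cats0; apply: wverts_window => // e /(allP tw) /andP[].
have cl' : wend u (w ++ [::]) = u by rewrite cats0.
have le := bond_energy_flip cl' box uw tw; set s' := flip_config _ _ _ in le.
have [||u' [w' [cl2 u2 t2 p2]]] := IH s'.
- by move: le; rewrite addn0; lia.
- by rewrite ffunE si cats0 (negPf npi).
exists u', w'; split => //; apply/allP => e ew.
have /andP[eb de] := allP t2 e ew; rewrite eb /=.
move: de; rewrite /s' (disagree_flip _ cl' box) ?(bonds_is_bond eb) // cats0 (count_uniq_mem _ uw) oddb.
have [/(allP tw) /andP[_ ->] //|_] := boolP (e \in wbonds u w).
by rewrite addbF.
Qed.

Definition minus_adj (s : rect n m) : rel ('I_n * 'I_m) :=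
  fun i j => [&& ~~ s i, ~~ s j & is_bond (pos i, pos j) || is_bond (pos j, pos i)].

Lemma parity_cluster (s : rect n m) u w i j : wend u w = u ->
  trail_in (wbonds u w) s -> connect (minus_adj s) i j ->
  parity (wbonds u w) (pos i) -> parity (wbonds u w) (pos j).
Proof.
move=> cl tw /connectP[p + ->]; elim: p i => [//|k p IH] i /= /andP[/and3P[si sk bd] kp] pi.
apply: IH kp _.
have no e : is_bond e -> disagree (ext plus s) e = false -> parity (wbonds u w) e.1 = parity (wbonds u w) e.2.
  move=> be de; have := parity_bond cl be.
  have -> : count_mem e (wbonds u w) = 0%N.
    apply/count_memPn; apply/negP => /(allP tw); by rewrite de andbF.
  by case: parity; case: parity.
case/orP: bd => bd; have := no _ bd; rewrite /disagree /= !ext_in (negPf si) (negPf sk) eqxx => /(_ erefl).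
all: by rewrite ?pi // => <-.
Qed.

End ClosedTrail.

(** * Size of minus clusters *)

Lemma poly4_geometric_bound (R : realType) (q : R) : 0 < q -> q < 1 ->
  exists2 C : R, 0 < C & forall K, \sum_(0 <= l < K) (2 * l)%:R ^+ 4 * q ^+ l <= C.
Proof.
(* A fifth root of [q]: four factors absorb the power l^4 and the fifth leaves a geometric
   series. *)
move=> q0 q1; pose s := expR (ln q / 5).
have s0 : 0 < s by exact: expR_gt0.
have s1 : s < 1 by rewrite expR_lt1 pmulr_llt0 ?ln_lt0 ?q0 // invr_gt0.
have s5 : s ^+ 5 = q by rewrite /s -expRM_natl mulrCA divff ?mulr1 ?lnK // pnatr_eq0.
have d0 : 0 < 1 - s by rewrite subr_gt0.
have geo K : \sum_(0 <= l < K) s ^+ l <= (1 - s)^-1.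
  rewrite -(ler_pM2l d0) divff ?gt_eqF //.
  have -> : (1 - s) * \sum_(0 <= l < K) s ^+ l = 1 - s ^+ K.
    elim: K => [|K IH]; first by rewrite big_geq // mulr0 subrr.
    by rewrite big_nat_recr //= mulrDr IH exprS; ring.
  by rewrite gerBl exprn_ge0 // ltW.
have lin (l : nat) : l%:R * s ^+ l <= (1 - s)^-1.
  apply: le_trans (geo l).
  have -> : l%:R * s ^+ l = \sum_(0 <= k < l) s ^+ l by rewrite sumr_const_nat subn0 mulr_natl.
  rewrite !big_nat; apply: ler_sum => k /andP[_ kl].
  by apply: ler_wiXn2l; rewrite ?(ltW s0) ?(ltW s1) // ltnW.
pose D := (1 - s)^-1; have D0 : 0 < D by rewrite invr_gt0.
exists (16 * D ^+ 4 * D); first by rewrite !mulr_gt0 ?exprn_gt0.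
move=> K; apply: le_trans (_ : \sum_(0 <= l < K) 16 * D ^+ 4 * s ^+ l <= _); last first.
  by rewrite -big_distrr /= ler_pM2l ?geo // mulr_gt0 ?exprn_gt0.
apply: ler_sum => l _.
have -> : (2 * l)%:R ^+ 4 * q ^+ l = 16 * (l%:R * s ^+ l) ^+ 4 * s ^+ l.
  rewrite -s5 -exprM (mulnC 5) exprM natrM; set y := s ^+ l; ring.
rewrite ler_wpM2r ?exprn_ge0 ?(ltW s0) // ler_pM2l //.
by rewrite lerXn2r // nnegrE ?(ltW D0) // mulr_ge0 ?ler0n // exprn_ge0 // ltW.
Qed.

Section ClusterSize.
Variables (R : realType) (x : R) (n m : nat).
Hypotheses (x0 : 0 < x) (x1 : x < 1).
Notation plus := (bc true).
Notation trail_in := (@trail_in n m plus).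
Notation Z := (@Zf R x n m).
Implicit Types (s : rect n m) (i j : 'I_n * 'I_m).

Definition cluster s i : {set 'I_n * 'I_m} :=
  [set j | ~~ s i && connect (minus_adj s) i j].

Definition dirs (l : nat) (w : l.-tuple 'I_4) : seq dir :=
  [seq nat_to_dir (nat_of_ord k) | k <- w].

Lemma dirs_surj w : exists w' : (size w).-tuple 'I_4, dirs w' = w.
Proof.
exists (map_tuple (fun d => inord (dir_to_nat d)) (in_tuple w)).
rewrite /dirs /= -map_comp -[RHS]map_id; apply: eq_map => d /=.
by rewrite inordK ?dir_natK //; case: d.
Qed.

Definition base (i : 'I_n * 'I_m) l (a b : 'I_(2 * l)) : dvertex :=
  ((pos i).1 - l%:Z + 1 + (nat_of_ord a)%:Z, (pos i).2 - l%:Z + 1 + (nat_of_ord b)%:Z).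

Definition closed_trail u w s : bool :=
  [&& wend u w == u, uniq (wbonds u w) & trail_in (wbonds u w) s].

Lemma window_card (u : dvertex) (l : nat) (A : {set 'I_n * 'I_m}) :
  (forall j, j \in A -> (u.1 - l%:Z <= (pos j).1 < u.1 + l%:Z) && (u.2 - l%:Z <= (pos j).2 < u.2 + l%:Z)) ->
  (#|A| <= (2 * l) ^ 2)%N.
Proof.
move=> AW; case: l AW => [|l] AW.
  rewrite leqn0 cards_eq0; apply/eqP/setP => j; rewrite inE; apply/negP => /AW.
  by move=> /andP[/andP[h1 h2] _]; have := le_lt_trans h1 h2; rewrite ltrD2l.
pose g (v : site) : 'I_(2 * l).+2 * 'I_(2 * l).+2 :=
  (inord (absz (v.1 - u.1 + l.+1%:Z)), inord (absz (v.2 - u.2 + l.+1%:Z))).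
have fi : {in A &, injective (fun j => g (pos j))}.
  move=> j k /AW jA /AW kA jk; apply: pos_inj.
  move: jA kA jk; case: (pos j) (pos k) => [a b] [c d]; rewrite /g /= => jA kA.
  move=> [] /(congr1 (@nat_of_ord _)) h1 /(congr1 (@nat_of_ord _)) h2.
  rewrite !inordK in h1; [|lia|lia].
  by rewrite !inordK in h2; [congr pair; lia|lia|lia].
rewrite -(card_in_imset fi); apply: leq_trans (max_card _) _.
by rewrite card_prod card_ord; lia.
Qed.

(** A closed trail around the cluster, if its length is l, starts at one of the (2 l)^2 vertices
    [base i a b] and encloses at most (2 l)^2 sites. The sum over all trails overcounts, but its
    expectation splits into Peierls terms. *)
Lemma cluster_card_le s i :
  (#|cluster s i| <= \sum_(0 <= l < (size (bonds n m)).+1)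
     \sum_(a < 2 * l) \sum_(b < 2 * l) \sum_(w : l.-tuple 'I_4)
     if closed_trail (base i a b) (dirs w) s then (2 * l) ^ 2 else 0)%N.
Proof.
have [si|/negbTE si] := boolP (s i).
  have -> : cluster s i = finset.set0 by apply/setP => j; rewrite !inE si.
  by rewrite cards0.
have [u [w [cl uw tw pi]]] := closed_trail_around si.
have W := parity_window cl (wverts_ball u w).
have lt : (size w < (size (bonds n m)).+1)%N.
  rewrite ltnS -(size_wbonds u); apply: uniq_leq_size => // e /(allP tw) /andP[] //.
have cA : (#|cluster s i| <= (2 * size w) ^ 2)%N.
  apply: (@window_card u) => j; rewrite inE si andTb => ij; apply: (W (pos j)).
  exact: parity_cluster cl tw ij pi.
have [w' E] := dirs_surj w.
have iw := W _ pi.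
have num (p q l : int) : p - l <= q < p + l -> (absz (p + l - 1 - q)%R < 2 * absz l)%N.
  by lia.
have /andP[iw1 iw2] := iw.
have ha := num _ _ _ iw1; have hb := num _ _ _ iw2; rewrite !absz_nat in ha hb.
rewrite big_mkord (bigD1 (Ordinal lt)) //= (bigD1 (Ordinal ha)) //= (bigD1 (Ordinal hb)) //= (bigD1 w') //=.
have -> : base i (Ordinal ha) (Ordinal hb) = u.
  by rewrite /base /=; case: (u) iw => a b /= iw; congr pair; lia.
rewrite E /closed_trail cl eqxx uw tw /=.
by apply: leq_trans cA _; rewrite -!addnA leq_addr.
Qed.

Lemma closed_trail_weight u w : \sum_(s | closed_trail u w s) wgt x plus 0 s <= x ^+ size w * Z plus 0 predT.
Proof.
have nn : 0 <= x ^+ size w * Z plus 0 predT by rewrite mulr_ge0 ?exprn_ge0 ?Zf_ge0 // ltW.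
have [/existsP[s /and3P[/eqP cl uw tw]]|/existsPn no] := boolP [exists s, closed_trail u w s]; last first.
  by rewrite big1 // => s sc; have := no s; rewrite sc.
case: (posnP (size w)) => [w0|w0].
  rewrite w0 expr0 mul1r /Zf [leLHS]big_mkcond /=; apply: ler_sum => t _.
  by case: ifP => _ //; exact: ltW (wgt_gt0 x0 _ _ _).
have cl' : wend u (w ++ [::]) = u by rewrite cats0.
have box : all (in_window 0 n%:Z 0 m%:Z) (wverts u (w ++ [::])).
  by rewrite cats0; apply: wverts_window => // e /(allP tw) /andP[].
have := peierls plus x0 x1 cl' box uw; rewrite expr0 mul1r; apply: le_trans.
rewrite [leLHS]big_mkcond [leRHS]big_mkcond; apply: ler_sum => t _.
rewrite /closed_trail; case: (trail_in _ t); first by case: ifP => // _; exact: ltW (wgt_gt0 x0 _ _ _).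
by rewrite !andbF.
Qed.

Lemma cluster_size_le i :
  \sum_s wgt x plus 0 s * #|cluster s i|%:R <=
  (\sum_(0 <= l < (size (bonds n m)).+1) (2 * l)%:R ^+ 4 * (4 * x) ^+ l) * Z plus 0 predT.
Proof.
apply: le_trans (_ : \sum_s wgt x plus 0 s * (\sum_(0 <= l < (size (bonds n m)).+1)
     \sum_(a < 2 * l) \sum_(b < 2 * l) \sum_(w : l.-tuple 'I_4)
     if closed_trail (base i a b) (dirs w) s then (2 * l) ^ 2 else 0)%:R <= _).
  apply: ler_sum => s _; rewrite ler_pM2l ?wgt_gt0 // ler_nat; exact: cluster_card_le.
under eq_bigr do rewrite natr_sum big_distrr /=.
rewrite exchange_big /= big_distrl /=; apply: ler_sum => l _.
under eq_bigr do rewrite natr_sum big_distrr /=.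
rewrite exchange_big /=.
apply: le_trans (_ : \sum_(a < 2 * l) \sum_(b < 2 * l) \sum_(w : l.-tuple 'I_4) (2 * l)%:R ^+ 2 * (x ^+ l * Z plus 0 predT) <= _); last first.
  have sc (T : finType) (c : R) : \sum_(t : T) c = c * #|T|%:R by rewrite sumr_const mulr_natr.
  rewrite !sc card_tuple !card_ord natrX exprMn le_eqVlt; apply/orP; left; apply/eqP.
  set p := _ ^+ l; set q := _ ^+ l; ring.
apply: ler_sum => a _.
under eq_bigr do rewrite natr_sum big_distrr /=.
rewrite exchange_big /=; apply: ler_sum => b _.
under eq_bigr do rewrite natr_sum big_distrr /=.
rewrite exchange_big /=; apply: ler_sum => w _.
have := closed_trail_weight (base i a b) (dirs w); rewrite size_map size_tuple => H.
have p2 : 0 <= (2 * l)%:R ^+ 2 :> R by rewrite exprn_ge0 // ler0n.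
apply: le_trans (ler_wpM2l p2 H); rewrite big_distrr /= [leRHS]big_mkcond /=.
apply: ler_sum => s _; case: ifP => _; last by rewrite mulr0.
by rewrite natrX mulrC.
Qed.

End ClusterSize.

(** * Pinning sites to plus *)

Section PinnedPlus.
Variables (R : realType) (x : R) (n m : nat).
Hypotheses (x0 : 0 < x) (x1 : x < 1).
Notation plus := (bc true).
Notation Z := (@Zf R x n m).
Implicit Types (s t r : rect n m) (i j : 'I_n * 'I_m) (A K : {set 'I_n * 'I_m}).

Definition plus_on A t : bool := [forall i in A, t i].
Definition hull A s : {set 'I_n * 'I_m} := \bigcup_(i in A) cluster s i.
Definition lower K r : rect n m := [ffun i => r i && (i \notin K)].
Definition raise K r : rect n m := [ffun i => r i || (i \in K)].

Lemma hullP A s j :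
  reflect (exists i, [/\ i \in A, s i = false & connect (minus_adj s) i j]) (j \in hull A s).
Proof.
apply: (iffP bigcupP) => [[i iA]|[i [iA si ij]]].
  by rewrite inE => /andP[/negPf si ij]; exists i.
by exists i => //; rewrite inE si.
Qed.

Lemma connect_minus s i j : s i = false -> connect (minus_adj s) i j -> s j = false.
Proof.
move=> si /connectP[p + ->]; elim: p i si => [//|k p IH] i si /= /andP[/and3P[_ /negPf sk _] kp].
exact: IH kp.
Qed.

Lemma hull_minus A s j : j \in hull A s -> s j = false.
Proof. by case/hullP => i [_ si ij]; exact: connect_minus ij. Qed.

Lemma hull_step A s j k : j \in hull A s -> s k = false ->
  is_bond (pos j, pos k) || is_bond (pos k, pos j) -> k \in hull A s.
Proof.
move=> jh sk jk; have sj := hull_minus jh.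
case/hullP: jh => i [iA si ij]; apply/hullP; exists i; split => //.
by apply: connect_trans ij (connect1 _); rewrite /minus_adj sj sk jk.
Qed.

Lemma hull_mono A s t : (forall i, s i -> t i) -> (forall i, i \in hull A s -> t i = false) ->
  hull A t = hull A s.
Proof.
move=> st ht; apply/setP => j; apply/idP/idP.
  case/hullP => i [iA ti ij]; apply/hullP; exists i; split => //.
    by apply: contraFF ti; exact: st.
  apply: connect_sub ij => k l /and3P[tk tl kl]; apply: connect1.
  by rewrite /minus_adj kl andbT; apply/andP; split; [move: tk|move: tl]; apply: contra; exact: st.
case/hullP => i [iA si /connectP[p ip ->]].
have ih : i \in hull A s by apply/hullP; exists i.
apply/hullP; exists i; split; rewrite ?ht //.
elim: p i ih ip {iA si} => [|k p IH] i ih /=; first by rewrite connect0.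
move=> /andP[/and3P[si /negPf sk ik] kp].
have kh := hull_step ih sk ik.
by apply: connect_trans (IH k kh kp); apply: connect1; rewrite /minus_adj !ht.
Qed.

Lemma raiseK A s : lower (hull A s) (raise (hull A s) s) = s.
Proof.
apply/ffunP => i; rewrite !ffunE.
case ih : (i \in hull A s); first by rewrite andbF (hull_minus ih).
by rewrite orbF andbT.
Qed.

Definition inset K (v : site) : bool := ext (fun _ => false) [ffun i => i \in K] v.

Lemma ext_lower K r v : ext plus (lower K r) v = ext plus r v && ~~ inset K v.
Proof. by rewrite /inset /ext; case: pickP => // i _; rewrite !ffunE. Qed.

(** The image under [raise K] of the configurations with hull [K]. Unlike the original event it is
    stable under joins ([hull_of_join]), as the four functions theorem requires. *)
Definition hull_of A K r : bool := plus_on K r && (hull A (lower K r) == K).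

Lemma hull_edge A K r e : hull_of A K r -> is_bond e ->
  [/\ inset K e.1 -> ext plus r e.1, inset K e.2 -> ext plus r e.2,
      inset K e.1 -> ~~ inset K e.2 -> ext plus r e.2 &
      inset K e.2 -> ~~ inset K e.1 -> ext plus r e.1].
Proof.
move=> /andP[/'forall_implyP rK /eqP hK] be.
have I v : inset K v -> exists2 i, pos i = v & i \in K.
  rewrite /inset; have [/inrectP[i <-]|nv] := boolP (inrect n m v); last by rewrite ext_out.
  by rewrite ext_in ffunE => iK; exists i.
have P v : inset K v -> ext plus r v.
  by case/I => i <- iK; rewrite ext_in; exact: rK.
have N v w : is_bond (v, w) || is_bond (w, v) -> inset K v -> ~~ inset K w -> ext plus r w.
  move=> vw /I[i vi iK] nw.
  have [/inrectP[k kw]|now] := boolP (inrect n m w); last by rewrite ext_out.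
  rewrite -kw ext_in; apply: contraNT nw => rk.
  have kK : k \in K.
    rewrite -hK; apply: (@hull_step A _ i); rewrite ?hK // ?vi ?kw //.
    by rewrite ffunE (negPf rk).
  by rewrite -kw /inset ext_in ffunE.
case: e be => v w be /=; split; [exact: P|exact: P|apply: N|apply: N]; by rewrite be ?orbT.
Qed.

(** Away from [K] this is submodularity. On bonds touching [K] there is equality: [r] is plus at
    both ends, by [hull_edge], so the meet is [t], while the lowered terms coincide. *)
Lemma bond_energy_lower A K r t : hull_of A K r ->
  (bond_energy n m (ext plus (conf_meet r t)) + bond_energy n m (ext plus (lower K (conf_join r t)))
   <= bond_energy n m (ext plus (lower K r)) + bond_energy n m (ext plus t))%N.
Proof.
move=> hr; rewrite /bond_energy -!sum1_count !(big_mkcond (disagree _)) -!big_split /=.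
rewrite big_seq [leqRHS]big_seq; apply: leq_sum => e /bonds_is_bond be.
have [h1 h2 h3 h4] := hull_edge hr be.
have A1 v : ext plus (conf_meet r t) v = ext plus r v && ext plus t v by rewrite -ext_meet.
have A2 v : ext plus (conf_join r t) v = ext plus r v || ext plus t v by rewrite -ext_join.
rewrite /disagree !ext_lower !A1 !A2; move: h1 h2 h3 h4.
case: (inset K e.1); case: (inset K e.2); case: (ext plus r e.1); case: (ext plus r e.2) => h1 h2 h3 h4;
  rewrite ?(h1 isT) ?(h2 isT) ?(h3 isT isT) ?(h4 isT isT);
  case: (ext plus t e.1); case: (ext plus t e.2) => //;
  by [have := h1 isT|have := h2 isT|have := h3 isT isT|have := h4 isT isT].
Qed.

Lemma plus_on_meet A K r t : hull_of A K r -> plus_on A t -> plus_on A (conf_meet r t).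
Proof.
move=> /andP[/'forall_implyP rK /eqP hK] /'forall_implyP tA; apply/'forall_implyP => i iA.
rewrite ffunE tA // andbT; apply: contraT => /negPf ri.
suff : i \in K by move=> /rK; rewrite ri.
by rewrite -hK; apply/hullP; exists i; split => //; rewrite ffunE ri.
Qed.

Lemma hull_of_join A K r t : hull_of A K r -> hull_of A K (conf_join r t).
Proof.
move=> /andP[/'forall_implyP rK /eqP hK]; apply/andP; split.
  by apply/'forall_implyP => i iK; rewrite ffunE rK.
rewrite (@hull_mono A (lower K r)) ?hK // => i.
  by rewrite !ffunE => /andP[-> ->].
by rewrite !ffunE => ->; rewrite andbF.
Qed.

Lemma mag_raise A s : mag R (raise (hull A s) s) = mag R s + 2 * #|hull A s|%:R.
Proof.
rewrite /mag -sum1_card natr_sum big_distrr /= [X in _ + X]big_mkcond -big_split /=.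
apply: eq_bigr => i _; rewrite ffunE; case ih : (i \in hull A s).
  by rewrite (hull_minus ih) /=; ring.
by rewrite orbF addr0.
Qed.

(** The four functions theorem is applied to raised configurations, with the field weight of [r]
    itself; as raising adds 2 |K| to the magnetization, the exponential factor appears. *)
Lemma Zf_hull A K (lam : R) : 0 <= lam ->
  Z plus 0 (fun s => hull A s == K) * Z plus lam (plus_on A) <=
  Z plus 0 (plus_on A) * (expR (2 * lam * #|K|%:R) * Z plus lam (fun s => hull A s == K)).
Proof.
move=> l0.
have re (f : rect n m -> rect n m -> R) : \sum_(s | hull A s == K) f s (raise K s) =
    \sum_r (if hull_of A K r then f (lower K r) r else 0).
  rewrite -big_mkcond /= (reindex_onto (lower K) (raise K)) /=; last first.
    by move=> s /eqP <-; exact: raiseK.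
  have E r : (raise K (lower K r) == r) = plus_on K r.
    apply/eqP/'forall_implyP => [<- i iK|rK]; first by rewrite !ffunE iK orbT.
    by apply/ffunP => i; rewrite !ffunE; case: (boolP (i \in K)) => [/rK ->|]; rewrite ?andbT ?orbF ?orbT.
  apply: eq_big => [r|r]; first by rewrite E andbC.
  by rewrite E => /andP[_ rK]; rewrite -E in rK; rewrite (eqP rK).
have -> : expR (2 * lam * #|K|%:R) * Z plus lam (fun s => hull A s == K) =
    \sum_r (if hull_of A K r then wgt x plus 0 (lower K r) * expR (lam * mag R r) else 0).
  rewrite -(re (fun s r => wgt x plus 0 s * expR (lam * mag R r))).
  rewrite /Zf big_distrr /=; apply: eq_bigr => s /eqP hs.
  rewrite -hs mag_raise /wgt mul0r expR0 mulr1 mulrDr expRD (mulrCA lam) (mulrA 2).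
  by ring.
rewrite {1}/Zf (re (fun s _ => wgt x plus 0 s)) {1}/Zf big_mkcond {1}/Zf [X in _ <= X * _]big_mkcond /=.
have wp l s : 0 <= wgt x plus l s by exact: ltW (wgt_gt0 x0 _ _ _).
rewrite [X in _ * X <= _]big_mkcond /=.
apply: four_functions => [s|s|s|s|r t].
- by case: ifP.
- by case: ifP.
- by case: ifP.
- by case: ifP => // _; rewrite mulr_ge0 // expR_ge0.
case hr : (hull_of A K r); last by rewrite mul0r mulr_ge0 //; case: ifP => // _; rewrite mulr_ge0 // expR_ge0.
case ht : (plus_on A t); last by rewrite mulr0 mulr_ge0 //; case: ifP => // _; rewrite mulr_ge0 // expR_ge0.
rewrite (plus_on_meet hr ht) (hull_of_join t hr) /wgt !mul0r expR0 !mulr1 !mulrA -!exprD.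
apply: ler_pM; rewrite ?exprn_ge0 ?expR_ge0 ?(ltW x0) //.
  by apply: ler_wiXn2l; rewrite ?(ltW x0) ?(ltW x1) //; exact: bond_energy_lower hr.
rewrite ler_expR ler_wpM2l //; apply: ler_sum => i _; rewrite ffunE.
by case: (r i); case: (t i) => //=; lra.
Qed.

(* Condition on the minus clusters of A: raising them to plus and using
   Jensen's inequality for their size *)
Lemma pinned_plus (lam kappa : R) A : 0 <= lam ->
  (forall i, \sum_s wgt x plus 0 s * #|cluster s i|%:R <= kappa * Z plus 0 predT) ->
  Z plus lam (plus_on A) * Z plus 0 predT <=
  expR (2 * lam * kappa * #|A|%:R) * (Z plus 0 (plus_on A) * Z plus lam predT).
Proof.
move=> l0 kap; set M := 2 * lam * kappa * _.
have Zp := @Zbc_gt0 R x x0 n m true 0.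
have part l : Z plus l predT = \sum_K Z plus l (fun s => hull A s == K).
  by rewrite /Zf (partition_big (hull A) xpredT).
have hE : \sum_s wgt x plus 0 s * #|hull A s|%:R <= kappa * #|A|%:R * Z plus 0 predT.
  apply: le_trans (_ : \sum_s \sum_(i in A) wgt x plus 0 s * #|cluster s i|%:R <= _).
    apply: ler_sum => s _; rewrite -big_distrr ler_pM2l ?wgt_gt0 // -natr_sum ler_nat.
    rewrite /hull; elim/big_rec2: _ => [|i k B _ IH]; first by rewrite cards0.
    by apply: leq_trans (leq_card_setU _ _).1 _; rewrite leq_add2l.
  rewrite exchange_big /=; apply: le_trans (ler_sum _ (fun i _ => kap i)) _.
  by rewrite sumr_const -[X in X <= _]mulr_natl le_eqVlt; apply/orP; left; apply/eqP; ring.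
have J : expR (- M) * Z plus 0 predT <= \sum_s wgt x plus 0 s * expR (- (2 * lam * #|hull A s|%:R)).
  (* Jensen in tangent form: [expR] is bounded below by its tangent at [- M], and [M] is at least
     the mean of 2 lam |hull|. *)
  apply: le_trans (_ : \sum_s expR (- M) * (wgt x plus 0 s * (1 + (M - 2 * lam * #|hull A s|%:R))) <= _).
    rewrite -big_distrr ler_pM2l ?expR_gt0 //=.
    have -> : \sum_s wgt x plus 0 s * (1 + (M - 2 * lam * #|hull A s|%:R)) =
       (1 + M) * Z plus 0 predT - 2 * lam * \sum_s wgt x plus 0 s * #|hull A s|%:R.
      by rewrite /Zf !big_distrr -sumrB /=; apply: eq_bigr => s _; ring.
    have := ler_wpM2l (_ : 0 <= 2 * lam) hE; rewrite mulr_ge0 // => /(_ isT).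
    by rewrite /M; lra.
  apply: ler_sum => s _; rewrite mulrCA ler_pM2l ?wgt_gt0 //.
  rewrite [in leRHS](_ : - (2 * lam * #|hull A s|%:R) = - M + (M - 2 * lam * #|hull A s|%:R)); last by ring.
  by rewrite expRD ler_pM2l ?expR_gt0 // expR_ge1Dx.
rewrite -(ler_pM2l (expR_gt0 (- M))) [leRHS]mulrA -expRD addNr expR0 mul1r.
rewrite mulrCA; apply: le_trans (ler_wpM2l (Zf_ge0 x0 _ _ _) J) _.
have -> : \sum_s wgt x plus 0 s * expR (- (2 * lam * #|hull A s|%:R)) =
    \sum_(K : {set 'I_n * 'I_m}) expR (- (2 * lam * #|K|%:R)) * Z plus 0 (fun s => hull A s == K).
  rewrite (partition_big (hull A) xpredT) //=; apply: eq_bigr => K _.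
  by rewrite /Zf big_distrr /=; apply: eq_bigr => s /eqP ->; rewrite mulrC.
rewrite (part lam) !big_distrr /=; apply: ler_sum => K _.
have := ler_wpM2l (ltW (expR_gt0 (- (2 * lam * #|K|%:R)))) (Zf_hull A K l0).
rewrite [X in _ <= X -> _]mulrCA (mulrA (expR _) (expR _)) -expRD addNr expR0 mul1r.
by rewrite mulrA (mulrC (Z plus lam _)).
Qed.

End PinnedPlus.

(** * Locality of the interface *)

Lemma in_box_inrect N v : in_box N v = inrect N.+1 N.+1 v.
Proof. by rewrite /in_box /inrect; lia. Qed.

Lemma spin_ext N (s : config N) v : spin s v = ext (bc false) s v.
Proof.
rewrite /spin in_box_inrect; case: ifP => [/inrectP[[i j] <-]|nv]; last by rewrite ext_out ?nv.
rewrite ext_in /pos /=; congr (s (_, _)); apply: val_inj; rewrite /= inordK //; exact: ltn_ord.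
Qed.

Lemma energyE N (s : config N) : energy s = bond_energy N.+1 N.+1 (ext (bc false) s).
Proof.
set S := ext (bc false) s.
pose L (k l : nat) : bool := S (k%:Z - 1, l%:Z) != S (k%:Z, l%:Z).
pose U (k l : nat) : bool := S (k%:Z, l%:Z - 1) != S (k%:Z, l%:Z).
(* Each site is charged with its right and upper bond, and with its left or lower bond only when it
   lies on that side of the box. *)
have loc (i j : 'I_N.+1) : local_energy s (site_of (i, j)) =
   ((((i == 0%N :> nat) && L 0%N j) + L i.+1 j) + (((j == 0%N :> nat) && U i 0%N) + U i j.+1))%N.
  rewrite /local_energy /site_of /right_of /up_of !spin_ext -/S /=.
  have out v : ~~ in_box N v -> dobrushin v = S v by move=> vo; rewrite /S ext_out // -in_box_inrect.
  have bx (k l : int) : in_box N (k, l) = (0 <= k <= N%:Z) && (0 <= l <= N%:Z) by [].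
  have hi := ltn_ord i; have hj := ltn_ord j.
  have e3 : in_box N (i%:Z - 1, j%:Z) = (0 < i)%N by rewrite bx; lia.
  have e4 : in_box N (i%:Z, j%:Z - 1) = (0 < j)%N by rewrite bx; lia.
  have E v (c : bool) : (in_box N v && (c != S v) + (~~ in_box N v && (c != dobrushin v)) = (c != S v))%N.
    by case: (boolP (in_box N v)) => vo /=; rewrite ?addn0 // out.
  have := E (i%:Z + 1, j%:Z) (S (i%:Z, j%:Z)); have := E (i%:Z, j%:Z + 1) (S (i%:Z, j%:Z)).
  have h3 : ~~ in_box N (i%:Z - 1, j%:Z) && (S (i%:Z, j%:Z) != dobrushin (i%:Z - 1, j%:Z)) =
     (i == 0%N :> nat) && L 0%N j.
    rewrite e3 -eqn0Ngt; case: eqP => //= i0.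
    by rewrite out ?e3 ?i0 // /L eq_sym.
  have h4 : ~~ in_box N (i%:Z, j%:Z - 1) && (S (i%:Z, j%:Z) != dobrushin (i%:Z, j%:Z - 1)) =
     (j == 0%N :> nat) && U i 0%N.
    rewrite e4 -eqn0Ngt; case: eqP => //= j0.
    by rewrite out ?e4 ?j0 // /U eq_sym.
  have sc (k : nat) : k.+1%:Z = k%:Z + 1 by rewrite -addn1.
  have -> : L i.+1 j = (S (i%:Z, j%:Z) != S (i%:Z + 1, j%:Z)).
    by rewrite /L sc addrK.
  have -> : U i j.+1 = (S (i%:Z, j%:Z) != S (i%:Z, j%:Z + 1)).
    by rewrite /U sc addrK.
  by rewrite h3 h4 => /= <- <-; rewrite addn0; ring.
rewrite /energy -(pair_bigA _ (fun i j => local_energy s (site_of (i, j)))) /=.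
under eq_bigr do under eq_bigr do rewrite loc.
under eq_bigr do rewrite !big_split /=.
rewrite !big_split /= bond_energyE; congr (_ + _)%N.
  rewrite [RHS](@big_nat_recl _ _ _ N.+1 0) //; congr (_ + _)%N; last first.
    by rewrite big_mkord; apply: eq_bigr => i _; rewrite big_mkord.
  by rewrite [RHS]big_mkord [LHS]big_ord_recl /= [X in (_ + X)%N]big1 ?addn0 // => i _; rewrite big1.
transitivity (\sum_(i < N.+1) (U i 0%N + \sum_(j < N.+1) U i j.+1))%N.
  rewrite -big_split /=; apply: eq_bigr => i _; congr (_ + _)%N.
  by rewrite big_ord_recl /= [X in (_ + X)%N]big1 ?addn0.
by rewrite big_mkord; apply: eq_bigr => i _; rewrite big_nat_recl // big_mkord.
Qed.

Lemma gibbs_weightE (R : realType) (beta lam : R) N (s : config N) :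
  gibbs_weight beta lam s = wgt (expR (- (2 * beta))) (bc false) lam s.
Proof.
rewrite /gibbs_weight /wgt -expRM_natl -expRD energyE /magnetization /mag.
by congr expR; ring.
Qed.

Section Interface.
Variables (N : nat).
Implicit Types (s : config N) (u z : dvertex) (d : dir).
Notation ebonds := (bonds N.+1 N.+1).

Lemma dedge_bond s u d : dedge_in s u d ->
  (dsep u d \in ebonds) && disagree (ext (bc false) s) (dsep u d).
Proof.
have := is_bond_dsep u d; rewrite /dedge_in; case: (dsep u d) => [p q] be.
rewrite !in_box_inrect !spin_ext => /andP[io pq].
by rewrite (mem_bonds be io).
Qed.

Definition touch z (i : 'I_N.+1 * 'I_N.+1) : bool :=
  ((z.1 - 1 == (pos i).1) || (z.1 == (pos i).1)) && ((z.2 - 1 == (pos i).2) || (z.2 == (pos i).2)).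

Lemma dedge_local s s' u d : (forall i, touch u i -> s i = s' i) -> dedge_in s u d = dedge_in s' u d.
Proof.
move=> ss; case: u ss => a b ss.
have S k l : ((a - 1 == k) || (a == k)) && ((b - 1 == l) || (b == l)) -> spin s (k, l) = spin s' (k, l).
  rewrite !spin_ext => kl; have [/inrectP[i E]|nv] := boolP (inrect N.+1 N.+1 (k, l)); last by rewrite !ext_out.
  by rewrite -E !ext_in ss // /touch E.
by case: d; rewrite /dedge_in /= !S // !eqxx ?orbT.
Qed.

Definition visited_sites s : {set 'I_N.+1 * 'I_N.+1} :=
  [set i | has (touch^~ i) (interface s)].

Lemma next_dir_local s s' u d : (forall i, touch u i -> s i = s' i) -> next_dir s u d = next_dir s' u d.
Proof.
move=> ss; have E := fun c => dedge_local c ss.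
by rewrite /next_dir /ddegree /= !E.
Qed.

Lemma walk_local s s' f u d :
  (forall z i, z \in u :: walk s f u d -> touch z i -> s i = s' i) ->
  walk s f u d = walk s' f u d.
Proof.
elim: f u d => [//|f IH] u d /= ss; case: ifP => // ut; rewrite ut in ss.
have E : next_dir s u d = next_dir s' u d.
  by apply: next_dir_local => i; apply: ss; rewrite inE eqxx.
rewrite E in ss *.
case: (next_dir s' u d) ss => [e|//] ss; congr cons; apply: IH => z i zi.
by apply: ss; rewrite inE zi orbT.
Qed.

(** The interface is an exploration: each step reads only the spins touching the current dual
    vertex, so both walks take the same decisions. *)
Lemma interface_local s s' : (forall i, i \in visited_sites s -> s i = s' i) -> interface s' = interface s.
Proof.
move=> ss; have T z i : z \in interface s -> touch z i -> s i = s' i.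
  by move=> zi ti; apply: ss; rewrite inE; apply/hasP; exists z.
have t0 i : touch dstart i -> s i = s' i.
  by apply: T; rewrite /interface; case: ohead => [?|]; rewrite inE eqxx.
move: T; rewrite /interface.
have -> : [seq d <- alldirs | dedge_in s' dstart d] = [seq d <- alldirs | dedge_in s dstart d].
  by apply: eq_filter => d; rewrite (dedge_local d t0).
case: ohead => [d|//] T; congr [:: _, _ & _].
rewrite [RHS](@walk_local s s') // => z i zi; apply: T.
by rewrite inE zi orbT.
Qed.

Lemma touch_card z : (#|[set i | touch z i]| <= 4)%N.
Proof.
pose f (i : 'I_N.+1 * 'I_N.+1) : bool * bool := (z.1 == (pos i).1, z.2 == (pos i).2).
have fi : {in [set i | touch z i] &, injective f}.
  have E (k a b : int) : (k - 1 == a) || (k == a) -> (k - 1 == b) || (k == b) ->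
      (k == a) = (k == b) -> a = b.
    by case/orP => /eqP ha; case/orP => /eqP hb; lia.
  move=> i j; rewrite !inE /touch /f => /andP[i1 i2] /andP[j1 j2] [] h1 h2; apply: pos_inj.
  by rewrite [LHS]surjective_pairing [RHS]surjective_pairing (E _ _ _ i1 j1 h1) (E _ _ _ i2 j2 h2).
by rewrite -(card_in_imset fi) (leq_trans (max_card _)) // card_prod card_bool.
Qed.

Lemma visited_card s : (#|visited_sites s| <= 4 * size (interface s))%N.
Proof.
rewrite /visited_sites; elim: (interface s) => [|z p IH] /=.
  by rewrite muln0 leqn0 cards_eq0; apply/eqP/setP => i; rewrite !inE.
have -> : [set i | touch z i || has (touch^~ i) p] = [set i | touch z i] :|: [set i | has (touch^~ i) p].
  by apply/setP => i; rewrite !inE.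
by rewrite mulnS; apply: leq_trans (leq_card_setU _ _).1 _; rewrite leq_add ?touch_card.
Qed.

End Interface.

(** * The interface is a trail *)

(** If position i < j held the same entry as position j, going back i steps would already reach [x],
    and the remaining j - i steps would have to lead from [x] to [x], although [x] has no
    predecessor. *)
Lemma uniq_backtrack (T : eqType) (prev : T -> option T) x p :
  prev x = None -> path (fun a b => prev b == Some a) x p -> uniq (x :: p).
Proof.
move=> px /(pathP x) hp.
have back i : (i <= size p)%N -> iter i (obind prev) (Some (nth x (x :: p) i)) = Some x.
  by elim: i => [//|i IH] ip; rewrite iterSr /= (eqP (hp i ip)) IH // ltnW.
have none k : iter k (obind prev) None = None by elim: k => //= k ->.
apply/(uniqP x); suff H i j : (i < j)%N -> (j < (size p).+1)%N ->
    nth x (x :: p) i <> nth x (x :: p) j.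
  move=> i j; rewrite !inE /= => ip jp ij.
  by case: (ltngtP i j) => // lt; [case: (H i j lt jp)|case: (H j i lt ip)].
move=> ij jp E; have := back j jp; rewrite -(subnK (ltnW ij)) iterD subnK ?(ltnW ij) // -E.
rewrite back; last by rewrite (leq_trans (ltnW ij)).
have : (0 < j - i)%N by rewrite subn_gt0.
by case: (j - i)%N => // k _; rewrite iterSr /= px none.
Qed.

Section Trail.
Variables (N : nat) (s : config N).
Implicit Types (u z : dvertex) (d : dir).
Notation S := (ext (bc false) s).
Notation box := (in_window 0 N.+1%:Z 0 N.+1%:Z).

(** Value of the spin at the second site of [dsep u d] when the walker has plus on the left. *)
Definition orient d : bool := match d with DE | DS => true | _ => false end.

(** The two definitions differ only for edges with both sites outside the box, and within the window
    the boundary condition changes sign along such an edge only at [dstart] and [dtarget]. *)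
Lemma dedge_regular u d : box u -> u != dstart -> u != dtarget N ->
  dedge_in s u d = disagree S (dsep u d).
Proof.
move=> bu us ut; apply/idP/idP => [/dedge_bond /andP[] //|dis].
have be := is_bond_dsep u d; rewrite /dedge_in.
case E : (dsep u d) dis be => [p q] dis be.
rewrite !spin_ext -/(disagree S (p, q)) dis andbT !in_box_inrect.
apply: contraLR dis; rewrite negb_or => /andP[np nq].
rewrite /disagree negbK /= !ext_out // /bc /dobrushin /=.
case: u d E bu us ut => a b d E; rewrite /in_window /dstart /dtarget !xpair_eqE /= => bu us ut.
move: np nq; rewrite /inrect; case: d E => -[<- <-] /=; lia.
Qed.

Lemma next_dir_dstart d : next_dir s dstart d = None.
Proof.
suff E : ddegree s dstart = 1%N by rewrite /next_dir E.
have S1 : S (0 - 1, 0) by rewrite ext_out // /inrect /=; lia.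
have S2 : S (0, 0 - 1) = false by rewrite ext_out // /inrect /=; lia.
by rewrite /ddegree /dedge_in /= !spin_ext S1 S2; case: (S _).
Qed.

(** The south-east rule pairs the edges at a vertex, so a step can be undone, and it keeps plus on
    the left. Checked on the 16 patterns of surrounding spins. *)
Lemma next_dir_regular u din d : box u -> u != dstart -> u != dtarget N ->
  dedge_in s u din -> next_dir s u din = Some d ->
  [/\ dedge_in s u d, next_dir s u d = Some din &
      S (dsep u din).2 = ~~ orient din -> S (dsep u d).2 = orient d].
Proof.
move=> bu us ut; rewrite /next_dir /ddegree /=.
have E c := dedge_regular c bu us ut; rewrite !E {E} /disagree.
case: u {bu us ut} => a b /=.
case e1 : (S (a - 1, b)); case e2 : (S (a, b)); case e3 : (S (a, b - 1)); case e4 : (S (a - 1, b - 1));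
  by case: din => //= E1; case: d => //=; rewrite ?e1 ?e2 ?e3 ?e4 //; move: E1; rewrite ?e1 ?e2 ?e3 ?e4 //.
Qed.

Lemma dsep_rev u d : dsep (dstep u d) (Defs.dopp d) = dsep u d.
Proof. by case: u => a b; case: d => /=; congr (_, _, (_, _)); lia. Qed.

Lemma dstepK u d : dstep (dstep u d) (Defs.dopp d) = u.
Proof. by case: u => a b; case: d => /=; congr (_, _); lia. Qed.

Lemma doppK d : Defs.dopp (Defs.dopp d) = d. Proof. by case: d. Qed.

Lemma dedge_rev u d : dedge_in s (dstep u d) (Defs.dopp d) = dedge_in s u d.
Proof. by rewrite /dedge_in dsep_rev. Qed.

Definition dart := (dvertex * dir)%type.

Fixpoint walk_darts (f : nat) u (din : dir) : seq dart :=
  if u == dtarget N then [::] else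
  match f with
  | 0 => [::]
  | f'.+1 => if next_dir s u din is Some d then (u, d) :: walk_darts f' (dstep u d) (Defs.dopp d) else [::]
  end.

Definition dart_end (x : dart) : dvertex := dstep x.1 x.2.

Lemma walk_dartsE f u din : walk s f u din = map dart_end (walk_darts f u din).
Proof.
elim: f u din => [|f IH] u din /=; case: ifP => //= _.
by case: next_dir => //= d; rewrite IH.
Qed.

Lemma wbonds_walk f u din : wbonds u (map snd (walk_darts f u din)) =
  [seq dsep x.1 x.2 | x <- walk_darts f u din].
Proof.
elim: f u din => [|f IH] u din /=; case: ifP => //= _.
by case: next_dir => //= d; rewrite IH.
Qed.

Lemma wverts_walk f u din :
  wverts u (map snd (walk_darts f u din)) = u :: map dart_end (walk_darts f u din).
Proof.
elim: f u din => [|f IH] u din /=; case: ifP => //= _.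
by case: next_dir => //= d; rewrite IH.
Qed.

Definition prev_dart (x : dart) : option dart :=
  if next_dir s x.1 x.2 is Some din then Some (dstep x.1 din, Defs.dopp din) else None.

Definition good_dart (x : dart) : bool :=
  dedge_in s x.1 x.2 && (S (dsep x.1 x.2).2 == orient x.2).

Lemma walk_darts_good f u din : dedge_in s u din -> S (dsep u din).2 = ~~ orient din ->
  path (fun a b => prev_dart b == Some a) (dstep u din, Defs.dopp din) (walk_darts f u din)
  && all good_dart (walk_darts f u din).
Proof.
elim: f u din => [|f IH] u din eu ou /=; case: ifP => // /negbT ut.
case E : next_dir => [d|//].
have us : u != dstart by apply/eqP => u0; rewrite u0 next_dir_dstart in E.
have bu : box u by have /andP[/bonds_window /andP[]] := dedge_bond eu.
have [ed pd od] := next_dir_regular bu us ut eu E.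
have := IH (dstep u d) (Defs.dopp d); rewrite dedge_rev dsep_rev (od ou) dstepK doppK => /(_ ed).
have -> : orient d = ~~ orient (Defs.dopp d) by case: d {E ed pd od}.
move=> /(_ erefl) /andP[h1 h2] /=.
by rewrite {1}/prev_dart pd eqxx h1 h2 /good_dart ed od // eqxx.
Qed.

(** A bond belongs to two darts of opposite directions; only one of them has plus on its left.
    Distinct darts of the walk thus give distinct bonds. *)
Lemma good_dart_inj x y : good_dart x -> good_dart y -> dsep x.1 x.2 = dsep y.1 y.2 -> x = y.
Proof.
case: x y => [u d] [u' d']; rewrite /good_dart /= => /andP[_ /eqP o] /andP[_ /eqP o'] E.
have oo : orient d = orient d' by rewrite -o -o' E.
case: u u' E {o o'} => a b [a' b'].
case: d d' oo => -[] //= _ [] *; congr (_, _, _); lia.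
Qed.

Lemma interface_trail : exists w : seq dir,
  [/\ interface s = wverts dstart w, uniq (wbonds dstart w) &
      trail_in (n := N.+1) (m := N.+1) (bc false) (wbonds dstart w) s].
Proof.
rewrite /interface; move: (walk_fuel N) => fuel; case E : ohead => [d|]; last by exists [::].
have ed : dedge_in s dstart d.
  have : d \in [seq d <- alldirs | dedge_in s dstart d].
    by move: E; case: [seq c <- alldirs | dedge_in s dstart c] => [|c l] //= [->]; rewrite inE eqxx.
  by rewrite mem_filter => /andP[].
have od : S (dsep dstart d).2 = orient d.
  have S1 : S (0 - 1, 0) by rewrite ext_out // /inrect /=; lia.
  have S2 : S (0, 0 - 1) = false by rewrite ext_out // /inrect /=; lia.
  by move: ed; rewrite /dedge_in; case: d {E} => //=; rewrite !spin_ext ?S1 ?S2; case: (S _).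
pose D := (dstart, d) :: walk_darts fuel (dstep dstart d) (Defs.dopp d).
have /andP[pD gD] := @walk_darts_good fuel (dstep dstart d) (Defs.dopp d)
   (etrans (dedge_rev _ _) ed) (etrans (etrans (congr1 (fun e => S e.2) (dsep_rev _ _)) od)
     (ltac:(by case: (d)) : orient d = ~~ orient (Defs.dopp d))).
rewrite dstepK doppK in pD.
have gD' : all good_dart D by rewrite /= gD andbT /good_dart ed od /=.
have uD : uniq D.
  by apply: uniq_backtrack pD; rewrite /prev_dart next_dir_dstart.
have wD : wbonds dstart (map snd D) = [seq dsep x.1 x.2 | x <- D] by rewrite /= wbonds_walk.
exists (map snd D); split.
- by rewrite walk_dartsE /= wverts_walk.
- by rewrite wD map_inj_in_uniq // => x y /(allP gD') gx /(allP gD') gy; exact: good_dart_inj.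
- rewrite wD; apply/allP => e /mapP[x /(allP gD') /andP[xe _] ->].
  exact: dedge_bond xe.
Qed.

End Trail.

(** * Long and short interfaces *)

Lemma wend_home a b : wend (a%:Z, b%:Z) (nseq a DW ++ nseq b DS) = dstart.
Proof.
rewrite wend_cat; have -> : wend (a%:Z, b%:Z) (nseq a DW) = (0, b%:Z).
  elim: a => [//|a IH] /=; rewrite -[RHS]IH; congr (wend (_, _) _); lia.
by elim: b => [//|b IH] /=; rewrite -[RHS]IH; congr (wend (_, _) _); lia.
Qed.

Lemma window_home (n a b : nat) : (a <= n)%N -> (b <= n)%N ->
  all (in_window 0 n%:Z 0 n%:Z) (wverts (a%:Z, b%:Z) (nseq a DW ++ nseq b DS)).
Proof.
move=> an bn; rewrite wverts_cat.
have -> : wend (a%:Z, b%:Z) (nseq a DW) = (0, b%:Z).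
  elim: a {an} => [//|a IH] /=; rewrite -[RHS]IH; congr (wend (_, _) _); lia.
apply/andP; split.
  elim: a an => [|a IH] an /=; first by rewrite /in_window /=; lia.
  have -> : a.+1%:Z - 1 = a%:Z by lia.
  by rewrite IH ?(ltnW an) // andbT /in_window /=; lia.
elim: b bn => [|b IH] bn /=; first by rewrite /in_window /=; lia.
have -> : b.+1%:Z - 1 = b%:Z by lia.
by rewrite IH ?(ltnW bn) // andbT /in_window /=; lia.
Qed.

Section LongInterface.
Variables (R : realType) (x : R) (N : nat).
Hypotheses (x0 : 0 < x) (x1 : x < 1).
Notation Z := (@Zf R x N.+1 N.+1).
Notation trail_in := (@trail_in N.+1 N.+1 (bc false)).

(* A trail starting at dstart is closed up by a straight path, whose length
   is at most 2 (N + 1), before flipping *)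
Lemma trail_weight t : (0 < size t)%N -> uniq (wbonds dstart t) ->
  x ^+ (2 * N.+1) * (\sum_(s | trail_in (wbonds dstart t) s) wgt x (bc false) 0 s)
  <= x ^+ size t * Z (bc false) 0 predT.
Proof.
move=> t0 ut; have nn : 0 <= x ^+ size t * Z (bc false) 0 predT by rewrite mulr_ge0 ?exprn_ge0 ?Zf_ge0 // ltW.
have [/existsP[s ts]|/existsPn no] := boolP [exists s, trail_in (wbonds dstart t) s]; last first.
  by rewrite big1 ?mulr0 // => s sc; have := no s; rewrite sc.
have win : all (in_window 0 N.+1%:Z 0 N.+1%:Z) (wverts dstart t).
  by apply: wverts_window => // e /(allP ts) /andP[].
have lastin : wend dstart t \in wverts dstart t.
  elim: (t) (dstart) => [|d w IH] u /=; first by rewrite inE.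
  by rewrite inE IH orbT.
have := allP win _ lastin; rewrite /in_window => ew.
pose a := absz (wend dstart t).1; pose b := absz (wend dstart t).2.
have E : wend dstart t = (a%:Z, b%:Z).
  by rewrite /a /b; case: (wend dstart t) ew => c d /= ew; congr pair; lia.
have an : (a <= N.+1)%N by move: ew; rewrite E /=; lia.
have bn : (b <= N.+1)%N by move: ew; rewrite E /=; lia.
pose r := nseq a DW ++ nseq b DS.
have cl : wend dstart (t ++ r) = dstart by rewrite wend_cat E wend_home.
have box : all (in_window 0 N.+1%:Z 0 N.+1%:Z) (wverts dstart (t ++ r)).
  by rewrite wverts_cat win E window_home.
apply: le_trans (peierls (bc false) x0 x1 cl box ut).
apply: ler_wpM2r; first by apply: sumr_ge0 => q _; exact: ltW (wgt_gt0 x0 _ _ _).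
apply: ler_wiXn2l; rewrite ?(ltW x0) ?(ltW x1) // size_cat !size_nseq; lia.
Qed.

Lemma long_interface l : (0 < l)%N ->
  x ^+ (2 * N.+1) * Z (bc false) 0 (fun s => (l < size (interface s))%N) <=
  (4 * x) ^+ l * Z (bc false) 0 predT.
Proof.
move=> l0.
have wp (s : rect N.+1 N.+1) : 0 <= wgt x (bc false) 0 s by exact: ltW (wgt_gt0 x0 _ _ _).
pose ok (w : l.-tuple 'I_4) s := uniq (wbonds dstart (dirs w)) && trail_in (wbonds dstart (dirs w)) s.
have cover (s : rect N.+1 N.+1) : (l < size (interface s))%N -> exists w, ok w s.
  have [w [-> uw tw]] := interface_trail s.
  have -> : size (wverts dstart w) = (size w).+1.
    by elim: (w) (dstart) => //= d v IH u; rewrite IH.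
  (* Only the first [l] edges of the interface are kept, so that a union bound over the words of
     length exactly [l] suffices. *)
  rewrite ltnS => lw; have [w' E] := dirs_surj (take l w).
  have sl : size (take l w) = l by rewrite size_takel.
  exists (tcast sl w'); rewrite /ok; have -> : dirs (tcast sl w') = take l w by rewrite /dirs val_tcast.
  have cat : wbonds dstart w = wbonds dstart (take l w) ++ wbonds (wend dstart (take l w)) (drop l w).
    by rewrite -wbonds_cat cat_take_drop.
  move: uw tw; rewrite cat cat_uniq /trail_in all_cat => /andP[uw _] /andP[tw _].
  by rewrite uw.
apply: le_trans (_ : x ^+ (2 * N.+1) * \sum_(w : l.-tuple 'I_4) \sum_(s | ok w s) wgt x (bc false) 0 s <= _).
  apply: ler_wpM2l; first by rewrite exprn_ge0 // ltW.
  rewrite /Zf big_mkcond /=; under [leRHS]eq_bigr do rewrite big_mkcond /=.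
  rewrite exchange_big /=; apply: ler_sum => s _; case: ifP => [/cover[w ow]|_].
    rewrite (bigD1 w) //= ow lerDl; apply: sumr_ge0 => v _; by case: ifP.
  by apply: sumr_ge0 => v _; case: ifP.
rewrite big_distrr /=; apply: le_trans (_ : \sum_(w : l.-tuple 'I_4) x ^+ l * Z (bc false) 0 predT <= _); last first.
  by rewrite sumr_const card_tuple card_ord -[leLHS]mulr_natl natrX exprMn mulrA.
apply: ler_sum => w _; rewrite /ok.
case uw : (uniq _) => /=; last first.
  by rewrite big_pred0_eq mulr0 mulr_ge0 ?exprn_ge0 ?Zf_ge0 // ltW.
have sw : size (dirs w) = l by rewrite size_map size_tuple.
by have := @trail_weight (dirs w); rewrite sw; apply.
Qed.

End LongInterface.

Section ShortInterface.
Variables (R : realType) (x : R) (N : nat).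
Hypotheses (x0 : 0 < x) (x1 : x < 1).
Notation Z := (@Zf R x N.+1 N.+1).
Notation rect := (rect N.+1 N.+1).

Definition cell (s0 s : rect) : bool := [forall i in visited_sites s0, s i == s0 i].

(** The four functions inequality carries the field from the Dobrushin factor to the plus factor.
    The meet stays in the cell because the other configuration is plus on all frozen sites. *)
Lemma cell_le (s0 : rect) (lam : R) : 0 <= lam ->
  Z (bc false) lam (cell s0) * Z (bc true) 0 (plus_on (visited_sites s0)) <=
  Z (bc false) 0 (cell s0) * Z (bc true) lam (plus_on (visited_sites s0)).
Proof.
move=> l0; set A := visited_sites s0.
have := @Zf_four R x N.+1 N.+1 x0 x1 (bc false) (bc true) lam 0 0 lam (cell s0) (plus_on A) (cell s0) (plus_on A).
rewrite addrC lexx => /(_ erefl l0 isT).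
have -> : (fun w => bc false w && bc true w) = bc false by apply/funext => v; rewrite andbT.
have -> : (fun w => bc false w || bc true w) = bc true by apply/funext => v; rewrite orbT.
apply => s t /'forall_implyP sc /'forall_implyP tA; apply/andP; split; apply/'forall_implyP => i iA; rewrite ffunE.
  by rewrite (eqP (sc i iA)) tA // andbT.
by rewrite tA // orbT.
Qed.

(** A label for the cell of [s]: forgetting the unvisited spins does not change the interface, so
    the label still determines the visited sites. *)
Definition pattern_of (s : rect) : rect := [ffun i => (i \notin visited_sites s) || s i].

Lemma pattern_class (s0 s : rect) :
  (pattern_of s == pattern_of s0) = cell s0 s.
Proof.
have agree (a b : rect) : (forall i, i \in visited_sites a -> a i = b i) ->
    interface b = interface a /\ visited_sites b = visited_sites a.
  by move=> /interface_local E; rewrite /visited_sites E.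
have pat (a : rect) : visited_sites (pattern_of a) = visited_sites a.
  by apply: (agree a _ _).2 => i ia; rewrite ffunE ia.
apply/eqP/'forall_implyP => [E i iA|E].
  have V : visited_sites s = visited_sites s0 by rewrite -(pat s) E pat.
  by have /ffunP/(_ i) := E; rewrite !ffunE V iA /= => ->.
have V : visited_sites s = visited_sites s0.
  by apply: (agree s0 s _).2 => i iA; rewrite (eqP (E i iA)).
apply/ffunP => i; rewrite !ffunE V; case iA : (i \in _) => //=.
by rewrite (eqP (E i iA)).
Qed.

(* Every event carried by short interfaces splits into cells on which the
   spins around the interface are frozen *)
Lemma short_interface (l : nat) (lam kappa E : R) (G : pred (seq dvertex)) :
  0 <= lam -> 0 <= kappa ->
  (forall i : 'I_N.+1 * 'I_N.+1, \sum_(s : rect) wgt x (bc true) 0 s * #|cluster s i|%:R <= kappa * Z (bc true) 0 predT) ->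
  Z (bc false) 0 predT * Z (bc true) lam predT <= expR E * (Z (bc true) 0 predT * Z (bc false) lam predT) ->
  Z (bc false) lam (fun s => G (interface s) && (size (interface s) <= l)%N) * Z (bc false) 0 predT <=
  expR (2 * lam * kappa * (4 * l)%:R + E) *
    (Z (bc false) 0 (fun s => G (interface s)) * Z (bc false) lam predT).
Proof.
move=> l0 k0 kap ratio; set E1 := 2 * lam * kappa * _.
pose P (s : rect) := G (interface s) && (size (interface s) <= l)%N.
apply: le_trans (_ : expR (E1 + E) * (Z (bc false) 0 P * Z (bc false) lam predT) <= _); last first.
  rewrite ler_pM2l ?expR_gt0 // ler_pM2r ?Zbc_gt0 // /Zf [leLHS]big_mkcond [leRHS]big_mkcond /=.
  apply: ler_sum => s _; rewrite /P; case: (G _) => //=; case: ifP => // _; exact: ltW (wgt_gt0 x0 _ _ _).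
have part mu : Z (bc false) mu P = \sum_t \sum_(s | P s && (pattern_of s == t)) wgt x (bc false) mu s.
  by rewrite /Zf (partition_big pattern_of xpredT).
rewrite (part lam) (part 0) !big_distrl big_distrr /=; apply: ler_sum => t _.
have [/existsP[s0 /andP[Ps0 /eqP st]]|/existsPn no] := boolP [exists s, P s && (pattern_of s == t)]; last first.
  rewrite !big_pred0 ?mul0r ?mulr0 // => s; by have /negbTE := no s.
set A := visited_sites s0.
have cellE mu : \sum_(s | P s && (pattern_of s == t)) wgt x (bc false) mu s =
    Z (bc false) mu (cell s0).
  apply: eq_bigl => s; rewrite -st pattern_class; case: (boolP (cell s0 s)) => sA; rewrite ?andbF // andbT.
  have -> : P s = P s0; last by rewrite Ps0.
  rewrite /P (@interface_local _ s0 s) // => i iA.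
  by have /'forall_implyP/(_ i iA)/eqP -> := sA.
(* [cell_le] transfers the field to the pinned plus measure, [pinned_plus] removes the pinning, and
   [ratio] returns to the Dobrushin partition functions. *)
rewrite !cellE; have h1 := cell_le s0 l0; rewrite -/A in h1.
have h2 := pinned_plus x0 x1 A l0 kap.
have cA : (#|A| <= 4 * l)%N.
  by apply: leq_trans (visited_card s0) _; rewrite leq_mul2l; case/andP: Ps0.
have h2' : Z (bc true) lam (plus_on A) * Z (bc true) 0 predT <=
    expR E1 * (Z (bc true) 0 (plus_on A) * Z (bc true) lam predT).
  apply: le_trans h2 _; apply: ler_wpM2r; first by rewrite mulr_ge0 // Zf_ge0.
  by rewrite ler_expR ler_wpM2l ?ler_nat // !mulr_ge0.
have bp : 0 < Z (bc true) 0 (plus_on A).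
  by apply: (@Zf_gt0 _ _ _ _ x0 _ _ _ [ffun=> true]); apply/'forall_implyP => i _; rewrite ffunE.
have zp := @Zbc_gt0 R x x0 N.+1 N.+1 true 0.
have zm := @Zbc_gt0 R x x0 N.+1 N.+1 false 0.
set a := Z (bc false) lam (cell s0) in h1 *; set c := Z (bc false) 0 (cell s0) in h1 *.
set b := Z (bc true) 0 (plus_on A) in h1 h2' bp; set d := Z (bc true) lam (plus_on A) in h1 h2'.
set z0 := Z (bc true) 0 predT in ratio h2' zp; set zl := Z (bc true) lam predT in ratio h2'.
set m0 := Z (bc false) 0 predT in ratio zm *; set ml := Z (bc false) lam predT in ratio *.
have c0 : 0 <= c by exact: Zf_ge0.
rewrite -(ler_pM2r bp) -(ler_pM2r zp).
apply: le_trans (_ : c * d * m0 * z0 <= _).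
  by rewrite ler_pM2r // [leLHS]mulrAC ler_pM2r.
apply: le_trans (_ : c * m0 * (expR E1 * (b * zl)) <= _).
  have -> : c * d * m0 * z0 = c * m0 * (d * z0) by ring.
  by rewrite ler_wpM2l // mulr_ge0 // ltW.
have -> : c * m0 * (expR E1 * (b * zl)) = c * expR E1 * b * (m0 * zl) by ring.
have -> : expR (E1 + E) * (c * ml) * b * z0 = c * expR E1 * b * (expR E * (z0 * ml)) by rewrite expRD; ring.
by rewrite ler_wpM2l // !mulr_ge0 // ?expR_ge0 // ltW.
Qed.

End ShortInterface.

(** * Choice of the parameters *)

Lemma floor_cbrt (N : nat) : (0 < N)%N ->
  exists h, [/\ (0 < h)%N, (h ^ 3 <= N)%N & (N < h.+1 ^ 3)%N].
Proof.
elim: N => [//|[_ _|N IH _]]; first by exists 1%N.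
have [h [h0 hN Nh]] := IH isT.
have [lt|ge] := ltnP N.+2 (h.+1 ^ 3); first by exists h; split => //; exact: leqW.
exists h.+1; split => //; apply: leq_ltn_trans Nh _.
by rewrite ltn_exp2r.
Qed.

Lemma double_le_cube h : (2 * h <= (h ^ 3).+1)%N.
Proof.
case: h => [|[|h]] //; apply: leqW; rewrite [(_ ^ 3)%N]expnS mulnC leq_mul2l /=.
by rewrite expnS expn1 (leq_trans _ (leq_pmulr _ _)).
Qed.

Lemma ler_cbrt (R : realType) (h N : nat) : (h ^ 3 <= N)%N -> h%:R <= N%:R `^ (3^-1) :> R.
Proof.
move=> hN; have -> : h%:R = (h ^ 3)%:R `^ 3^-1 :> R.
  rewrite natrX -powR_mulrn ?ler0n // -powRrM divff ?powRr1 ?ler0n //.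
by rewrite ge0_ler_powR ?nnegrE ?ler0n ?ler_nat // invr_ge0.
Qed.

Lemma mu_interfaceE (R : realType) (beta lam : R) N (G : pred (seq dvertex)) :
  mu_interface beta lam N G =
  Zf (n := N.+1) (m := N.+1) (expR (- (2 * beta))) (bc false) lam (fun s => G (interface s)) /
  Zf (n := N.+1) (m := N.+1) (expR (- (2 * beta))) (bc false) lam predT.
Proof.
by rewrite /mu_interface /Zf; congr (_ / _); apply: eq_bigr => s _; exact: gibbs_weightE.
Qed.

(** exp beta exceeds 1 + sqrt 2 >= 2, hence x < 1/4; and [tau_exp] is below 1 as soon as x^2 + 2 x <
    1. *)
Lemma peierls_regime (R : realType) (beta : R) : beta_c R < beta ->
  [/\ 0 < beta, 4 * expR (- (2 * beta)) < 1 & tau_exp (expR (- (2 * beta))) < 1].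
Proof.
move=> hb; pose y := expR (- beta).
have y0 : 0 < y by exact: expR_gt0.
have s1 : 1 <= Num.sqrt 2 :> R by rewrite -[leLHS]sqrtr1 ler_sqrt //; lra.
have y2 : 2 * y < 1.
  have : 1 + Num.sqrt 2 < expR beta.
    rewrite -[X in X < _]lnK ?ltr_expR // posrE; lra.
  have -> : y = (expR beta)^-1 by rewrite /y expRN.
  have bp : 0 < expR beta by exact: expR_gt0.
  by move=> lt; rewrite ltr_pdivrMr // mul1r; lra.
have b0 : 0 < beta.
  by rewrite -oppr_lt0 -expR_lt1 -/y; lra.
have E : expR (- (2 * beta)) = y * y.
  by rewrite /y -expRD; congr expR; ring.
have yy : y * y < 4^-1.
  have : y * (2 * y) < y * 1 by rewrite ltr_pM2l.
  by lra.
rewrite E; split => //; first by lra.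
rewrite /tau_exp; have p : 0 < y * y by rewrite mulr_gt0.
rewrite ltr_pdivrMr; last by lra.
have : (y * y) * (y * y) < (y * y) * 4^-1 by rewrite ltr_pM2l.
by lra.
Qed.

Lemma short_exponent_le (R : realFieldType) (lam kappa C K M N h q : R) :
    0 <= lam -> 0 <= kappa -> 0 <= C -> 0 <= K -> 0 <= N -> 1 <= h -> M <= 2 * N -> q <= 16 * h ->
  2 * lam * kappa * (4 * (K * N)) + (4 * lam * (M * h) + C * (h + q))
    <= (8 * (lam * N) * kappa * K + 8 * (lam * N) + 17 * C) * h.
Proof.
move=> l0 k0 C0 K0 N0 h1 MN qh.
have e1 : 8 * (lam * N) * kappa * K * 1 <= 8 * (lam * N) * kappa * K * h by rewrite ler_wpM2l // !mulr_ge0.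
have h0 : 0 <= h by exact: le_trans h1.
have e2 : 4 * lam * (M * h) <= 4 * lam * (2 * N * h) by rewrite ler_wpM2l ?mulr_ge0 // ler_wpM2r.
have e3 : C * (h + q) <= C * (17 * h) by rewrite ler_wpM2l //; lra.
have -> : 2 * lam * kappa * (4 * (K * N)) = 8 * (lam * N) * kappa * K * 1 by ring.
apply: le_trans (lerD e1 (lerD e2 e3)) _.
by rewrite le_eqVlt; apply/orP; left; apply/eqP; ring.
Qed.

Lemma long_exponent_le (R : realFieldType) (beta lam d M N : R) :
    0 <= beta -> 0 <= lam -> 0 <= N -> 0 <= M -> M <= 2 * N -> 8 * beta + 8 * (lam * N) + 1 <= d ->
  2 * (lam * (M * M)) + (4 * beta * M - d * N) <= - N.
Proof.
move=> b0 l0 N0 M0 MN dB.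
have e1 : lam * (M * M) <= lam * (2 * N * (2 * N)) by rewrite ler_wpM2l // ler_pM.
have e2 : 4 * beta * M <= 4 * beta * (2 * N) by rewrite ler_wpM2l // mulr_ge0.
have e3 := ler_wpM2r N0 dB.
have {e1} : 2 * (lam * (M * M)) <= 8 * (lam * N) * N.
  have -> : 8 * (lam * N) * N = 2 * (lam * (2 * N * (2 * N))) by ring.
  by rewrite ler_wpM2l.
rewrite mulrDl mul1r mulrDl in e3.
move: e2 e3; set X := 4 * beta * M; set Y := 8 * beta * N; set Z := 2 * (lam * _); set W := 8 * (lam * N) * N.
have -> : 4 * beta * (2 * N) = Y by rewrite /Y; ring.
set V := d * N => *; lra.
Qed.

Theorem theorem4p1 (R : realType) (beta c_lambda : R) :
  beta_c R < beta -> 0 < c_lambda ->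
  exists C1 C2 : R, 0 < C1 /\ 0 < C2 /\
    forall (N : nat) (Gamma : pred (seq dvertex)),
      (0 < N)%N ->
      (forall g, Gamma g -> admissible N g) ->
      mu_interface beta (c_lambda / N%:R) N Gamma
        <= expR (C1 * (N%:R `^ (3^-1))) * mu_interface beta 0 N Gamma
           + expR (- (C2 * N%:R)).
Proof.
move=> hb c0; have [b0 x4 t1] := peierls_regime hb.
set x := expR (- (2 * beta)) in x4 t1.
have x0 : 0 < x by exact: expR_gt0.
have x1 : x < 1 by lra.
have [kappa k0 Hk] := poly4_geometric_bound (mulr_gt0 (ltr0n R 4) x0) x4.
have [C C0 HC] := field_ratio x0 x1 t1.
pose c := c_lambda.
pose dlt := - ln (4 * x).
have q0 : 0 < 4 * x by rewrite mulr_gt0.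
have d0 : 0 < dlt by rewrite oppr_gt0 ln_lt0 // q0.
(* What a long interface must pay per unit of N: 8 beta for the closing path of 2 (N + 1) steps, 8 c
   for the field in numerator and denominator, and 1 for the final decay. [K] makes (4 x)^(K N) pay
   it. *)
pose B := 8 * beta + 8 * c + 1.
have Bp : 0 < B by rewrite /B /c; lra.
have := archi_boundP (ltW (divr_gt0 Bp d0)); set K := Num.bound _ => BK.
have Kp : 0 < K%:R :> R by apply: lt_trans BK; exact: divr_gt0.
have K0 : (0 < K)%N by rewrite -(ltr0n R).
have {}BK : B <= K%:R * dlt by rewrite -ler_pdivrMr // ltW.
pose C1 := 8 * c * kappa * K%:R + 8 * c + 17 * C.
have C1p : 0 < C1 by rewrite /C1 !addr_gt0 ?mulr_gt0.
exists C1, 1; split => //; split => // N G N0 _.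
have Np : 0 < N%:R :> R by rewrite ltr0n.
have N1 : 1 <= N%:R :> R by rewrite ler1n.
set lam := c_lambda / N%:R.
have l0 : 0 <= lam by rewrite divr_ge0 ?ler0n // ltW.
have lN : lam * N%:R = c by rewrite /lam divfK // gt_eqF.
rewrite !mu_interfaceE -/x.
pose l := (K * N)%N.
have lpos : (0 < l)%N by rewrite muln_gt0 K0.
have [h [h0 hN Nh]] := floor_cbrt N0.
have hp : 0 < h%:R :> R by rewrite ltr0n.
have h1 : 1 <= h%:R :> R by rewrite ler1n.
have h2 : (2 * h <= N.+1)%N.
  by apply: leq_trans (_ : (h ^ 3).+1 <= _)%N; [exact: double_le_cube|rewrite ltnS].
have n2 : N.+1%:R <= 2 * N%:R :> R by rewrite -natr1; lra.
(* N + 1 <= 2 N and N <= (h + 1)^3 <= 8 h^3, whence 16. *)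
have nh : N.+1%:R / h%:R ^+ 2 <= 16 * h%:R :> R.
  rewrite ler_pdivrMr ?exprn_gt0 //; apply: le_trans n2 _.
  have : N%:R <= (h.+1 ^ 3)%:R :> R by rewrite ler_nat ltnW.
  rewrite natrX -natr1 => H.
  have h3 : h%:R + 1 <= 2 * h%:R :> R by lra.
  have : (h%:R + 1) ^+ 3 <= (2 * h%:R) ^+ 3 :> R by rewrite lerXn2r ?nnegrE //; lra.
  by rewrite !exprS expr0 !mulr1 in H *; nra.
set E := 4 * lam * (N.+1%:R * h%:R) + C * (h%:R + N.+1%:R / h%:R ^+ 2).
have ratio := HC N.+1 h lam l0 h0 h2; rewrite -/E in ratio.
have kap (i : 'I_N.+1 * 'I_N.+1) : \sum_s wgt x (bc true) 0 s * #|cluster s i|%:R <=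
    kappa * Zf (n := N.+1) (m := N.+1) x (bc true) 0 predT.
  apply: le_trans (cluster_size_le x0 x1 i) _.
  by apply: ler_wpM2r; [exact: Zf_ge0|exact: Hk].
have short := @short_interface R x N x0 x1 l lam kappa E G l0 (ltW k0) kap ratio.
have long := @long_interface R x N x0 x1 l lpos.
have zl := @Zbc_gt0 R x x0 N.+1 N.+1 false lam.
have z0 := @Zbc_gt0 R x x0 N.+1 N.+1 false 0.
set Zl := Zf x (bc false) lam predT in short zl *.
set Z0 := Zf x (bc false) 0 predT in short long z0 *.
set g0 := Zf x (bc false) 0 (fun s => G (interface s)) in short *.
set gs := Zf x (bc false) lam (fun s => G (interface s) && _) in short.
set g := Zf x (bc false) lam _.
have g0p : 0 <= g0 by exact: Zf_ge0.
set b0' := Zf x (bc false) 0 _ in long.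
pose bl := Zf (n := N.+1) (m := N.+1) x (bc false) lam (fun s => (l < size (interface s))%N).
have split_g : g <= gs + bl.
  rewrite /g /gs /bl /Zf [leLHS]big_mkcond [X in _ <= X + _]big_mkcond [X in _ <= _ + X]big_mkcond -big_split /=.
  apply: ler_sum => s _; have w0 := wgt_gt0 x0 (bc false) lam s.
  by case: (G _) => /=; case: leqP => _; rewrite ?addr0 ?add0r // ltW.
have S1 : gs / Zl <= expR (C1 * N%:R `^ 3^-1) * (g0 / Z0).
  apply: le_trans (_ : expR (2 * lam * kappa * (4 * l)%:R + E) * (g0 / Z0) <= _).
    rewrite ler_pdivrMr // -(ler_pM2r z0); apply: le_trans short _.
    by rewrite le_eqVlt; apply/orP; left; apply/eqP; field; rewrite gt_eqF.
  apply: ler_wpM2r; first by rewrite divr_ge0 // ltW.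
  rewrite ler_expR; apply: le_trans (_ : C1 * h%:R <= _); last by rewrite ler_pM2l // ler_cbrt.
  by rewrite /C1 /E /l !natrM -lN; apply: short_exponent_le => //; apply: ltW.
have S2 : bl / Zl <= expR (- (1 * N%:R)).
  have u : bl <= expR (lam * (N.+1 * N.+1)%:R) * b0' by exact: Zf_field_le.
  have v : expR (lam * - (N.+1 * N.+1)%:R) * Z0 <= Zl by apply: Zf_field_ge => // s _; exact: mag_ge.
  set M := lam * (N.+1 * N.+1)%:R in u.
  have vM : expR (- M) * Z0 <= Zl by rewrite /M -mulrN.
  have xE : x ^+ (2 * N.+1) = expR (- (4 * beta * N.+1%:R)).
    by rewrite /x -expRM_natl natrM; congr expR; ring.
  have qE : (4 * x) ^+ l = expR (- (dlt * K%:R * N%:R)).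
    by rewrite -[4 * x]lnK // -expRM_natl /l natrM /dlt; congr expR; ring.
  rewrite xE qE in long.
  rewrite ler_pdivrMr // mul1r.
  apply: le_trans u _.
  apply: le_trans (ler_wpM2l (expR_ge0 _) vM).
  have {}long : b0' <= expR (4 * beta * N.+1%:R - dlt * K%:R * N%:R) * Z0.
    rewrite -(ler_pM2l (expR_gt0 (- (4 * beta * N.+1%:R)))) mulrA -expRD.
    by have -> : - (4 * beta * N.+1%:R) + (4 * beta * N.+1%:R - dlt * K%:R * N%:R) = - (dlt * K%:R * N%:R) by ring.
  apply: le_trans (ler_wpM2l (expR_ge0 _) long) _.
  rewrite !mulrA -!expRD ler_pM2r // ler_expR.
  have := @long_exponent_le R beta lam (K%:R * dlt) N.+1%:R N%:R (ltW b0) l0 (ltW Np) (ler0n _ _) n2.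
  rewrite lN => /(_ BK) H; rewrite lerBrDr; apply: le_trans H; rewrite /M natrM.
  by rewrite le_eqVlt; apply/orP; left; apply/eqP; ring.
have := le_trans (_ : g / Zl <= gs / Zl + bl / Zl) (lerD S1 S2).
by apply; rewrite -mulrDl ler_pM2r // invr_gt0.
Qed.
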